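(* Fix $\gamma\in(0,1)$, $p\ge1$, $u_0>0$ and $A<0$. Let $u(t)$ be the unique solution of $D_c^{\gamma}u=Au^p$ with $u(0)=u_0$. Then $u(t)>0$ for all $t>0$, $u$ is decreasing, and $\lim_{t\to\infty}u(t)=0$. Moreover, there exists a constant $C(u_0,A,p)>0$ such that, when $t$ is large enough, $$u(t)\ge C(u_0,A,p)\,\frac{t^{-\gamma/p}}{\Gamma(1-\gamma)^{1/p}}.$$
   Context: Fix $\gamma\in(0,1)$. A function $u\in L^1_{loc}(0,T)$ has right limit $u(0+)=u_0$ at $t=0$ if $\lim_{t\to0+}\frac1t\int_0^t|u(s)-u_0|\,ds=0$. For such $u$, the (generalized) Caputo derivative is the distribution on $(-\infty,T)$ supported in $[0,T)$ given by $D_c^{\gamma}u=g_{-\gamma}*\big((u-u(0+))\theta(t)\big)$, where $\theta$ is the Heaviside function and $g_{-\gamma}=\frac{1}{\Gamma(1-\gamma)}D\big(\theta(t)t^{-\gamma}\big)$ with $D$ the distributional derivative. A strong solution of $D_c^\gamma u=f(u)$, $u(0)=u_0$, is such a $u$ with $u(0+)=u_0$, $D_c^{\gamma}u\in L^1(0,T)$, satisfying the equation almost everywhere. It is known that for continuous $u$ the problem is equivalent to the Volterra equation $u(t)=u_0+\frac{1}{\Gamma(\gamma)}\int_0^t(t-s)^{\gamma-1}f(u(s))\,ds$. For $f(u)=Au^p$ considered on $(0,\infty)$ and $u_0>0$, there is a unique continuous strong solution with values in $(0,\infty)$ on a maximal interval $[0,T_b)$, $T_b\in(0,\infty]$; if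 $T_b<\infty$ then $\liminf_{t\to T_b^-}u(t)=0$ or $\limsup_{t\to T_b^-}u(t)=\infty$. The claim includes that the solution exists for all $t>0$, i.e. $T_b=\infty$. The notation $C(u_0,A,p)$ means the constant depends only on $u_0,A,p$. *)

(* Defs.v *)
From HB Require Import structures.
From mathcomp Require Import all_boot all_order all_algebra.
From mathcomp Require Import all_classical all_reals all_analysis.

Set Implicit Arguments.
Unset Strict Implicit.
Unset Printing Implicit Defensive.

Import Order.TTheory GRing.Theory Num.Theory.
Import numFieldNormedType.Exports.

Local Open Scope classical_set_scope.
Local Open Scope ring_scope.

Definition Gamma (R : realType) (z : R) : R :=
  \int[@lebesgue_measure R]_(t in `]0, +oo[) (t `^ (z - 1) * expR (- t)).

(* A distribution on ]-oo, T[ is represented by its values on C_c^oo(]-oo, T[);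
   its values on other functions carry no meaning. *)
Definition functional (R : realType) : Type := (R -> R) -> R.

Definition test_function (R : realType) (T : R) (phi : R -> R) : Prop :=
  (forall (n : nat) (x : R), derivable (derive1n n phi) x 1) /\
  (let K := closure [set x | phi x != 0] in compact K /\ K `<=` `]-oo, T[).

Definition of_fun (R : realType) (v : R -> R) : functional R :=
  fun phi => \int[@lebesgue_measure R]_x (v x * phi x).

Definition distr_derive (R : realType) (d : functional R) : functional R :=
  fun phi => - d (derive1 phi).

(* <d * e, phi> = < d(s), < e(t), phi(s + t) > >.  For e supported in [0, +oo[,
   the function s |-> < e(t), phi(s + t) > is in general not compactly supported
   on the left; this is harmless when d is also supported in [0, +oo[. *)
Definition distr_conv (R : realType) (d e : functional R) : functional R :=
  fun phi => d (fun s => e (fun t => phi (s + t))).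

Definition heaviside (R : realType) : R -> R := \1_(`]0, +oo[ : set R).

(* g_{-gamma} *)
Definition g_neg (R : realType) (gamma : R) : functional R :=
  fun phi => (Gamma (1 - gamma))^-1 *
    distr_derive (of_fun (fun t => heaviside t * t `^ (- gamma))) phi.

(* The averages are extended real, so the limit being 0 forces `|u - u0| to be
   integrable near 0; Rintegral would return the junk value 0 instead of +oo. *)
Definition right_limit0 (R : realType) (u : R -> R) (u0 : R) : Prop :=
  ((t^-1)%:E * \int[@lebesgue_measure R]_(s in `]0%R, t[) `|u s - u0|%:E)%E
    @[t --> 0^'+] --> 0%E.

(* u is a function on ]0, T[; u0 stands for u(0+).  The cut-off at T makes
   (u - u0) theta a function on R, and does not affect the pairing with
   functions supported in ]-oo, T[. *)
Definition caputo (R : realType) (gamma T : R) (u : R -> R) (u0 : R) :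
    functional R :=
  distr_conv (g_neg gamma)
    (of_fun (fun t => (u t - u0) * heaviside t * \1_(`]-oo, T[ : set R) t)).

Definition strong_solution (R : realType) (gamma : R) (f : R -> R) (u0 T : R)
    (u : R -> R) : Prop :=
  [/\ locally_integrable `]0, T[ u,
      right_limit0 u u0 &
      exists h : R -> R,
        [/\ (@lebesgue_measure R).-integrable `]0, T[ (EFin \o h),
            forall phi, test_function T phi ->
              caputo gamma T u u0 phi =
              \int[@lebesgue_measure R]_(t in `]0, T[) (h t * phi t) &
            {ae @lebesgue_measure R, forall t, t \in `]0, T[ -> h t = f (u t)}]].

(* On [0, Tb[, with Tb possibly +oo, the equation is required on ]0, T[ for every
   finite T < Tb: D_c^gamma u need not be integrable up to Tb. *)
Definition positive_solution (R : realType) (gamma : R) (f : R -> R) (u0 : R)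
    (Tb : \bar R) (u : R -> R) : Prop :=
  [/\ {within [set t : R | 0 <= t /\ (t%:E < Tb)%E], continuous u},
      forall t : R, 0 <= t -> (t%:E < Tb)%E -> 0 < u t &
      forall T : R, 0 < T -> (T%:E < Tb)%E -> strong_solution gamma f u0 T u].

(* Every continuous positive solution is a restriction of (Tb, u); in particular
   Tb and the restriction of u to [0, Tb[ are unique. *)
Definition unique_maximal_solution (R : realType) (gamma : R) (f : R -> R)
    (u0 : R) (Tb : \bar R) (u : R -> R) : Prop :=
  [/\ (0 < Tb)%E,
      positive_solution gamma f u0 Tb u &
      forall (T : \bar R) (v : R -> R), (0 < T)%E ->
        positive_solution gamma f u0 T v ->
        (T <= Tb)%E /\ forall t : R, 0 <= t -> (t%:E < T)%E -> v t = u t].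

(* Main.v *)
Require Import Defs.
From HB Require Import structures.
From mathcomp Require Import all_boot all_order all_algebra.
From mathcomp Require Import all_classical all_reals all_analysis.
From mathcomp Require Import measurable_realfun ring lra.

Set Implicit Arguments.
Unset Strict Implicit.
Unset Printing Implicit Defensive.

Import Order.TTheory GRing.Theory Num.Theory.
Import numFieldNormedType.Exports.

Local Open Scope classical_set_scope.
Local Open Scope ring_scope.

(** Write [w = u0 - u] and let [F] be [- A * x `^ p], clamped to [0, u0]. Two forms
    of the problem are used side by side: the Volterra equation
      [u t = u0 - fracint (g - 1) (fun s => rate g * F (u s)) t],
    whose kernel is [(t - s) `^ (g - 1)], and the memory equation
      [fracint (- g) w t = Gamma (1 - g) * fracint 0 (fun s => F (u s)) t],
    in which [fracint (- g) w t] is the integral of [(t - s) `^ (- g) * w s] over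
    ]0, t[, the memory of [w], and [fracint 0] is ordinary integration. They are
    equivalent because [t `^ (- g)] and [t `^ (g - 1)] have a constant convolution.

    Existence. [F] is bounded and Lipschitz, hence Picard iteration gives a solution
    on the whole half-line ([volterra_exists]). It has values in ]0, u0], where the
    clamping is invisible, and the memory equation makes it a strong solution
    ([strong_solution_of_memory]).

    Uniqueness. The distributional equation, tested against smooth cutoffs, gives the
    memory equation ([weak_memory_equation]); the latter is inverted to the Volterra
    equation ([volterra_of_memory]), and a Gronwall argument concludes
    ([volterra_unique]). As the solution is global, it extends every other one.

    Monotonicity. A translate of [u] solves the equation of [u] with a smaller datum,
    and a comparison of the kernels at the last time of contact shows that it stays
    below [u] ([volterra_nonincreasing]).

    The remaining claims come from the gain of the two sides of the memory equation
    over an interval [t, t + h]. As [w] is nondecreasing, the left-hand side gains at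
    least the memory that time [t + h] keeps of the values of [w] on [0, h]
    ([memory_increment]), which is positive. The right-hand side gains the integral of
    [F (u s)] up to the factor [Gamma (1 - g)]. Therefore [u] cannot reach 0
    ([solution_gt0]), nor can it be constant on an interval ([solution_decreasing]).
    Bounding [w] by [u0] gives [F (u t) = O(t `^ (- g))], so that [u] tends to 0
    ([solution_cvg0]). Then [w >= u0 / 2] for large times, and the gains over [t, 2t] give
      [u0 / 8 * t `^ (- g) <= Gamma (1 - g) * F (u t)]
    ([solution_F_ge]). Solved for [u t], this is the lower bound, with the constant
    [(u0 / (8 * - A)) `^ p^-1], which depends on neither [g] nor [t]. *)

(** * Lipschitz functions and affine changes of variable *)

Lemma lipschitz_continuous {R : realType} (L : R) (f : R -> R) : 0 <= L ->
  (forall x y, `|f x - f y| <= L * `|x - y|) -> continuous f.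
Proof.
move=> L0 lipf x; apply/cvgrPdist_le => e e0.
have L10 : 0 < L + 1 by rewrite ltr_wpDl.
have d0 : 0 < e / (L + 1) by rewrite divr_gt0.
near=> y; apply: (le_trans (lipf _ _)).
have : `|x - y| <= e / (L + 1) by near: y; exact: (cvgr_dist_le _ x).
rewrite ler_pdivlMr// => h; apply: le_trans h.
by rewrite mulrDr mulr1 mulrC lerDl.
Unshelve. all: by end_near. Qed.

Section affine_change_of_variables.
Context {R : realType}.
Local Notation mu := (@lebesgue_measure R).
Local Open Scope ereal_scope.

Implicit Types (b c t : R).

Definition affine (c b x : R) : R := (c * x + b)%R.

Lemma continuous_affine c b : continuous (affine c b).
Proof.
by move=> x; apply: cvgD; [apply: cvgM; [exact: cvg_cst|exact: cvg_id]|exact: cvg_cst].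
Qed.

Lemma measurable_affine c b :
  measurable_fun [set: measurableTypeR R]
    (affine c b : measurableTypeR R -> measurableTypeR R).
Proof.
by apply: continuous_measurable_fun; exact: continuous_affine.
Qed.

(** The scaled image of the Lebesgue measure agrees with it on intervals, and the
    Lebesgue measure is the only measure with these values. *)
Lemma lebesgue_measure_affine c b (A : set (measurableTypeR R)) :
  (c != 0)%R -> measurable A -> mu A = `|c|%:E * mu (affine c b @^-1` A).
Proof.
move=> c0 mA.
pose pm := mscale (NngNum (normr_ge0 c))
  (pushforward mu (affine c b : measurableTypeR R -> measurableTypeR R)).
pose m : {measure set (measurableTypeR R) -> \bar R} :=
  pm (measurable_affine c b).
rewrite (_ : _ * _ = m A) //.
apply: lebesgue_measure_unique => // _ [[x y] _ <-] /=.
rewrite /m /pm /mscale/= /pushforward lebesgue_measure_itv /= lte_fin.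
have [cgt0|] := ltP 0%R c.
  have -> : affine c b @^-1` `]x, y] = `]((x - b) / c)%R, ((y - b) / c)%R]%classic.
    apply/seteqP; split=> z; rewrite /affine /= !in_itv /=.
      by rewrite ltr_pdivrMr// ler_pdivlMr// => /andP[]; lra.
    by rewrite ltr_pdivrMr// ler_pdivlMr// => /andP[]; lra.
  rewrite lebesgue_measure_itv /= lte_fin ltr_pM2r ?invr_gt0// ltrD2r.
  case: ifPn => _; last by rewrite mule0.
  by rewrite !EFinN -!EFinB -EFinM gtr0_norm//; congr EFin; field.
rewrite le_eqVlt (negbTE c0)/= => clt0.
have -> : affine c b @^-1` `]x, y] = `[((y - b) / c)%R, ((x - b) / c)%R[%classic.
  apply/seteqP; split=> z; rewrite /affine /= !in_itv /=.
    by rewrite ltr_ndivlMr// ler_ndivrMr// => /andP[]; lra.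
  by rewrite ltr_ndivlMr// ler_ndivrMr// => /andP[]; lra.
rewrite lebesgue_measure_itv /= lte_fin ltr_nM2r ?invr_lt0// ltrD2r.
case: ifPn => _; last by rewrite mule0.
by rewrite !EFinN -!EFinB -EFinM ltr0_norm//; congr EFin; field.
Qed.

Lemma ge0_integral_affine c b (f : R -> \bar R) : (c != 0)%R ->
  measurable_fun [set: R] f -> (forall x, 0 <= f x) ->
  \int[mu]_x f x = `|c|%:E * \int[mu]_x f (affine c b x).
Proof.
move=> c0 mf f0.
pose pm := mscale (NngNum (normr_ge0 c))
  (pushforward mu (affine c b : measurableTypeR R -> measurableTypeR R)).
pose m : {measure set (measurableTypeR R) -> \bar R} :=
  pm (measurable_affine c b).
rewrite (eq_measure_integral m); last first.
  by move=> A mA _; exact: (lebesgue_measure_affine b c0 mA).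
rewrite ge0_integral_mscale//; congr (_ * _).
by rewrite ge0_integral_pushforward//; exact: measurable_affine.
Qed.

Lemma ge0_integral_reflect t (f : R -> \bar R) :
  measurable_fun [set: R] f -> (forall x, 0 <= f x) ->
  \int[mu]_x f (t - x)%R = \int[mu]_x f x.
Proof.
move=> mf f0; rewrite [RHS](@ge0_integral_affine (-1)%R t)// ?oppr_eq0 ?oner_eq0//.
rewrite normrN normr1 mul1e; apply: eq_integral => x _.
by rewrite /affine mulN1r addrC.
Qed.

Lemma ge0_integral_shift t (f : R -> \bar R) :
  measurable_fun [set: R] f -> (forall x, 0 <= f x) ->
  \int[mu]_x f (x + t)%R = \int[mu]_x f x.
Proof.
move=> mf f0; rewrite [RHS](@ge0_integral_affine 1%R t)// ?oner_eq0//.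
by rewrite normr1 mul1e; apply: eq_integral => x _; rewrite /affine mul1r.
Qed.

End affine_change_of_variables.

(** * Convolution of nonnegative functions *)

Section convolution.
Context {R : realType}.
Local Notation mu := (@lebesgue_measure R).
Local Open Scope ereal_scope.
Implicit Types f g h : R -> \bar R.

(** Extended real values make Tonelli's theorem available without integrability
    conditions: associativity and commutativity hold for all nonnegative
    measurable functions, and finiteness is a separate question. *)
Definition conv f g (t : R) : \bar R := \int[mu]_s (f (t - s)%R * g s).

Definition mge0 f := measurable_fun [set: R] f /\ forall x, 0 <= f x.

Lemma mge0_reflect f t : mge0 f -> measurable_fun [set: R] (fun s => f (t - s)%R).
Proof.
move=> [mf _]; apply: (measurableT_comp mf).
exact: measurable_funB.
Qed.

Lemma mge0_integrand f g t : mge0 f -> mge0 g -> mge0 (fun s => f (t - s)%R * g s).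
Proof.
move=> f0 g0; split; last by move=> s; rewrite mule_ge0// ?f0.2 ?g0.2.
by apply: emeasurable_funM; [exact: mge0_reflect|exact: g0.1].
Qed.

Lemma conv_ge0 f g t : mge0 f -> mge0 g -> 0 <= conv f g t.
Proof. by move=> f0 g0; apply: integral_ge0 => s _; exact: (mge0_integrand t f0 g0).2. Qed.

Lemma mge0_conv f g : mge0 f -> mge0 g -> mge0 (conv f g).
Proof.
move=> f0 g0; split; last by move=> t; exact: conv_ge0.
pose F (p : measurableTypeR R * measurableTypeR R) : \bar R := f (p.1 - p.2)%R * g p.2.
apply: (@measurable_fun_fubini_tonelli_F _ _ (measurableTypeR R) (measurableTypeR R) R mu F).
  apply: emeasurable_funM.
    apply: (measurableT_comp f0.1).
    by apply: measurable_funB; [exact: measurable_fst|exact: measurable_snd].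
  by apply: (measurableT_comp g0.1); exact: measurable_snd.
by move=> p; rewrite mule_ge0// ?f0.2 ?g0.2.
Qed.

Lemma convC f g : mge0 f -> mge0 g -> conv f g = conv g f.
Proof.
move=> f0 g0; apply/funext => t; rewrite /conv.
rewrite -(ge0_integral_reflect t (mge0_integrand t f0 g0).1 (mge0_integrand t f0 g0).2).
by apply: eq_integral => s _; rewrite subKr muleC.
Qed.

(** Tonelli's theorem and translation invariance. *)
Lemma convA f g h : mge0 f -> mge0 g -> mge0 h ->
  conv f (conv g h) = conv (conv f g) h.
Proof.
move=> f0 g0 h0; apply/funext => t.
pose F (p : measurableTypeR R * measurableTypeR R) : \bar R :=
  f (t - p.1)%R * (g (p.1 - p.2)%R * h p.2).
transitivity (\int[mu]_s \int[mu]_r F (s, r)).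
  apply: eq_integral => s _; rewrite /F/= ge0_integralZl//.
  - exact: (mge0_integrand s g0 h0).1.
  - by move=> x _; exact: (mge0_integrand s g0 h0).2.
  - exact: f0.2.
have mF : measurable_fun setT F.
  apply: emeasurable_funM.
    apply: (measurableT_comp f0.1).
    by apply: measurable_funB => //; exact: measurable_fst.
  apply: emeasurable_funM.
    apply: (measurableT_comp g0.1).
    by apply: measurable_funB; [exact: measurable_fst|exact: measurable_snd].
  by apply: (measurableT_comp h0.1); exact: measurable_snd.
rewrite (@fubini_tonelli _ _ (measurableTypeR R) (measurableTypeR R) R mu mu F)//; last first.
  by move=> p; rewrite !mule_ge0// ?f0.2 ?g0.2 ?h0.2.
apply: eq_integral => r _; rewrite /F/=.
have fg := mge0_integrand (t - r)%R f0 g0.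
rewrite muleC -ge0_integralZl//=; last 3 first.
- exact: fg.1.
- by move=> s _; exact: fg.2.
- exact: h0.2.
rewrite -[RHS](ge0_integral_shift (- r)%R); last 2 first.
- by apply: emeasurable_funM => //; exact: fg.1.
- by move=> s; rewrite mule_ge0// ?h0.2// fg.2.
apply: eq_integral => s _ /=; rewrite muleA muleC.
by congr (_ * (f _ * _)); lra.
Qed.

Lemma convDr f g h t : mge0 f -> mge0 g -> mge0 h ->
  conv f (g \+ h) t = conv f g t + conv f h t.
Proof.
move=> f0 g0 h0; rewrite /conv -ge0_integralD//.
- by apply: eq_integral => s _; rewrite ge0_muleDr ?g0.2 ?h0.2.
- by move=> s _; exact: (mge0_integrand t f0 g0).2.
- exact: (mge0_integrand t f0 g0).1.
- by move=> s _; exact: (mge0_integrand t f0 h0).2.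
- exact: (mge0_integrand t f0 h0).1.
Qed.

Lemma convZr f g (c : R) t : mge0 f -> mge0 g -> (0 <= c)%R ->
  conv f (fun s => c%:E * g s) t = c%:E * conv f g t.
Proof.
move=> f0 g0 c0; rewrite /conv -ge0_integralZl//.
- by apply: eq_integral => s _; rewrite muleCA.
- exact: (mge0_integrand t f0 g0).1.
- by move=> s _; exact: (mge0_integrand t f0 g0).2.
Qed.

Lemma convZl f g (c : R) t : mge0 f -> mge0 g -> (0 <= c)%R ->
  conv (fun s => c%:E * f s) g t = c%:E * conv f g t.
Proof.
move=> f0 g0 c0; rewrite /conv -ge0_integralZl//.
- by apply: eq_integral => s _; rewrite muleA.
- exact: (mge0_integrand t f0 g0).1.
- by move=> s _; exact: (mge0_integrand t f0 g0).2.
Qed.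

Lemma le_conv f g h t : mge0 f -> mge0 g -> mge0 h ->
  (forall s, f (t - s)%R * g s <= f (t - s)%R * h s) ->
  conv f g t <= conv f h t.
Proof.
move=> f0 g0 h0 gh; apply: ge0_le_integral => //.
- by move=> s _; exact: (mge0_integrand t f0 g0).2.
- exact: (mge0_integrand t f0 g0).1.
- exact: (mge0_integrand t f0 h0).1.
Qed.

End convolution.

(** * Power kernels on the half-line *)

Section power_kernels.
Context {R : realType}.
Local Notation mu := (@lebesgue_measure R).
Implicit Types (a b c s t x y : R) (phi : R -> R).

Lemma le0_le_powR a x y : a <= 0 -> 0 < x -> x <= y -> y `^ a <= x `^ a.
Proof.
move=> a0 x0 xy; have y0 := lt_le_trans x0 xy.
rewrite -[a]opprK !(powRN _ (- a)) lef_pV2 ?posrE ?powR_gt0//.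
by apply: ge0_ler_powR; rewrite ?nnegrE ?oppr_ge0// ltW.
Qed.

Lemma lt0_lt_powR a x y : a < 0 -> 0 < x -> x < y -> y `^ a < x `^ a.
Proof.
move=> a0 x0 xy; have y0 := lt_trans x0 xy.
rewrite -[a]opprK !(powRN _ (- a)) ltf_pV2 ?posrE ?powR_gt0//.
by apply: gt0_ltr_powR; rewrite ?nnegrE ?oppr_gt0// ltW.
Qed.

Lemma heavisideE t : heaviside t = ((0 < t)%R : bool)%:R :> R.
Proof.
rewrite /heaviside indicE; congr (_%:R); congr nat_of_bool.
by apply/idP/idP; rewrite inE/= in_itv/= andbT.
Qed.

Lemma heaviside_gt0 t : 0 < t -> heaviside t = 1 :> R.
Proof. by rewrite heavisideE => ->. Qed.

Lemma heaviside_le0 t : t <= 0 -> heaviside t = 0 :> R.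
Proof. by rewrite heavisideE ltNge => ->. Qed.

Lemma heaviside_ge0 t : 0 <= heaviside t :> R.
Proof. by rewrite heavisideE ler0n. Qed.

Lemma heavisideM c t : 0 < c -> heaviside (c * t) = heaviside t :> R.
Proof. by move=> c0; rewrite !heavisideE pmulr_rgt0. Qed.

Lemma measurable_heaviside : measurable_fun [set: R] (@heaviside R).
Proof. exact: measurable_indic. Qed.

(** The convolution on the half-line, an integral over ]0, t[, is [conv] of two
    causal functions. *)
Definition causal phi : R -> \bar R := fun t => (heaviside t * phi t)%:E.

(** The kernel of fractional integration of order [a + 1]. *)
Definition pk a : R -> \bar R := causal (fun t => t `^ a).

Lemma causal_gt0 phi t : 0 < t -> causal phi t = (phi t)%:E.
Proof. by move=> t0; rewrite /causal heaviside_gt0// mul1r. Qed.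

Lemma causal_le0 phi t : t <= 0 -> causal phi t = 0%E.
Proof. by move=> t0; rewrite /causal heaviside_le0// mul0r. Qed.

Lemma mge0_causal phi : measurable_fun [set: R] phi ->
  (forall t, 0 < t -> 0 <= phi t) -> mge0 (causal phi).
Proof.
move=> mphi phi0; split.
  by apply/measurable_EFinP; apply: measurable_funM => //; exact: measurable_heaviside.
move=> t; have [t0|t0] := ltP 0 t.
  by rewrite causal_gt0// lee_fin phi0.
by rewrite causal_le0.
Qed.

Lemma mge0_pk a : mge0 (pk a).
Proof.
by apply: mge0_causal => [|t _]; [exact: measurable_powR|exact: powR_ge0].
Qed.

Lemma pkM a c t : 0 < c -> pk a (c * t) = ((c `^ a)%:E * pk a t)%E.
Proof.
move=> c0; have [t0|t0] := ltP 0 t.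
  by rewrite /pk !causal_gt0 ?mulr_gt0// -EFinM powRM// ltW.
by rewrite /pk !causal_le0 ?mule0// pmulr_rle0.
Qed.

(** Homogeneity of the kernel: values at different times are related by rescaling,
    so that the convolution of two kernels need only be known at time 1. *)
Lemma conv_causalM a phi c t : 0 < c ->
  measurable_fun [set: R] phi -> (forall t, 0 <= phi t) ->
  conv (pk a) (causal phi) (c * t) =
  ((c `^ (a + 1))%:E * conv (pk a) (causal (fun x => phi (c * x)%R)) t)%E.
Proof.
move=> c0 mphi phi0; rewrite /conv.
have m1 : mge0 (causal phi) by exact: mge0_causal.
have mphic : measurable_fun [set: R] (fun x => phi (c * x)).
  by apply: (measurableT_comp mphi); exact: measurable_funM.
have m2 : mge0 (causal (fun x => phi (c * x))) by exact: mge0_causal.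
have m3 := mge0_integrand (c * t) (mge0_pk a) m1.
have m4 := mge0_integrand t (mge0_pk a) m2.
rewrite (@ge0_integral_affine R c 0 _ _ m3.1 m3.2) ?gt_eqF// gtr0_norm//.
rewrite -!ge0_integralZl//= ?lee_fin ?powR_ge0 ?(ltW c0)//; last 4 first.
- exact: m4.1.
- by move=> x _; exact: m4.2.
- apply: (measurableT_comp m3.1); exact: measurable_affine.
- by move=> x _; exact: m3.2.
apply: eq_integral => x _; rewrite /affine addr0 -mulrBr pkM//.
rewrite /causal heavisideM// powRD; last by rewrite (gt_eqF c0) implybT.
by rewrite powRr1 ?(ltW c0)// (EFinM (c `^ a)) (muleC (c `^ a)%:E c%:E) -!muleA.
Qed.

Lemma conv_le0 a phi t : t <= 0 -> conv (pk a) (causal phi) t = 0%E.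
Proof.
move=> t0; rewrite /conv integral0_eq// => s _.
have [s0|s0] := ltP 0 s; last by rewrite causal_le0// mule0.
by rewrite /pk causal_le0 ?mul0e// subr_le0 (le_trans t0)// ltW.
Qed.

Lemma eq_conv a phi psi t :
  (forall s, 0 < s -> s < t -> phi s = psi s) ->
  conv (pk a) (causal phi) t = conv (pk a) (causal psi) t.
Proof.
move=> e; apply: eq_integral => s _.
have [s0|s0] := ltP 0 s; last by rewrite !causal_le0.
have [st|ts] := ltP s t; first by rewrite !(causal_gt0 _ s0) e.
by rewrite /pk causal_le0 ?mul0e// subr_le0.
Qed.

(** On each interval [1/(n+1), 1] the fundamental theorem of calculus bounds the
    integral by [(a + 1)^-1]; let n tend to infinity. *)
Lemma int_powR_lt_pinfty a : -1 < a ->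
  (\int[mu]_(x in `]0%R, 1%R]) (x `^ a)%:E < +oo)%E.
Proof.
move=> a1; have a10 : 0 < a + 1 by lra.
pose F (n : nat) : set R := `[n.+1%:R^-1, 1]%classic.
have n0 n : 0 < n.+1%:R^-1 :> R by rewrite invr_gt0 ltr0n.
have FE : \bigcup_i F i = `]0, 1]%classic.
  apply/seteqP; split => x /=.
    move=> [n _]; rewrite /F/= !in_itv/= => /andP[nx ->].
    by rewrite andbT (lt_le_trans _ nx).
  rewrite !in_itv/= => /andP[x0 x1].
  have := @ltr_add_invr R 0 x x0 => -[k]; rewrite add0r => kx.
  by exists k => //; rewrite /F/= in_itv/= x1 ltW.
have cpow x : 0 < x -> {for x, continuous (fun x => x `^ a)}.
  move=> x0; apply/differentiable_continuous/derivable1_diffP.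
  by apply: derivable_powR; rewrite in_itv/= x0.
have Fle n : (\int[mu]_(x in F n) (x `^ a)%:E <= ((a + 1)^-1)%:E)%E.
  have [n1|n1] := ltP (n.+1%:R^-1) (1 : R); last first.
    have e : n.+1%:R^-1 = 1 :> R.
      by apply/le_anti; rewrite n1 andbT invf_le1 ?ltr0n// ler1n.
    by rewrite /F e set_itv1 integral_set1 lee_fin invr_ge0 ltW.
  pose P x := (a + 1)^-1 * x `^ (a + 1).
  have dP x : 0 < x -> is_derive x 1 P (x `^ a).
    move=> x0; have h := @is_derive1_powR R (a + 1) x x0.
    rewrite (_ : x `^ a = (a + 1)^-1 *: ((a + 1) * x `^ (a + 1 - 1))).
      exact: is_deriveZ.
    by rewrite /GRing.scale/= mulrA mulVf ?gt_eqF// mul1r addrK.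
  have cP x : 0 < x -> {for x, continuous P}.
    move=> x0; apply/differentiable_continuous/derivable1_diffP.
    by have [] := dP x x0.
  rewrite /F (@continuous_FTC2 R _ P)//; first last.
  - move=> x /[!in_itv]/= /andP[nx _]; rewrite derive1E.
    by have [] := dP x (lt_trans (n0 n) nx).
  - split.
    + move=> x /[!in_itv]/= /andP[nx _].
      by have [] := dP x (lt_trans (n0 n) nx).
    + by apply: cvg_at_right_filter; exact: cP.
    + by apply: cvg_at_left_filter; exact: cP.
  - apply: continuous_in_subspaceT => x; rewrite inE/= in_itv/= => /andP[nx _].
    exact: cpow (lt_le_trans (n0 n) nx).
  rewrite -EFinB lee_fin /P powR1 mulr1 gerBl.
  by rewrite mulr_ge0 ?powR_ge0// invr_ge0 ltW.
have cv : (\int[mu]_(x in F i) (x `^ a)%:E @[i --> \oo] -->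
    \int[mu]_(x in `]0%R, 1%R]) (x `^ a)%:E)%E.
  rewrite -FE; apply: ge0_nondecreasing_set_cvg_integral.
  - move=> i j ij; apply/subsetPset => x; rewrite /F/= !in_itv/= => /andP[ix ->].
    rewrite andbT (le_trans _ ix)// lef_pV2 ?posrE ?ltr0n// ler_nat.
    by rewrite ltnS.
  - by move=> i; exact: measurable_itv.
  - by move=> i; apply/measurable_EFinP; apply: measurable_funTS; exact: measurable_powR.
  - by move=> i x _; rewrite lee_fin powR_ge0.
rewrite -(cvg_lim _ cv)//; apply: (@le_lt_trans _ _ ((a + 1)^-1)%:E); last by rewrite ltry.
apply: lime_le; first by apply/cvg_ex; eexists; exact: cv.
by near=> i; exact: Fle.
Unshelve. all: by end_near. Qed.

End power_kernels.

(** * Beta and Gamma integrals *)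

Section power_kernel_constants.
Context {R : realType}.
Local Notation mu := (@lebesgue_measure R).
Implicit Types (a b c s t x y : R) (phi : R -> R).

Lemma powR1E a : 1 `^ a = 1 :> R.
Proof. by rewrite powR1. Qed.

Lemma powR_ge1 a x : a <= 0 -> 0 < x -> x <= 1 -> 1 <= x `^ a.
Proof. by move=> a0 x0 x1; rewrite -{1}(powR1E a) le0_le_powR. Qed.

(** The two singularities are apart: on [0, 1/2] the factor [(1 - s) `^ a] is
    bounded, on [1/2, 1] the factor [s `^ b] is. *)
Lemma conv_pk1_lt_pinfty a b : -1 < a <= 0 -> -1 < b <= 0 ->
  (conv (pk a) (pk b) 1 < +oo)%E.
Proof.
move=> /andP[a1 a0] /andP[b1 b0].
pose chi c : R -> \bar R := (fun x => (x `^ c)%:E) \_ `]0, 1]%classic.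
have mchi c : measurable_fun [set: R] (chi c).
  apply/(measurable_restrictT _ _).1 => //; apply: measurable_funTS.
  by apply/measurable_EFinP; exact: measurable_powR.
have chi0 c x : (0 <= chi c x)%E.
  by rewrite /chi patchE; case: ifPn => // _; rewrite lee_fin powR_ge0.
have Ichi c : -1 < c -> (\int[mu]_x chi c x < +oo)%E.
  by move=> c1; rewrite /chi -integral_mkcond; exact: int_powR_lt_pinfty.
pose C : R := (2^-1) `^ a * (2^-1) `^ b.
have C0 : 0 <= C by rewrite mulr_ge0 ?powR_ge0.
have mchi1 : measurable_fun [set: R] (fun s => chi a (1 - s)).
  by apply: (measurableT_comp (mchi a)); exact: measurable_funB.
apply: (@le_lt_trans _ _ (\int[mu]_s (C%:E * (chi b s + chi a (1 - s)%R)))%E).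
  apply: ge0_le_integral => //.
  - by move=> s _; exact: (mge0_integrand 1 (mge0_pk a) (mge0_pk b)).2.
  - exact: (mge0_integrand 1 (mge0_pk a) (mge0_pk b)).1.
  - by apply: emeasurable_funM => //; exact: (emeasurable_funD (mchi b) mchi1).
  move=> s _.
  have rhs0 : (0 <= C%:E * (chi b s + chi a (1 - s)%R))%E.
    by rewrite mule_ge0 ?adde_ge0// lee_fin.
  have [s0|s0] := ltP 0 s; last by rewrite [in leLHS]/pk (causal_le0 _ s0) mule0.
  have [s1|s1] := ltP s 1; last first.
    by rewrite [in leLHS]/pk (@causal_le0 _ _ (1 - s)) ?mul0e// subr_le0.
  rewrite /pk !causal_gt0 ?subr_gt0// /chi !patchE !ifT; last 2 first.
    by rewrite inE/= in_itv/= subr_gt0 s1 lerBlDr lerDl ltW.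
    by rewrite inE/= in_itv/= s0 ltW.
  rewrite -EFinD -!EFinM lee_fin.
  have h0 : 0 < 2^-1 :> R by rewrite invr_gt0.
  have h1 : 2^-1 <= 1 :> R by rewrite invf_le1// ler1n.
  have [a2 b2] := (powR_ge1 a0 h0 h1, powR_ge1 b0 h0 h1).
  have sa := powR_ge0 (1 - s) a; have sb := powR_ge0 s b.
  have [s2|s2] := leP s 2^-1.
    apply: (@le_trans _ _ (2^-1 `^ a * s `^ b)).
      by rewrite ler_wpM2r// le0_le_powR//; lra.
    by rewrite /C -mulrA ler_wpM2l ?powR_ge0// -[leLHS]mul1r ler_pM ?lerDl.
  apply: (@le_trans _ _ ((1 - s) `^ a * 2^-1 `^ b)).
    by rewrite ler_wpM2l// le0_le_powR//; lra.
  rewrite /C [leLHS]mulrC -mulrA [leRHS]mulrCA ler_wpM2l ?powR_ge0//.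
  by rewrite -[leLHS]mul1r ler_pM ?lerDr.
rewrite ge0_integralZl ?lee_fin//; last 2 first.
- exact: (emeasurable_funD (mchi b) mchi1).
- by move=> s _; rewrite adde_ge0.
rewrite ge0_integralD//.
rewrite (ge0_integral_reflect 1 (mchi a) (chi0 a)).
rewrite lte_mul_pinfty ?lee_fin// lte_add_pinfty ?Ichi//.
exact: mchi.
Qed.

(** Euler's Beta function at [(a + 1, b + 1)]. *)
Definition beta a b : R := fine (conv (pk a) (pk b) 1).

Lemma betaE a b : -1 < a <= 0 -> -1 < b <= 0 ->
  (beta a b)%:E = conv (pk a) (pk b) 1.
Proof.
move=> ha hb; rewrite fineK// ge0_fin_numE ?conv_pk1_lt_pinfty//.
by apply: conv_ge0; exact: mge0_pk.
Qed.

(** For [a + b + 1 = 0] the convolution is constant on the half-line: the kernels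
    [t `^ a] and [t `^ b] are then inverse to each other up to one integration,
    which is what makes the Caputo equation equivalent to a Volterra equation. *)
Lemma conv_pk_pk a b t : -1 < a <= 0 -> -1 < b <= 0 ->
  conv (pk a) (pk b) t = causal (fun t => t `^ (a + b + 1) * beta a b) t.
Proof.
move=> ha hb; have [t0|t0] := ltP 0 t; last by rewrite causal_le0// conv_le0.
rewrite causal_gt0// EFinM betaE// -{1}[t]mulr1 [pk b]/pk.
rewrite conv_causalM//; last by move=> x; exact: powR_ge0.
rewrite (@eq_conv _ a _ (fun x => t `^ b * x `^ b)) ; last first.
  by move=> s s0 _; rewrite powRM// ltW.
have -> : causal (fun x => t `^ b * x `^ b) = fun x => ((t `^ b)%:E * pk b x)%E.
  by apply/funext => x; rewrite /pk /causal -EFinM mulrCA.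
rewrite convZr ?powR_ge0//; [|exact: mge0_pk|exact: mge0_pk].
rewrite muleA -EFinM -powRD; last by rewrite (gt_eqF t0) implybT.
by rewrite addrAC.
Qed.

Lemma conv_heaviside phi t : (forall x, 0 <= phi x) -> measurable_fun [set: R] phi ->
  conv (pk 0) (causal phi) t = (\int[mu]_(x in `]0%R, t[) (phi x)%:E)%E.
Proof.
move=> phi0 mphi; rewrite integral_mkcond; apply: eq_integral => s _.
rewrite patchE; case: ifPn.
  rewrite inE/= in_itv/= => /andP[s0 st]; rewrite causal_gt0// /pk causal_gt0 ?subr_gt0//.
  by rewrite powRr0 mul1e.
rewrite notin_setE/= in_itv/= => /negP; rewrite negb_and -!leNgt => /orP[s0|ts].
  by rewrite causal_le0// mule0.
by rewrite /pk causal_le0 ?mul0e// subr_le0.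
Qed.

Lemma beta_gt0 a b : -1 < a <= 0 -> -1 < b <= 0 -> 0 < beta a b.
Proof.
move=> ha hb; rewrite -lte_fin betaE//.
have [/andP[a1 a0] /andP[b1 b0]] := (ha, hb).
apply: (@lt_le_trans _ _ (\int[mu]_(x in `]0%R, 1%R[) cst 1%E x)%E).
  rewrite integral_cst//= mul1e lebesgue_measure_itv/= lte_fin ltr01.
  by rewrite sube0 lte_fin ltr01.
rewrite integral_mkcond; apply: ge0_le_integral => //.
- by move=> x _; rewrite patchE; case: ifPn.
- by apply/(measurable_restrictT _ _).1 => //; exact: measurable_cst.
- exact: (mge0_integrand 1 (mge0_pk a) (mge0_pk b)).1.
move=> s _; rewrite patchE; case: ifPn; last first.
  by move=> _; exact: (mge0_integrand 1 (mge0_pk a) (mge0_pk b)).2.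
rewrite inE/= in_itv/= => /andP[s0 s1].
rewrite /pk !causal_gt0 ?subr_gt0//= -EFinM lee_fin.
by rewrite -[leLHS]mulr1 ler_pM// powR_ge1//; lra.
Qed.

Lemma conv_pk_lt_pinfty a b t : -1 < a <= 0 -> -1 < b <= 0 ->
  (conv (pk a) (pk b) t < +oo)%E.
Proof. by move=> ha hb; rewrite conv_pk_pk// ltry. Qed.

(** The integrand of [Gamma (a + 1)], rescaled by [m]. *)
Definition pkexp a m : R -> \bar R := causal (fun x => x `^ a * expR (- (m * x))).

Lemma measurable_expRM m : measurable_fun [set: R] (fun x => expR (m * x)).
Proof. by apply: measurableT_comp => //; exact: measurable_funM. Qed.

Lemma mge0_pkexp a m : mge0 (pkexp a m).
Proof.
apply: mge0_causal => [|x _]; last by rewrite mulr_ge0 ?powR_ge0 ?expR_ge0.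
apply: measurable_funM; first exact: measurable_powR.
rewrite (_ : (fun x => _) = (fun x => expR (- m * x))); first exact: measurable_expRM.
by apply/funext => x; rewrite mulNr.
Qed.

(** Near 0 the power is integrable; beyond 1 it is at most 1, and the exponential
    density dominates. *)
Lemma int_pkexp_lt_pinfty a : -1 < a <= 0 -> (\int[mu]_x pkexp a 1 x < +oo)%E.
Proof.
move=> /andP[a1 a0].
pose chi : R -> \bar R := (fun x => (x `^ a)%:E) \_ `]0, 1]%classic.
have mchi : measurable_fun [set: R] chi.
  apply/(measurable_restrictT _ _).1 => //; apply: measurable_funTS.
  by apply/measurable_EFinP; exact: measurable_powR.
have chi0 x : (0 <= chi x)%E.
  by rewrite /chi patchE; case: ifPn => // _; rewrite lee_fin powR_ge0.
have e0 x : (0 <= (exponential_pdf 1 x)%:E :> \bar R)%E.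
  by rewrite lee_fin exponential_pdf_ge0.
have me : measurable_fun [set: R] (fun x => (exponential_pdf (1 : R) x)%:E).
  by apply/measurable_EFinP; exact: measurable_exponential_pdf.
apply: (@le_lt_trans _ _ (\int[mu]_x (chi x + (exponential_pdf 1 x)%:E))%E).
  apply: ge0_le_integral => //.
  - by move=> x _; exact: (mge0_pkexp a 1).2.
  - exact: (mge0_pkexp a 1).1.
  - exact: (emeasurable_funD mchi me).
  move=> x _; have [x0|x0] := ltP 0 x; last first.
    by rewrite /pkexp causal_le0// adde_ge0.
  rewrite /pkexp causal_gt0// mul1r.
  have [x1|x1] := leP x 1.
    apply: (@le_trans _ _ (chi x)); last by rewrite leeDl.
    have -> : chi x = (x `^ a)%:E by rewrite /chi patchE ifT// inE/= in_itv/= x0 x1.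
    by rewrite lee_fin ler_piMr ?powR_ge0// -expR0 ler_expR lerNl oppr0 ltW.
  apply: (@le_trans _ _ (exponential_pdf 1 x)%:E); last by rewrite leeDr.
  rewrite exponential_pdfE ?(ltW x0)//= lee_fin mul1r mulN1r.
  by rewrite ler_piMl ?expR_ge0// -(powR1E a) le0_le_powR// ltW.
rewrite ge0_integralD// lte_add_pinfty//.
  by rewrite /chi -integral_mkcond; exact: int_powR_lt_pinfty.
by rewrite integral_exponential_pdf// ltry.
Qed.

Lemma int_pkexp a : -1 < a <= 0 -> (\int[mu]_x pkexp a 1 x = (Gamma (a + 1))%:E)%E.
Proof.
move=> ha; rewrite /Gamma /Rintegral addrK integral_mkcond.
rewrite (_ : _ \_ _ = pkexp a 1).
  rewrite fineK// ge0_fin_numE ?int_pkexp_lt_pinfty//.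
  by apply: integral_ge0 => x _; exact: (mge0_pkexp a 1).2.
apply/funext => x; rewrite patchE /pkexp; have [x0|x0] := ltP 0 x.
  by rewrite ifT ?inE/= ?in_itv/= ?x0// causal_gt0// mul1r.
by rewrite causal_le0// ifF//; apply/negbTE; rewrite notin_setE/= in_itv/= andbT; apply/negP; rewrite -leNgt.
Qed.

Lemma Gamma_gt0 a : -1 < a <= 0 -> 0 < Gamma (a + 1).
Proof.
move=> ha; rewrite -lte_fin -int_pkexp//; have /andP[a1 a0] := ha.
apply: (@lt_le_trans _ _ (\int[mu]_(x in `]0%R, 1%R[) cst (expR (- 1))%:E x)%E).
  rewrite integral_cst//= lebesgue_measure_itv/= lte_fin ltr01.
  by rewrite sube0 mule1 lte_fin expR_gt0.
rewrite integral_mkcond; apply: ge0_le_integral => //.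
- by move=> x _; rewrite patchE; case: ifPn => //= _; rewrite lee_fin expR_ge0.
- by apply/(measurable_restrictT _ _).1 => //; exact: measurable_cst.
- exact: (mge0_pkexp a 1).1.
move=> s _; rewrite patchE; case: ifPn; last first.
  by move=> _; exact: (mge0_pkexp a 1).2.
rewrite inE/= in_itv/= => /andP[s0 s1].
rewrite /pkexp causal_gt0// lee_fin -[leLHS]mul1r ler_pM ?expR_ge0//.
  by rewrite powR_ge1// ltW.
by rewrite ler_expR mul1r lerN2 ltW.
Qed.

(** Factoring [expR (m * t)] out of the convolution leaves the Laplace transform of
    the kernel at [m], restricted to [0, t]. *)
Lemma conv_pk_expR a m t : -1 < a <= 0 -> 0 < m ->
  (conv (pk a) (causal (fun s => expR (m * s))) t <=
   (expR (m * t) * (m `^ (- (a + 1)) * Gamma (a + 1)))%:E)%E.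
Proof.
move=> ha m0; rewrite EFinM EFinM -int_pkexp//.
have p1 := mge0_pkexp a 1; have pm := mge0_pkexp a m.
have -> : ((m `^ (- (a + 1)))%:E * \int[mu]_x pkexp a 1 x = \int[mu]_x pkexp a m x)%E.
  rewrite (ge0_integral_affine (c := m) 0 _ p1.1 p1.2) ?gt_eqF// gtr0_norm// muleA -EFinM.
  rewrite -ge0_integralZl ?lee_fin ?mulr_ge0 ?powR_ge0 ?(ltW m0)//; last 2 first.
  - by apply: (measurableT_comp p1.1); exact: measurable_affine.
  - by move=> x _; exact: p1.2.
  apply: eq_integral => x _; rewrite /affine addr0 /pkexp.
  have [x0|x0] := ltP 0 x; last by rewrite !causal_le0 ?mule0// pmulr_rle0.
  rewrite !causal_gt0 ?mulr_gt0// -EFinM mul1r powRM ?(ltW m0) ?(ltW x0)//.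
  congr EFin; rewrite !mulrA -[in RHS](mul1r (x `^ a)); congr (_ * _ * _).
  rewrite -[X in _ * X * _](powRr1 (ltW m0)) -!powRD ?(gt_eqF m0) ?implybT//.
  by rewrite (_ : - (a + 1) + 1 + a = 0) ?powRr0//; lra.
rewrite -(ge0_integral_reflect t pm.1 pm.2).
have pmt : measurable_fun [set: R] (fun x => pkexp a m (t - x)%R).
  by apply: (measurableT_comp pm.1); exact: measurable_funB.
rewrite -ge0_integralZl ?lee_fin ?expR_ge0//; last by move=> x _; exact: pm.2.
have me : mge0 (causal (fun s => expR (m * s))).
  by apply: mge0_causal => [|s _]; [exact: measurable_expRM|exact: expR_ge0].
apply: ge0_le_integral => //.
- by move=> x _; exact: (mge0_integrand t (mge0_pk a) me).2.
- exact: (mge0_integrand t (mge0_pk a) me).1.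
- exact: emeasurable_funM.
move=> s _.
have rhs0 : (0 <= (expR (m * t))%:E * pkexp a m (t - s)%R)%E.
  by rewrite mule_ge0 ?pm.2// lee_fin expR_ge0.
have [s0|s0] := ltP 0 s; last by rewrite causal_le0 ?mule0.
have [st|ts] := ltP s t; last by rewrite /pk causal_le0 ?mul0e// subr_le0.
rewrite /pk /pkexp !causal_gt0 ?subr_gt0// -!EFinM lee_fin.
by rewrite mulrCA -expRD; rewrite (_ : m * t + _ = m * s)//; lra.
Qed.

(** In the norm weighted by [expR (- (m * t))], fractional integration is as small as
    desired once [m] is large. Both the Picard iteration and the Gronwall lemma
    rest on this, and it is the reason why they work on the whole half-line at
    once. *)
Lemma conv_pk_expR_small a e : -1 < a <= 0 -> 0 < e ->
  exists2 m, 0 < m &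
  forall t, (conv (pk a) (causal (fun s => expR (m * s))) t <= (e * expR (m * t))%:E)%E.
Proof.
move=> ha e0; have G0 := Gamma_gt0 ha; have /andP[a1 a0] := ha.
pose m := (e / Gamma (a + 1)) `^ (- (a + 1)^-1).
have m0 : 0 < m by rewrite powR_gt0// divr_gt0.
exists m => // t; apply: le_trans (conv_pk_expR t ha m0) _.
rewrite lee_fin mulrC ler_wpM2r ?expR_ge0// /m -powRrM mulrNN mulVf ?gt_eqF//; last by lra.
by rewrite powRr1 ?divr_ge0 ?(ltW e0) ?(ltW G0)// divfK ?gt_eqF.
Qed.

End power_kernel_constants.

(** * Fractional integration *)

(** The Riemann-Liouville integral of order [a + 1], without its factor
    [(Gamma (a + 1))^-1]. *)
HB.lock Definition fracint {R : realType} (a : R) (phi : R -> R) (t : R) : R :=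
  fine (conv (pk a) (causal phi) t).

Section fractional_integral.
Context {R : realType}.
Local Notation mu := (@lebesgue_measure R).
Implicit Types (a b c s t x y M N : R) (phi psi : R -> R).

Lemma fracint_def a phi t : fracint a phi t = fine (conv (pk a) (causal phi) t).
Proof. by rewrite fracint.unlock. Qed.

(** The kernels [pk a] take the value 0 at their singularity, so that inequalities
    between them fail there, and only there. *)
Lemma le_integral_but1 (f g : R -> \bar R) p : mge0 f -> mge0 g ->
  (forall s, s != p -> (f s <= g s)%E) -> (\int[mu]_s f s <= \int[mu]_s g s)%E.
Proof.
move=> f0 g0 fg; apply: ae_ge0_le_integral => //.
- by move=> s _; exact: f0.2.
- exact: f0.1.
- by move=> s _; exact: g0.2.
- exact: g0.1.
exists [set p]; split=> //; first exact: lebesgue_measure_set1.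
move=> s /= /not_implyP[_ /negP]; rewrite -ltNge => gf.
by apply/eqP; apply: contraTT gf => sp; rewrite -leNgt fg.
Qed.

(** The functions on which [fracint] is finite, linear and monotone. *)
Definition bnd M phi := measurable_fun [set: R] phi /\ forall x, 0 <= phi x <= M.

Lemma bnd_ge0 M phi : bnd M phi -> forall x, 0 <= phi x.
Proof. by move=> [_ h] x; case/andP: (h x). Qed.

Lemma bnd_M_ge0 M phi : bnd M phi -> 0 <= M.
Proof. by move=> [_ /(_ 0)/andP[]]; exact: le_trans. Qed.

Lemma mge0_bnd M phi : bnd M phi -> mge0 (causal phi).
Proof. by move=> h; apply: mge0_causal => [|t _]; [exact: h.1|exact: bnd_ge0 h t]. Qed.

Lemma bnd_cst M : 0 <= M -> bnd M (cst M).
Proof. by move=> M0; split=> // x /=; rewrite M0 lexx. Qed.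

Lemma causal_cst M : causal (cst M) = (fun t => M%:E * pk 0 t)%E.
Proof.
by apply/funext => t; rewrite /pk /causal powRr0 mulr1 -EFinM mulrC.
Qed.

Lemma conv_cst a M t : -1 < a <= 0 -> 0 <= M ->
  conv (pk a) (causal (cst M)) t = (M * (heaviside t * (t `^ (a + 1) * beta a 0)))%:E.
Proof.
move=> ha M0; rewrite causal_cst convZr//; last 2 first.
- exact: mge0_pk.
- exact: mge0_pk.
by rewrite conv_pk_pk ?lexx ?ltrN10// /causal addr0 EFinM.
Qed.

Lemma conv_bnd_lt_pinfty a M phi t : -1 < a <= 0 -> bnd M phi ->
  (conv (pk a) (causal phi) t < +oo)%E.
Proof.
move=> ha h; have M0 := bnd_M_ge0 h.
apply: (@le_lt_trans _ _ (conv (pk a) (causal (cst M)) t)).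
  apply: le_conv.
  - exact: mge0_pk.
  - exact: mge0_bnd h.
  - exact: mge0_bnd (bnd_cst M0).
  move=> s; apply: lee_wpmul2l; first exact: (mge0_pk a).2.
  rewrite /causal lee_fin ler_wpM2l ?heaviside_ge0//.
  by case/andP: (h.2 s).
by rewrite conv_cst// ltry.
Qed.

Lemma fracintE a M phi t : -1 < a <= 0 -> bnd M phi ->
  (fracint a phi t)%:E = conv (pk a) (causal phi) t.
Proof.
move=> ha h; rewrite fracint_def fineK// ge0_fin_numE ?(conv_bnd_lt_pinfty _ ha h)//.
by apply: conv_ge0; [exact: mge0_pk|exact: mge0_bnd h].
Qed.

Lemma fracint_ge0 a M phi t : bnd M phi -> 0 <= fracint a phi t.
Proof.
by move=> h; rewrite fracint_def fine_ge0// conv_ge0//; [exact: mge0_pk|exact: mge0_bnd h].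
Qed.

Lemma fracint_le0 a phi t : t <= 0 -> fracint a phi t = 0.
Proof. by move=> t0; rewrite !fracint_def conv_le0. Qed.

Lemma eq_fracint a phi psi t :
  (forall s, 0 < s -> s < t -> phi s = psi s) -> fracint a phi t = fracint a psi t.
Proof. by move=> e; rewrite !fracint_def (eq_conv _ e). Qed.

Lemma le_fracint a M N phi psi t : -1 < a <= 0 -> bnd M phi -> bnd N psi ->
  (forall s, 0 < s -> s < t -> phi s <= psi s) ->
  fracint a phi t <= fracint a psi t.
Proof.
move=> ha hphi hpsi le; rewrite -lee_fin (fracintE t ha hphi) (fracintE t ha hpsi).
apply: le_conv; [exact: mge0_pk|exact: mge0_bnd hphi|exact: mge0_bnd hpsi|].
move=> s; have [s0|s0] := ltP 0 s; last by rewrite !(causal_le0 _ s0).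
have [st|ts] := ltP s t; last by rewrite /pk causal_le0 ?mul0e// subr_le0.
apply: lee_wpmul2l; first exact: (mge0_pk a).2.
by rewrite !causal_gt0// lee_fin le.
Qed.

Lemma bndD M N phi psi : bnd M phi -> bnd N psi -> bnd (M + N) (phi \+ psi).
Proof.
move=> hphi hpsi; split; first exact: measurable_funD hphi.1 hpsi.1.
move=> x; have := hphi.2 x; have := hpsi.2 x.
by move=> /andP[? ?] /andP[? ?]; rewrite /= addr_ge0//= lerD.
Qed.

Lemma bndZ c M phi : 0 <= c -> bnd M phi -> bnd (c * M) (fun x => c * phi x).
Proof.
move=> c0 hphi; split; first by apply: measurable_funM => //; exact: hphi.1.
by move=> x; have /andP[? ?] := hphi.2 x; rewrite mulr_ge0//= ler_wpM2l.
Qed.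

Lemma fracintD a M N phi psi t : -1 < a <= 0 -> bnd M phi -> bnd N psi ->
  fracint a (phi \+ psi) t = fracint a phi t + fracint a psi t.
Proof.
move=> ha hphi hpsi; apply: EFin_inj; rewrite EFinD.
rewrite (fracintE t ha (bndD hphi hpsi)) (fracintE t ha hphi) (fracintE t ha hpsi).
rewrite -convDr; [|exact: mge0_pk|exact: mge0_bnd hphi|exact: mge0_bnd hpsi].
by congr conv; apply/funext => s; rewrite /causal /= mulrDr EFinD.
Qed.

Lemma fracintZ a c M phi t : -1 < a <= 0 -> 0 <= c -> bnd M phi ->
  fracint a (fun x => c * phi x) t = c * fracint a phi t.
Proof.
move=> ha c0 hphi; apply: EFin_inj; rewrite EFinM.
rewrite (fracintE t ha (bndZ c0 hphi)) (fracintE t ha hphi).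
rewrite -convZr//; [|exact: mge0_pk|exact: mge0_bnd hphi].
by congr conv; apply/funext => s; rewrite /causal /= -EFinM mulrCA.
Qed.

(** The fractional integral of the constant 1. *)
Definition fracint1 a t : R := heaviside t * (t `^ (a + 1) * beta a 0).

Lemma fracint_cst a M t : -1 < a <= 0 -> 0 <= M ->
  fracint a (cst M) t = M * fracint1 a t.
Proof. by move=> ha M0; rewrite !fracint_def conv_cst. Qed.

(** As [a <= 0], the kernel seen from the later time [t'] is smaller on ]0, t[; the
    remaining interval contributes at most the fractional integral of the bound
    [M] over the length [t' - t]. *)
Lemma le_fracint_incr a M phi t t' : -1 < a <= 0 -> bnd M phi -> t <= t' ->
  fracint a phi t' <= fracint a phi t + M * fracint1 a (t' - t).
Proof.
move=> ha h tt'; have M0 := bnd_M_ge0 h.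
have p0 := mge0_pk (R := R) 0; have pa := mge0_pk (R := R) a.
have hphi := mge0_bnd h.
rewrite -lee_fin EFinD (fracintE _ ha h) (fracintE _ ha h) /fracint1 -conv_cst//.
have hM := mge0_bnd (bnd_cst M0).
have hi := mge0_integrand (t' - t) pa hM.
rewrite [X in (_ <= _ + X)%E]/conv -(ge0_integral_shift (- t) hi.1 hi.2).
have hit : mge0 (fun x => pk a (t' - t - (x + - t)) * causal (cst M) (x + - t))%E.
  split; last by move=> x; exact: hi.2.
  by apply: (measurableT_comp hi.1); exact: measurable_funD.
have ht := mge0_integrand t pa hphi.
have ht' := mge0_integrand t' pa hphi.
rewrite /conv -ge0_integralD//; last 4 first.
- by move=> x _; exact: ht.2.
- exact: ht.1.
- by move=> x _; exact: hit.2.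
- exact: hit.1.
apply: (@le_integral_but1 _ _ t) => //.
  split; first exact: (emeasurable_funD ht.1 hit.1).
  by move=> s; rewrite adde_ge0 ?ht.2 ?hit.2.
move=> s st.
have [s0|s0] := ltP 0 s; last first.
  by rewrite (causal_le0 phi s0) !mule0 add0e hit.2.
have [s1|s1] := ltP s t'; last first.
  by rewrite [in leLHS]/pk causal_le0 ?mul0e ?subr_le0// adde_ge0 ?ht.2 ?hit.2.
move: st; rewrite neq_lt => /orP[st|ts].
  apply: (@le_trans _ _ (pk a (t - s) * causal phi s)%E); last first.
    by rewrite leeDl// hit.2.
  apply: lee_wpmul2r; first exact: hphi.2.
  rewrite /pk !causal_gt0 ?subr_gt0// lee_fin.
  by case/andP: ha => _ a0; rewrite le0_le_powR ?subr_gt0// lerB.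
apply: (@le_trans _ _ (pk a (t' - t - (s + - t)) * causal (cst M) (s + - t))%E); last first.
  by rewrite leeDr// ht.2.
rewrite (_ : t' - t - (s + - t) = t' - s); last by lra.
apply: lee_wpmul2l; first exact: pa.2.
by rewrite !causal_gt0 ?subr_gt0//= lee_fin; case/andP: (h.2 s).
Qed.

Lemma fracint1_ge0 a t : -1 < a <= 0 -> 0 <= fracint1 a t.
Proof.
move=> ha; have := @fracint_ge0 a 1 (cst 1) t (bnd_cst ler01).
by rewrite fracint_cst// mul1r.
Qed.

Lemma le_fracint1 a s t : -1 < a <= 0 -> s <= t -> fracint1 a s <= fracint1 a t.
Proof.
move=> /andP[a1 a0] st; have [s0|s0] := leP s 0.
  by rewrite {1}/fracint1 heaviside_le0// mul0r fracint1_ge0// a1.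
rewrite /fracint1 !heaviside_gt0 ?(lt_le_trans s0)// !mul1r ler_wpM2r//.
  by rewrite ltW// beta_gt0 ?a1 ?ltrN10 ?lexx.
by apply: ge0_ler_powR; rewrite ?nnegrE ?(ltW s0) ?(ltW (lt_le_trans s0 st))//; lra.
Qed.

(** The upper bound [le_fracint_incr], applied to [M - phi]. *)
Lemma ge_fracint_incr a M phi t t' : -1 < a <= 0 -> bnd M phi -> t <= t' ->
  fracint a phi t <= fracint a phi t' + M * fracint1 a (t' - t).
Proof.
move=> ha h tt'; have M0 := bnd_M_ge0 h.
have h' : bnd M (fun x => M - phi x).
  split; first by apply: measurable_funB => //; exact: h.1.
  by move=> x; have /andP[? ?] := h.2 x; rewrite subr_ge0; apply/andP; split => //; lra.
have := le_fracint_incr ha h' tt'.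
have eM u : fracint a (fun x => M - phi x) u = M * fracint1 a u - fracint a phi u.
  apply/eqP; rewrite eq_sym subr_eq -(fracintD u ha h' h) -fracint_cst//.
  by apply/eqP; apply: eq_fracint => s _ _ /=; lra.
rewrite !eM; have : M * fracint1 a t <= M * fracint1 a t'.
  by rewrite ler_wpM2l// le_fracint1.
lra.
Qed.

(** A modulus of continuity that sees [phi] only through its bound; on the half-line
    [fracint1 a] is a multiple of a power of exponent [a + 1], so this is Hoelder
    continuity. *)
Lemma fracint_holder a M phi t t' : -1 < a <= 0 -> bnd M phi ->
  `|fracint a phi t' - fracint a phi t| <= M * fracint1 a `|t' - t|.
Proof.
move=> ha h; wlog tt' : t t' / t <= t' => [hw|].
  have [|/ltW] := leP t t'; first exact: hw.
  by move=> /hw; rewrite distrC [`|t - t'|]distrC.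
rewrite [`|t' - t|]ger0_norm ?subr_ge0// ler_norml.
have := le_fracint_incr ha h tt'; have := ge_fracint_incr ha h tt'.
by move=> ? ?; apply/andP; split; lra.
Qed.

Lemma cvg_fracint1 a : -1 < a <= 0 -> fracint1 a x @[x --> (0 : R)] --> (0 : R).
Proof.
move=> /[dup] ha /andP[a1 a0]; apply/cvgrPdist_le => e e0.
have a10 : 0 < a + 1 by lra.
have b0 : 0 < beta a 0 by rewrite beta_gt0 ?a1 ?ltrN10 ?lexx.
pose d := (e / beta a 0) `^ (a + 1)^-1.
have d0 : 0 < d by rewrite powR_gt0// divr_gt0.
near=> x; rewrite sub0r normrN ger0_norm ?fracint1_ge0//.
apply: (@le_trans _ _ (fracint1 a d)).
  apply: le_fracint1 => //; apply: (le_trans (ler_norm _)); apply: ltW.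
  by near: x; have := @nbhs0_lt R R d d0.
rewrite /fracint1 heaviside_gt0// mul1r /d -powRrM mulVf ?gt_eqF// powRr1; last first.
  by rewrite divr_ge0 ?ltW.
by rewrite divfK ?gt_eqF.
Unshelve. all: by end_near. Qed.

Lemma continuous_fracint a M phi : -1 < a <= 0 -> bnd M phi ->
  continuous (fracint a phi).
Proof.
move=> ha h t; have M0 := bnd_M_ge0 h; apply/cvgrPdist_le => e e0.
have /cvgrPdist_le /(_ (e / (M + 1))) := cvg_fracint1 ha.
have M10 : 0 < M + 1 by lra.
rewrite divr_gt0// => /(_ isT) /nbhs_ballP[d /= d0 hd].
near=> x; rewrite distrC; apply: (le_trans (fracint_holder _ _ ha h)).
have : `|0 - fracint1 a `|x - t| | <= e / (M + 1).
  apply: hd; rewrite /ball/= sub0r normrN normr_id distrC.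
  by near: x; exact: (nbhsx_ballx t d d0).
rewrite sub0r normrN ger0_norm ?fracint1_ge0// ler_pdivlMr// => hh.
by apply: le_trans hh; rewrite mulrC ler_wpM2l ?fracint1_ge0// lerDl.
Unshelve. all: by end_near. Qed.

End fractional_integral.

(** * Volterra equations: existence and uniqueness *)

Section volterra.
Context {R : realType}.
Implicit Types (a c s t x y e C L M : R) (phi psi : R -> R).

Lemma half_expS n : 2 ^- n.+1 = 2 ^- n / 2 :> R.
Proof. by rewrite exprS invfM mulrC. Qed.

Lemma geometric_small C e : 0 <= C -> 0 < e ->
  exists N, forall n, (N <= n)%N -> C * 2 ^- n <= e.
Proof.
move=> C0 e0; pose N := Num.truncn (C / e); exists N.+1 => n Nn.
rewrite ler_pdivrMr ?exprn_gt0//.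
have h1 : C / e < N.+1%:R by rewrite truncnS_gt.
rewrite mulrC -ler_pdivrMr//; apply: (le_trans (ltW h1)).
rewrite -natrX ler_nat; apply: leq_trans Nn _; apply: ltnW; exact: ltn_expl.
Qed.

Lemma geometric_le0 C x : 0 <= C -> (forall n, x <= C * 2 ^- n) -> x <= 0.
Proof.
move=> C0 h; rewrite leNgt; apply/negP => x0.
have x2 : 0 < x / 2 by rewrite divr_gt0.
have [n /(_ n (leqnn _)) hn] := geometric_small C0 x2.
by have := h n; lra.
Qed.

Lemma geometric_cauchy_limit (u : nat -> R) C :
  (forall n, `|u n.+1 - u n| <= C * 2 ^- n) ->
  exists l, forall n, `|l - u n| <= 2 * C * 2 ^- n.
Proof.
move=> hu.
have pn n : 0 < 2 ^- n :> R by rewrite invr_gt0 exprn_gt0.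
have C0 : 0 <= C.
  by have := le_trans (normr_ge0 _) (hu 0); rewrite expr0 invr1 mulr1.
have hk n k : `|u (n + k)%N - u n| <= 2 * C * 2 ^- n - 2 * C * 2 ^- (n + k).
  elim: k => [|k IH]; first by rewrite addn0 !subrr normr0.
  rewrite addnS (_ : _ - u n = (u (n + k).+1 - u (n + k)%N) + (u (n + k)%N - u n)); last by lra.
  apply: (le_trans (ler_normD _ _)); rewrite half_expS.
  have := hu (n + k)%N; set q := 2 ^- (n + k) in IH *; lra.
have hk' n k : `|u (n + k)%N - u n| <= 2 * C * 2 ^- n.
  apply: le_trans (hk n k) _; rewrite gerBl mulr_ge0 ?mulr_ge0// ltW//.
pose E := [set u n - 2 * C * 2 ^- n | n in [set: nat]].
have ub m : ubound E (u m + 2 * C * 2 ^- m).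
  move=> _ [n _ <-]; have [nm|mn] := leP n m.
    by have := hk' n (m - n)%N; rewrite subnKC// ler_norml => /andP[? _]; have := pn m; nra.
  by have := hk' m (n - m)%N; rewrite subnKC ?(ltnW mn)// ler_norml => /andP[_ ?]; have := pn n; nra.
have E0 : E !=set0 by exists (u 0 - 2 * C * 2 ^- 0), 0%N.
exists (sup E) => n; rewrite ler_distl; apply/andP; split.
  by apply: ub_le_sup; [exists (u 0 + 2 * C * 2 ^- 0); exact: ub|exists n].
by apply: ge_sup => //; exact: ub.
Qed.

Lemma bnd_dist M phi psi : bnd M phi -> bnd M psi ->
  bnd M (fun x => `|phi x - psi x|).
Proof.
move=> h1 h2; split.
  by apply: measurableT_comp => //; apply: measurable_funB; [exact: h1.1|exact: h2.1].
move=> x; have /andP[? ?] := h1.2 x; have /andP[? ?] := h2.2 x.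
by rewrite normr_ge0/= ler_norml; apply/andP; split; lra.
Qed.

Lemma fracint_dist a M phi psi t : -1 < a <= 0 -> bnd M phi -> bnd M psi ->
  `|fracint a phi t - fracint a psi t| <= fracint a (fun x => `|phi x - psi x|) t.
Proof.
move=> ha h1 h2; have hd := bnd_dist h1 h2.
rewrite ler_norml lerNl opprB !lerBlDl -(fracintD t ha h1 hd) -(fracintD t ha h2 hd).
apply/andP; split.
  apply: (le_fracint ha h2 (bndD h1 hd)) => s _ _ /=.
  by have := ler_norm (psi s - phi s); rewrite distrC; lra.
apply: (le_fracint ha h1 (bndD h2 hd)) => s _ _ /=.
by have := ler_norm (phi s - psi s); lra.
Qed.

Lemma fracint_le_expR a e (m : R) C M phi t : -1 < a <= 0 -> bnd M phi -> 0 <= C ->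
  (forall s, 0 < s -> s < t -> phi s <= C * expR (m * s)) ->
  (forall t, (conv (pk a) (causal (fun s => expR (m * s))) t <= (e * expR (m * t))%:E)%E) ->
  fracint a phi t <= C * e * expR (m * t).
Proof.
move=> ha h C0 hC hm; rewrite -lee_fin (fracintE t ha h).
have he : mge0 (causal (fun s => expR (m * s))).
  by apply: mge0_causal => [|s _]; [exact: measurable_expRM|exact: expR_ge0].
have heC : mge0 (fun s => C%:E * causal (fun s => expR (m * s)) s)%E.
  split; first by apply: measurable_funeM; exact: he.1.
  by move=> s; apply: mule_ge0; [rewrite lee_fin|exact: he.2].
apply: (@le_trans _ _ (conv (pk a) (fun s => C%:E * causal (fun s => expR (m * s)) s)%E t)).
  apply: le_conv => //; [exact: mge0_pk|exact: mge0_bnd h|].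
  move=> s; have [s0|s0] := ltP 0 s; last by rewrite !(causal_le0 _ s0) !mule0.
  have [st|ts] := ltP s t; last by rewrite /pk causal_le0 ?mul0e// subr_le0.
  apply: lee_wpmul2l; first exact: (mge0_pk a).2.
  by rewrite !causal_gt0// -EFinM lee_fin hC.
rewrite convZr//; last exact: mge0_pk.
by rewrite -mulrA EFinM lee_wpmul2l ?lee_fin.
Qed.

(** A bound [phi t <= C * expR (m * t)] improves itself, by a factor 1/2, when [m]
    makes the weighted norm of [L * fracint a] at most 1/2. *)
Lemma fracint_gronwall a L M phi (T : R) : -1 < a <= 0 -> 0 <= L -> bnd M phi ->
  (forall t, 0 < t -> t < T -> phi t <= L * fracint a phi t) ->
  forall t, 0 < t -> t < T -> phi t = 0.
Proof.
move=> ha L0 h hphi.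
have e0 : 0 < (2 * (L + 1))^-1 by rewrite invr_gt0; lra.
have [m m0 hm] := conv_pk_expR_small ha e0.
(* The weight makes one application of [L * fracint a] halve the bound. *)
have Le : L * (2 * (L + 1))^-1 <= 2^-1.
  by rewrite ler_pdivrMr; [lra|lra].
have M0 := bnd_M_ge0 h.
have pn n : 0 < 2 ^- n :> R by rewrite invr_gt0 exprn_gt0.
have bound n t : 0 < t -> t < T -> phi t <= M * 2 ^- n * expR (m * t).
  elim: n t => [|n IH] t t0 tT.
    rewrite expr0 invr1 mulr1; have /andP[_ hM] := h.2 t; apply: (le_trans hM).
    by rewrite ler_peMr// -expR0 ler_expR mulr_ge0 ?ltW.
  apply: (le_trans (hphi t t0 tT)).
  have := @fracint_le_expR a _ m (M * 2 ^- n) M phi t ha h _ _ hm.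
  rewrite mulr_ge0 ?(ltW (pn n))// => /(_ isT) /(_ _)/(ler_wpM2l L0) hh.
  apply: (le_trans (hh _)).
    by move=> s s0 st; apply: IH => //; exact: lt_trans tT.
  rewrite half_expS; have := pn n; have := expR_ge0 (m * t).
  set q := 2 ^- n; set E := expR _; set z := (2 * (L + 1))^-1 in Le *.
  move=> E0 q0; have : M * q * E * (L * z) <= M * q * E * 2^-1.
    by rewrite ler_wpM2l// !mulr_ge0// ltW.
  lra.
move=> t t0 tT; apply/le_anti/andP; split; last exact: bnd_ge0 h t.
apply: (@geometric_le0 (M * expR (m * t))); first by rewrite mulr_ge0 ?expR_ge0.
by move=> n; rewrite mulrAC bound.
Qed.

(** Picard iteration. Successive differences halve in the norm weighted by
    [expR (- (m * t))], hence the iterates converge for every [t], to a limit that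
    is measurable as a pointwise limit. *)
Lemma volterra_exists a L M (b : R -> R) (Phi : R -> R -> R) :
  -1 < a <= 0 -> 0 <= L -> measurable_fun [set: R] b ->
  (forall s x, 0 <= Phi s x <= M) ->
  (forall s x y, `|Phi s x - Phi s y| <= L * `|x - y|) ->
  (forall w : R -> R, measurable_fun [set: R] w ->
    measurable_fun [set: R] (fun s => Phi s (w s))) ->
  exists w : R -> R, measurable_fun [set: R] w /\
    forall t, w t = b t - fracint a (fun s => Phi s (w s)) t.
Proof.
move=> ha L0 mb PhiM PhiL mPhi.
have e0 : 0 < (2 * (L + 1))^-1 by rewrite invr_gt0; lra.
have [m m0 hm] := conv_pk_expR_small ha e0.
set e := (2 * (L + 1))^-1 in e0 hm.
have Le : L * e <= 2^-1.
  by rewrite /e ler_pdivrMr; [lra|lra].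
have M0 : 0 <= M by have /andP[] := PhiM 0 0; exact: le_trans.
have bPhi w : measurable_fun [set: R] w -> bnd M (fun s => Phi s (w s)).
  by move=> mw; split; [exact: mPhi|move=> x; exact: PhiM].
pose step (w : R -> R) t := b t - fracint a (fun s => Phi s (w s)) t.
pose w_ n := iter n step b.
have mw n : measurable_fun [set: R] (w_ n).
  elim: n => [//|n IH]; rewrite /w_ iterS; apply: measurable_funB => //.
  by apply: continuous_measurable_fun; exact: continuous_fracint ha (bPhi _ IH).
have ex1 s : 0 < s -> 1 <= expR (m * s).
  by move=> s0; rewrite -expR0 ler_expR mulr_ge0 ?ltW.
pose K := M * e; have K0 : 0 <= K by rewrite mulr_ge0// ltW.
have pn n : 0 < 2 ^- n :> R by rewrite invr_gt0 exprn_gt0.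
have diff n t : `|w_ n.+1 t - w_ n t| <= K * expR (m * t) * 2 ^- n.
  elim: n t => [|n IH] t.
    rewrite /w_ /= /step addrC addKr normrN expr0 invr1 mulr1.
    rewrite ger0_norm ?(fracint_ge0 _ _ (bPhi _ mb))//.
    apply: (fracint_le_expR ha (bPhi _ mb) M0 _ hm) => s s0 _.
    have /andP[_ hM] := PhiM s (b s); apply: (le_trans hM).
    by rewrite ler_peMr// ex1.
  rewrite (_ : w_ n.+2 t - w_ n.+1 t = fracint a (fun s => Phi s (w_ n s)) t -
      fracint a (fun s => Phi s (w_ n.+1 s)) t); last first.
    by rewrite /w_ iterS [in X in _ - X]iterS -/(w_ n.+1) -/(w_ n) /step; lra.
  have h1 := bPhi _ (mw n); have h2 := bPhi _ (mw n.+1).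
  apply: (le_trans (fracint_dist t ha h1 h2)).
  have CL0 : 0 <= L * K * 2 ^- n by rewrite !mulr_ge0// ltW.
  apply: (le_trans (fracint_le_expR ha (bnd_dist h1 h2) CL0 _ hm)).
    move=> s s0 _; apply: (le_trans (PhiL _ _ _)).
    rewrite -!mulrA ler_wpM2l// distrC; apply: (le_trans (IH s)).
    by rewrite /K le_eqVlt; apply/orP; left; apply/eqP; ring.
  rewrite half_expS; have := pn n; have := expR_ge0 (m * t).
  set q := 2 ^- n; set E := expR _.
  move=> E0 q0; have : K * q * E * (L * e) <= K * q * E * 2^-1.
    by rewrite ler_wpM2l// !mulr_ge0// ltW.
  lra.
have /choice[w hw] : forall t, exists l, forall n,
    `|l - w_ n t| <= 2 * (K * expR (m * t)) * 2 ^- n.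
  move=> t; apply: (@geometric_cauchy_limit (fun n => w_ n t)) => n. exact: diff.
have CK t : 0 <= 2 * (K * expR (m * t)) by rewrite mulr_ge0// mulr_ge0// expR_ge0.
have mwl : measurable_fun [set: R] w.
  apply: (measurable_fun_cvg mw) => t _; apply/cvgrPdist_le => d d0.
  have [N hN] := geometric_small (CK t) d0.
  by exists N => // n Nn; apply: le_trans (hw t n) _; exact: hN.
exists w; split => // t; apply/eqP; rewrite -subr_eq0 -normr_le0.
apply: (@geometric_le0 (2 * (2 * (K * expR (m * t))))); first by rewrite mulr_ge0.
move=> n.
have h1 := bPhi _ mwl; have h2 := bPhi _ (mw n).
have hd : `|fracint a (fun s => Phi s (w s)) t - fracint a (fun s => Phi s (w_ n s)) t|
     <= 2 * (K * expR (m * t)) * 2 ^- n.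
  apply: (le_trans (fracint_dist t ha h1 h2)).
  have CL0 : 0 <= 2 * L * K * 2 ^- n by rewrite !mulr_ge0// ltW.
  apply: (le_trans (fracint_le_expR ha (bnd_dist h1 h2) CL0 _ hm)).
    move=> s s0 _; apply: (le_trans (PhiL _ _ _)).
    rewrite (_ : _ * expR _ = L * (2 * (K * expR (m * s)) * 2 ^- n)); last by ring.
    by rewrite ler_wpM2l.
  have := pn n; have := expR_ge0 (m * t); set q := 2 ^- n; set E := expR _.
  move=> E0 q0.
  have : K * q * E * (L * e) <= K * q * E * 2^-1.
    by rewrite ler_wpM2l// !mulr_ge0// ltW.
  have : 0 <= K * q * E by rewrite !mulr_ge0// ltW.
  lra.
have := hw t n.+1; have := hd; rewrite half_expS.
rewrite /w_ iterS -/(w_ n) /step.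
set I1 := fracint _ _ _; set I2 := fracint _ _ _ => hI hW.
rewrite (_ : w t - (b t - I1) = (w t - (b t - I2)) + (I1 - I2)); last by lra.
apply: (le_trans (ler_normD _ _)); apply: (le_trans (lerD hW hI)).
have := pn n; have := CK t; set q := 2 ^- n; set Z := 2 * _ => Z0 q0.
by have := mulr_ge0 Z0 (ltW q0); lra.
Qed.

Lemma volterra_unique a L M (T : R) (b w1 w2 : R -> R) (Phi : R -> R -> R) :
  -1 < a <= 0 -> 0 <= L ->
  measurable_fun [set: R] w1 -> measurable_fun [set: R] w2 ->
  bnd M (fun s => Phi s (w1 s)) -> bnd M (fun s => Phi s (w2 s)) ->
  (forall s, `|Phi s (w1 s) - Phi s (w2 s)| <= L * `|w1 s - w2 s|) ->
  (forall t, 0 < t -> t < T -> w1 t = b t - fracint a (fun s => Phi s (w1 s)) t) ->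
  (forall t, 0 < t -> t < T -> w2 t = b t - fracint a (fun s => Phi s (w2 s)) t) ->
  forall t, 0 < t -> t < T -> w1 t = w2 t.
Proof.
move=> ha L0 m1 m2 h1 h2 hL e1 e2 t t0 tT.
have hd := bnd_dist h1 h2.
have d12 s : 0 < s -> s < T -> `|w1 s - w2 s| <=
    fracint a (fun x => `|Phi x (w1 x) - Phi x (w2 x)|) s.
  move=> s0 sT; rewrite e1// e2// (_ : `|_ - _| = `|fracint a (fun x => Phi x (w1 x)) s -
     fracint a (fun x => Phi x (w2 x)) s|); first exact: fracint_dist ha h1 h2.
  by rewrite distrC; congr `| _ |; lra.
have z := fracint_gronwall ha L0 hd (T := T) _ _.
have {}z s : 0 < s -> s < T -> `|Phi s (w1 s) - Phi s (w2 s)| = 0.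
  apply: z => r r0 rT; apply: (le_trans (hL r)); rewrite ler_wpM2l//.
  exact: d12.
apply/eqP; rewrite -subr_eq0 -normr_le0; apply: (le_trans (d12 t t0 tT)).
rewrite (@eq_fracint _ a _ (cst 0)).
  by rewrite fracint_cst// mul0r.
by move=> s s0 st; rewrite z// (lt_trans st).
Qed.

End volterra.

(** * Monotonicity of the solutions of Volterra equations *)

Section volterra_monotone.
Context {R : realType}.
Local Notation mu := (@lebesgue_measure R).
Implicit Types (a c h s t x y L M : R) (phi psi : R -> R).

(** Two fractional integrals of the same function compare as their kernels do. The
    exceptional point [p] is meant for the time at which the order of the kernels
    changes, or at which one of them is singular. *)
Lemma le_fracint_weighted (a a' c c' M : R) phi (t t' p : R) :
  -1 < a <= 0 -> -1 < a' <= 0 -> bnd M phi ->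
  0 <= c -> 0 <= c' ->
  (forall s, 0 < s -> s != p ->
    c * (heaviside (t - s) * (t - s) `^ a * phi s) <=
    c' * (heaviside (t' - s) * (t' - s) `^ a' * phi s)) ->
  c * fracint a phi t <= c' * fracint a' phi t'.
Proof.
move=> ha ha' hphi c0 c'0.
have hp := mge0_bnd hphi; have pa := mge0_pk (R := R).
have hc (b r k : R) : 0 <= k -> mge0 (fun s => k%:E * (pk b (r - s)%R * causal phi s))%E.
  move=> k0; split; first by apply: measurable_funeM; exact: (mge0_integrand r (pa b) hp).1.
  by move=> s; apply: mule_ge0; [rewrite lee_fin|exact: (mge0_integrand r (pa b) hp).2].
have hcE (b r k : R) : 0 <= k -> (k%:E * conv (pk b) (causal phi) r =
    \int[mu]_s (k%:E * (pk b (r - s)%R * causal phi s)))%E.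
  have hr := mge0_integrand r (pa b) hp.
  move=> k0; rewrite /conv ge0_integralZl ?lee_fin//; first exact: hr.1.
  by move=> s _; exact: hr.2.
have hF (b r k : R) : -1 < b <= 0 -> 0 <= k -> ((k * fracint b phi r)%:E =
    \int[mu]_s (k%:E * (pk b (r - s)%R * causal phi s)))%E.
  by move=> hb k0; rewrite EFinM (fracintE r hb hphi) hcE.
move=> le; rewrite -lee_fin [leLHS](hF a t c ha c0) [leRHS](hF a' t' c' ha' c'0).
apply: (@le_integral_but1 _ _ _ p); [exact: hc|exact: hc|].
move=> s sp; have [s0|s0] := ltP 0 s.
  by rewrite causal_gt0// /pk /causal -!EFinM lee_fin; exact: le.
by rewrite causal_le0// !mule0.
Qed.

Lemma last_zero (d : R -> R) s t : continuous d -> s < t -> d s <= 0 -> 0 < d t ->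
  exists r, [/\ s <= r, r < t, d r = 0 & forall x, r < x -> x <= t -> 0 < d x].
Proof.
move=> cd st ds dt.
pose E := [set r | s <= r <= t /\ d r <= 0].
have Es : E s by split => //; rewrite lexx ltW.
have hE : has_sup E by split; [exists s|exists t => r [/andP[]]].
have sE : s <= sup E by apply: ub_le_sup => //; exact: hE.2.
have Et : sup E <= t by apply: ge_sup; [exists s|move=> r [/andP[]]].
have after x : sup E < x -> x <= t -> 0 < d x.
  move=> Ex xt; rewrite ltNge; apply/negP => dx.
  have : x <= sup E.
    by apply: ub_le_sup; [exact: hE.2|split => //; rewrite xt andbT (le_trans sE)// ltW].
  by rewrite leNgt Ex.
have dE : d (sup E) <= 0.
  rewrite leNgt; apply/negP => dpos.
  have := cd (sup E); move/cvgrPdist_lt => /(_ _ dpos)/nbhs_ballP[e /= e0 he].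
  have [r [/andP[sr rt] dr] Er] := sup_adherent e0 hE.
  have rE : r <= sup E by apply: ub_le_sup; [exact: hE.2|split => //; rewrite sr].
  have : ball (sup E) e r by rewrite /ball/= ger0_norm ?subr_ge0//; lra.
  by move=> /he /=; rewrite ltr_norml => /andP[_]; lra.
have Elt : sup E < t.
  by rewrite lt_neqAle Et andbT; apply: contraTneq dt => <-; rewrite -leNgt.
exists (sup E); split => //; apply/le_anti; rewrite dE/= leNgt; apply/negP => dneg.
have [||r] := @IVT R d (sup E) t 0 (ltW Elt).
- by apply: continuous_subspaceT => x; exact: cd.
- by rewrite ge_min le_max (ltW dneg) (ltW dt) orbT.
rewrite in_itv/= => /andP[r1 r2] dr0.
have : 0 < d r.
  apply: after => //; rewrite lt_neqAle r1 andbT; apply: contraTneq dneg => ->.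
  by rewrite dr0 ltxx.
by rewrite dr0 ltxx.
Qed.

Lemma bnd_trunc M phi h : bnd M phi -> bnd M (fun s => phi s * ((s <= h)%R : bool)%:R).
Proof.
move=> hphi; split.
  apply: measurable_funM; first exact: hphi.1.
  rewrite (_ : (fun s => _) = \1_`]-oo, h]); first exact: measurable_indic.
  apply/funext => s; rewrite indicE; congr (nat_of_bool _)%:R.
  by apply/idP/idP; rewrite inE/= in_itv.
move=> x; have /andP[? ?] := hphi.2 x; have M0 := bnd_M_ge0 hphi.
by case: (x <= h); rewrite ?mulr1 ?mulr0 ?lexx//; apply/andP.
Qed.

Lemma bnd_shift M phi h : bnd M phi -> bnd M (fun s => phi (s + h)).
Proof.
move=> hphi; split; last by move=> s; exact: hphi.2.
by apply: (measurableT_comp hphi.1); exact: measurable_funD.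
Qed.

(** Restarting at time [h]: the past [0, h] acts through its memory, and what comes
    after is a fractional integral started at [h]. *)
Lemma fracint_split a M phi h t : -1 < a <= 0 -> bnd M phi -> 0 <= h ->
  fracint a phi (t + h) =
  fracint a (fun s => phi s * (s <= h)%R%:R) (t + h) + fracint a (fun s => phi (s + h)) t.
Proof.
move=> ha hphi h0.
have mlt : measurable_fun [set: R] (fun s : R => ((h < s)%R : bool)%:R : R).
  rewrite (_ : (fun s => _) = \1_`]h, +oo[); first exact: measurable_indic.
  apply/funext => s; rewrite indicE; congr (nat_of_bool _)%:R.
  by apply/idP/idP; rewrite inE/= in_itv/= andbT.
have h1 : bnd M (fun s => phi s * ((s <= h)%R : bool)%:R) by exact: bnd_trunc.
have h2 : bnd M (fun s => phi s * ((h < s)%R : bool)%:R).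
  split; first by apply: measurable_funM => //; exact: hphi.1.
  move=> x; have /andP[? ?] := hphi.2 x; have M0 := bnd_M_ge0 hphi.
  by case: (h < x); rewrite ?mulr1 ?mulr0 ?lexx//; apply/andP.
rewrite (@eq_fracint _ a phi
  ((fun s => phi s * ((s <= h)%R : bool)%:R) \+ (fun s => phi s * ((h < s)%R : bool)%:R)) (t + h)).
  rewrite (fracintD _ ha h1 h2); congr (_ + _); rewrite !fracint_def; congr fine.
  have hi := mge0_integrand (t + h) (mge0_pk a) (mge0_bnd h2).
  rewrite /conv -(ge0_integral_shift h hi.1 hi.2); apply: eq_integral => s _.
  rewrite (_ : t + h - (s + h) = t - s); last by lra.
  congr (_ * _)%E; have [s0|s0] := ltP 0 s.
    have hs : 0 < s + h by lra.
    by rewrite !causal_gt0// (_ : h < s + h) ?mulr1//; lra.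
  rewrite (causal_le0 _ s0) /causal (_ : (h < s + h) = false) ?mulr0 ?mulr0//.
  by apply/negbTE; rewrite -leNgt gerDr.
by move=> s _ _ /=; case: leP => _; rewrite mulr1 mulr0 ?addr0 ?add0r.
Qed.

(** The translate [v s = u (s + h)] solves the equation of [u] with the smaller datum
    [u0 - b], where [b] is the memory of [0, h]; it remains to see that the smaller
    datum gives the smaller solution. As the kernel is singular this is not
    immediate: let [x] solve the translated equation with [F (Num.min x u)] in place
    of [F x]. If [x] exceeds [u] at [t1], go back to the last time [t0] at which the
    two agree. Between [t0] and [t1] the source [P] of the equation of [x - u]
    vanishes, so that its fractional integral decreases at least by the factor
    [rho = (t1 / t0) `^ a] from [t0] to [t1], while [b], having an older memory,
    decreases at most by this factor. Hence [x - u] is nonpositive at [t1], a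
    contradiction. So [x <= u], the truncation by [u] is not active, and [x = v] by
    uniqueness. *)
Lemma volterra_nonincreasing a L M (u0 : R) (F u : R -> R) :
  -1 < a <= 0 -> 0 <= L ->
  {homo F : x y / x <= y} -> (forall x, 0 <= F x <= M) ->
  (forall x y, `|F x - F y| <= L * `|x - y|) ->
  measurable_fun [set: R] u ->
  (forall t, u t = u0 - fracint a (F \o u) t) ->
  {homo u : s t /~ s <= t}.
Proof.
move=> ha L0 homoF F0M lipF mu_ eu.
have balance (f1 f0 b1 b0 r : R) : 1 * f1 <= r * f0 -> r * b0 <= 1 * b1 ->
  f0 - b0 = 0 -> f1 - b1 <= 0 by move=> + + /eqP; rewrite subr_eq0 => h1 h2 /eqP e; move: h1 h2; rewrite e; lra.
have pos3 (p q r : R) : 0 < p -> q < r -> 0 < p + r - q by lra.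
(* Moving from time [p] to time [q] multiplies the distance to a past time [s > 0] by
   at least [q / p]; when both are delayed by [r], it multiplies the distance to
   [s < r] by at most [q / p]. *)
have ratio1 (p q s : R) : 0 < p -> p < q -> 0 < s -> s < p -> q / p * (p - s) <= q - s.
  move=> p0 pq s0 sp; rewrite mulrAC ler_pdivrMr//; nra.
have ratio2 (p q r s : R) : 0 < p -> p < q -> s < r -> q + r - s <= q / p * (p + r - s).
  move=> p0 pq sp; rewrite [leRHS]mulrAC ler_pdivlMr//; nra.
have mF : measurable_fun [set: R] F.
  by apply: continuous_measurable_fun; exact: lipschitz_continuous L0 lipF.
have bF w : measurable_fun [set: R] w -> bnd M (F \o w).
  by move=> mw; split; [exact: measurableT_comp|move=> x; exact: F0M].
have cu : continuous u.
  move=> t; rewrite (_ : u = fun t => u0 - fracint a (F \o u) t); last exact/funext.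
  by apply: cvgB; [exact: cvg_cst|exact: (continuous_fracint ha (bF _ mu_))].
suff main h : 0 < h -> forall t, 0 < t -> u (t + h) <= u t.
  have main0 h t : 0 < h -> 0 <= t -> u (t + h) <= u t.
    move=> h0; rewrite le_eqVlt => /predU1P[<-|]; last exact: main.
    by rewrite add0r (eu 0) fracint_le0// subr0 eu gerBl (fracint_ge0 _ _ (bF _ mu_)).
  move=> t s; rewrite le_eqVlt => /predU1P[->//|st].
  have [s0|s0] := leP 0 s; first by rewrite -(subrKC s t) main0 ?subr_gt0.
  by rewrite (eu s) (fracint_le0 _ _ (ltW s0)) subr0 eu gerBl (fracint_ge0 _ _ (bF _ mu_)).
move=> h0; pose v s := u (s + h).
have mv : measurable_fun [set: R] v.
  by apply: (measurableT_comp mu_); exact: measurable_funD.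
pose phi1 s := (F \o u) s * ((s <= h)%R : bool)%:R.
have h1 : bnd M phi1 by exact: bnd_trunc (bF _ mu_).
pose b t := fracint a phi1 (t + h).
have cb : continuous b.
  move=> t; apply: (@continuous_comp _ _ _ (fun t => t + h) (fracint a phi1)).
    by apply: cvgD; [exact: cvg_id|exact: cvg_cst].
  exact: continuous_fracint ha h1 _.
have ev t : v t = (u0 - b t) - fracint a (F \o v) t.
  by rewrite /v eu (fracint_split _ ha (bF _ mu_) (ltW h0)) opprD addrA.
pose Phi s x := F (Num.min x (u s)).
have minL x y z : `|Num.min x z - Num.min y z| <= `|x - y|.
  have h3 (p q : R) : p <= q -> `|Num.min p z - Num.min q z| <= `|p - q|.
    move=> pq; rewrite distrC [`|p - q|]distrC !ger0_norm ?subr_ge0//.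
      by case: (leP p z) => ?; case: (leP q z) => ?; lra.
    by rewrite le_min !ge_min pq lexx orbT.
  have [/h3//|/ltW/h3] := leP x y; by rewrite distrC [`|y - x|]distrC.
have [x [mx ex]] : exists x : R -> R, measurable_fun [set: R] x /\
    forall t, x t = (u0 - b t) - fracint a (fun s => Phi s (x s)) t.
  apply: (@volterra_exists _ a L M) => //.
  - by apply: measurable_funB => //; exact: continuous_measurable_fun.
  - by move=> s x; exact: F0M.
  - move=> s x y; apply: (le_trans (lipF _ _)); rewrite ler_wpM2l//.
  - move=> w mw; apply: (measurableT_comp mF).
    exact: (measurable_minr mw mu_).
have bmin : bnd M (fun s => Phi s (x s)).
  split; last by move=> s; exact: F0M.
  by apply: (measurableT_comp mF); exact: (measurable_minr mx mu_).
have cx : continuous x.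
  move=> t; rewrite (_ : x = fun t => u0 - b t - fracint a (fun s => Phi s (x s)) t); last exact/funext.
  apply: cvgB; last exact: (continuous_fracint ha bmin).
  by apply: cvgB; [exact: cvg_cst|exact: cb].
pose P s := F (u s) - Phi s (x s).
have hP : bnd M P.
  split; first by apply: measurable_funB; [exact: (bF _ mu_).1|exact: bmin.1].
  move=> s; have := homoF (Num.min (x s) (u s)) (u s); rewrite ge_min lexx orbT => /(_ isT).
  rewrite /P /Phi; have := F0M (u s); have := F0M (Num.min (x s) (u s)).
  by move=> /andP[? ?] /andP[? ?] ?; apply/andP; split; lra.
pose d t := x t - u t.
have ed t : d t = fracint a P t - b t.
  rewrite /d ex eu (_ : F \o u = P \+ (fun s => Phi s (x s))); last first.
    by apply/funext => s; rewrite /P /=; lra.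
  by rewrite (fracintD t ha hP bmin); lra.
have cd : continuous d by move=> t; apply: cvgB; [exact: cx|exact: cu].
have b0 t : 0 <= b t by exact: fracint_ge0 h1.
have le_xu t1 : 0 < t1 -> x t1 <= u t1.
  move=> t10; rewrite leNgt; apply/negP; rewrite -subr_gt0 -/(d t1) => dt1.
  have d0 : d 0 <= 0 by rewrite ed fracint_le0// sub0r oppr_le0.
  have [t0 [t00 t01 dt0 after]] := last_zero cd t10 d0 dt1.
  have P0 s : t0 < s -> s <= t1 -> P s = 0.
    move=> ts st; rewrite /P /Phi (_ : Num.min _ _ = u s) ?subrr//.
    by apply/min_idPr; have := after s ts st; rewrite /d subr_gt0 => /ltW.
  (* If the last contact is at time 0, the whole source [P] vanishes on ]0, t1]. *)
  move: t00; rewrite le_eqVlt => /predU1P[t00|t00].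
    move: dt1; rewrite ed (@eq_fracint _ a P (cst 0)).
      by rewrite fracint_cst// mul0r sub0r oppr_gt0 ltNge b0.
    by move=> s s0 st; apply: P0; rewrite -?t00// ltW.
  have [rho rhoE] : exists rho, rho = (t1 / t0) `^ a by eexists.
  have rho0 : 0 <= rho by rewrite rhoE powR_ge0.
  have q0 : 0 < t1 / t0 by rewrite divr_gt0.
  have leP' : 1 * fracint a P t1 <= rho * fracint a P t0.
    apply: (le_fracint_weighted (p := t0) ha ha hP) => // s s0 /negPf st0.
    have [st|] := ltP s t0; last first.
      rewrite le_eqVlt eq_sym st0 /= => ts; have [st|ts'] := leP s t1.
        by rewrite P0// !mulr0.
      have z : heaviside (t1 - s) = 0 :> R by rewrite heaviside_le0// subr_le0 ltW.
      rewrite z !mul0r mulr0; apply: mulr_ge0 => //; apply: mulr_ge0; last exact: bnd_ge0 hP s.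
      by apply: mulr_ge0; [exact: heaviside_ge0|exact: powR_ge0].
    rewrite !heaviside_gt0 ?subr_gt0//; last exact: lt_trans t01.
    rewrite !mul1r mulrA ler_wpM2r ?(bnd_ge0 hP)//.
    rewrite rhoE -powRM ?(ltW q0) ?subr_ge0 ?(ltW st)//.
    case/andP: ha => _ a0; apply: le0_le_powR => //; first by rewrite mulr_gt0 ?subr_gt0.
    exact: ratio1.
  have leb : rho * b t0 <= 1 * b t1.
    rewrite /b; apply: (@le_fracint_weighted a a rho 1 M phi1 (t0 + h) (t1 + h) h ha ha h1) => // s s0 /negPf sh.
    have [st|] := ltP s h; last first.
      by rewrite le_eqVlt eq_sym sh/= => hs; rewrite /phi1 (leNgt s) hs/= !mulr0.
    rewrite !heaviside_gt0; [|exact: pos3|exact: pos3].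
    rewrite !mul1r.
    rewrite mulrA.
    apply: ler_wpM2r; first exact: (bnd_ge0 h1 s).
    rewrite rhoE -powRM ?(ltW q0)//; last by apply/ltW/pos3.
    case/andP: ha => _ a0; apply: le0_le_powR => //; first exact: pos3.
    exact: ratio2.
  move: dt1; rewrite ltNge => /negP; apply; rewrite ed.
  by apply: (balance _ _ _ _ _ leP' leb); rewrite -ed.
move=> t t0.
rewrite -/(v t) (_ : v t = x t); first exact: le_xu.
apply: (@volterra_unique _ a L M (t + 1) (fun t => u0 - b t) v x (fun _ => F)) => //.
- exact: bF.
- exact: bF.
- move=> s s0 _; rewrite ex; congr (_ - _); apply: eq_fracint => r r0 _.
  rewrite /Phi (_ : Num.min _ _ = x r)//; exact/min_idPl/le_xu.
- by rewrite ltrDl.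
Qed.

End volterra_monotone.

(** * Positivity, and integration of order one *)

Section fracint_complements.
Context {R : realType}.
Local Notation mu := (@lebesgue_measure R).
Implicit Types (a c h s t x y L M : R) (phi psi : R -> R).

(** A nonnegative function with zero integral vanishes almost everywhere. *)
Lemma fracint_gt0 a M phi x y t : -1 < a <= 0 -> bnd M phi ->
  0 <= x -> x < y -> y <= t -> (forall s, x < s -> s < y -> 0 < phi s) ->
  0 < fracint a phi t.
Proof.
move=> ha hphi x0 xy yt pos; rewrite lt_neqAle (fracint_ge0 _ _ hphi) andbT.
apply/negP => /eqP e.
have hi := mge0_integrand t (mge0_pk a) (mge0_bnd hphi).
have : (\int[mu]_s `|pk a (t - s)%R * causal phi s| = 0)%E.
  transitivity ((fracint a phi t)%:E); last by rewrite -e.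
  rewrite (fracintE t ha hphi).
  by apply: eq_integral => s _; rewrite gee0_abs// hi.2.
move=> int0; have [N [mN N0 hN]] := (ae_eq_integral_abs mu measurableT hi.1).1 int0.
suff : (mu `]x, y[ <= mu N)%E.
  by rewrite N0 lebesgue_measure_itv/= lte_fin xy -EFinD lee_fin; lra.
apply: le_measure; rewrite ?inE//=; apply: subset_trans hN => s /=.
rewrite in_itv/= => /andP[xs sy] /(_ I).
rewrite /pk !causal_gt0; [|exact: le_lt_trans xs|rewrite subr_gt0; exact: lt_le_trans yt].
move/eqP; rewrite -EFinM eqe mulf_eq0 => /orP[|/eqP h].
  by rewrite powR_eq0 subr_eq0 => /andP[/eqP ts _]; move: sy yt; rewrite ts; lra.
by have := pos s xs sy; rewrite h ltxx.
Qed.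

Lemma beta00 : beta 0 0 = 1 :> R.
Proof.
have h0 : -1 < (0 : R) <= 0 by rewrite ltrN10 lexx.
apply: EFin_inj; rewrite (betaE h0 h0).
rewrite [pk 0 in X in conv _ X]/pk conv_heaviside//; last first.
  by move=> x; exact: powR_ge0.
under eq_integral do rewrite powRr0.
by rewrite integral_cst//= lebesgue_measure_itv/= lte_fin ltr01 mul1e oppr0 adde0.
Qed.

Lemma fracint1_0 t : 0 <= t -> fracint1 0 t = t.
Proof.
rewrite /fracint1 beta00 mulr1 add0r le_eqVlt => /predU1P[<-|t0].
  by rewrite heaviside_le0// mul0r.
by rewrite heaviside_gt0// mul1r powRr1// ltW.
Qed.

Lemma fracint0_cst c t : 0 <= c -> 0 <= t -> fracint 0 (cst c) t = c * t.
Proof.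
by move=> c0 t0; rewrite fracint_cst ?ltrN10 ?lexx// fracint1_0.
Qed.

Lemma heaviside0_powR0 t : heaviside t * t `^ 0 = heaviside t :> R.
Proof. by rewrite powRr0 mulr1. Qed.

Lemma fracint0_split M phi t h : bnd M phi -> 0 <= t -> 0 <= h ->
  fracint 0 phi (h + t) = fracint 0 phi t + fracint 0 (fun s => phi (s + t)) h.
Proof.
move=> hphi t0 h0; have z : -1 < (0 : R) <= 0 by rewrite ltrN10 lexx.
rewrite (fracint_split _ z hphi t0); congr (_ + _).
rewrite (@eq_fracint _ 0 phi (fun s => phi s * ((s <= t)%R : bool)%:R) t); last first.
  by move=> s _ st; rewrite ltW// mulr1.
set q := (fun s => _); have hq : bnd M q by exact: bnd_trunc.
have qt s : t < s -> q s = 0 by move=> ts; rewrite /q leNgt ts mulr0.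
apply/le_anti/andP; split; rewrite -[leLHS]mul1r -[leRHS]mul1r.
  apply: (@le_fracint_weighted _ 0 0 1 1 M q _ _ t z z hq ler01 ler01) => s s0 st.
  rewrite !mul1r !heaviside0_powR0; move: st; rewrite neq_lt => /orP[st|ts].
    by rewrite !heaviside_gt0 ?subr_gt0// (lt_le_trans st)// lerDr.
  by rewrite qt// !mulr0.
apply: (@le_fracint_weighted _ 0 0 1 1 M q _ _ t z z hq ler01 ler01) => s s0 st.
rewrite !mul1r !heaviside0_powR0; move: st; rewrite neq_lt => /orP[st|ts].
  by rewrite !heaviside_gt0 ?subr_gt0// (lt_le_trans st)// lerDr.
by rewrite qt// !mulr0.
Qed.

End fracint_complements.

(** * The global solution, its positivity and its decay *)

Section solution.
Context {R : realType} (g u0 L M : R) (F : R -> R).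
Hypotheses (g0 : 0 < g) (g1 : g < 1) (u00 : 0 < u0) (L0 : 0 <= L).
Hypotheses (homoF : {homo F : x y / x <= y}) (F0M : forall x, 0 <= F x <= M).
Hypotheses (lipF : forall x y, `|F x - F y| <= L * `|x - y|).
Hypotheses (F_le0 : forall x, x <= 0 -> F x = 0) (F_gt0 : forall x, 0 < x -> 0 < F x).

Let hk : -1 < - g <= 0. Proof. by rewrite ltrN2 g1 oppr_le0 ltW. Qed.
Let ha : -1 < g - 1 <= 0. Proof. by rewrite ltrBrDr addrC subrr g0 subr_le0 ltW. Qed.
Let z0 : -1 < (0 : R) <= 0. Proof. by rewrite ltrN10 lexx. Qed.

Lemma Gamma1B_gt0 : 0 < Gamma (1 - g).
Proof. by rewrite addrC Gamma_gt0. Qed.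

(** This number is [(Gamma g)^-1], because [beta (- g) (g - 1)] is
    [Gamma (1 - g) * Gamma g]. Written in this way, it lets [t `^ (- g)] and
    [t `^ (g - 1)] invert each other without that identity. *)
Definition rate : R := Gamma (1 - g) / beta (- g) (g - 1).

Lemma rate_gt0 : 0 < rate.
Proof. by rewrite divr_gt0 ?beta_gt0// Gamma1B_gt0. Qed.

Lemma F_measurable : measurable_fun [set: R] F.
Proof. by apply: continuous_measurable_fun; exact: lipschitz_continuous L0 lipF. Qed.

Lemma bndF w : measurable_fun [set: R] w -> bnd M (fun s => F (w s)).
Proof.
move=> mw; split; last by move=> s; exact: F0M.
exact: (measurableT_comp F_measurable mw).
Qed.

Lemma bndrF w : measurable_fun [set: R] w -> bnd (rate * M) (fun s => rate * F (w s)).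
Proof. by move=> mw; exact: bndZ (ltW rate_gt0) (bndF mw). Qed.

Lemma solution_exists : exists u : R -> R, measurable_fun [set: R] u /\
  forall t, u t = u0 - fracint (g - 1) (fun s => rate * F (u s)) t.
Proof.
apply: (@volterra_exists _ (g - 1) (rate * L) (rate * M) (cst u0) (fun _ x => rate * F x)).
- exact: ha.
- by rewrite mulr_ge0// ltW// rate_gt0.
- exact: measurable_cst.
- by move=> _ x; have /andP[? ?] := F0M x; have := ltW rate_gt0 => r0;
    rewrite mulr_ge0//= ler_wpM2l.
- move=> _ x y; rewrite -mulrBr normrM (gtr0_norm rate_gt0) -mulrA.
  by rewrite ler_wpM2l ?(ltW rate_gt0).
- by move=> w mw; exact: (bndrF mw).1.
Qed.

Variable u : R -> R.
Hypotheses (meas_u : measurable_fun [set: R] u).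
Hypothesis eu : forall t, u t = u0 - fracint (g - 1) (fun s => rate * F (u s)) t.

Lemma solution_nonincreasing : {homo u : s t /~ s <= t}.
Proof.
apply: (@volterra_nonincreasing _ (g - 1) (rate * L) (rate * M) u0 (fun x => rate * F x)) => //.
- by rewrite mulr_ge0// ltW// rate_gt0.
- by move=> x y xy; rewrite ler_wpM2l ?(ltW rate_gt0)// homoF.
- by move=> x; have /andP[? ?] := F0M x; have := ltW rate_gt0 => r0;
    rewrite mulr_ge0//= ler_wpM2l.
- move=> x y; rewrite -mulrBr normrM (gtr0_norm rate_gt0) -mulrA.
  by rewrite ler_wpM2l ?(ltW rate_gt0).
Qed.

Lemma solution_continuous : continuous u.
Proof.
move=> t; rewrite (_ : u = fun t => u0 - fracint (g - 1) (fun s => rate * F (u s)) t); last exact/funext.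
by apply: cvgB; [exact: cvg_cst|exact: (continuous_fracint ha (bndrF meas_u))].
Qed.

Lemma solution_le0 t : t <= 0 -> u t = u0.
Proof. by move=> t0; rewrite eu fracint_le0// subr0. Qed.

Lemma solution_le t : u t <= u0.
Proof. by rewrite eu gerBl (fracint_ge0 _ _ (bndrF meas_u)). Qed.

(** If [u] were negative at [t], let [r] be the last zero of [u] before [t]. The source
    vanishes between [r] and [t], and the memory of the past fades, so that [u] could
    only have grown since [r]. *)
Lemma solution_ge0 t : 0 <= u t.
Proof.
rewrite leNgt; apply/negP => ut.
have t0 : 0 < t.
  by rewrite ltNge; apply/negP => t0; move: ut; rewrite (solution_le0 t0) ltNge ltW.
have cN : continuous (fun t => - u t) by move=> x; apply: cvgN; exact: solution_continuous.
have [||r [r0 rt ur after]] := last_zero cN t0.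
- by rewrite (solution_le0 (lexx 0)) oppr_le0 ltW.
- by rewrite oppr_gt0.
have hr := bndrF meas_u.
have : 1 * fracint (g - 1) (fun s => rate * F (u s)) t <=
       1 * fracint (g - 1) (fun s => rate * F (u s)) r.
  apply: (@le_fracint_weighted _ _ _ _ _ _ _ _ _ r ha ha hr ler01 ler01) => s s0.
  rewrite neq_lt !mul1r => /orP[sr|rs].
    rewrite ler_wpM2r ?(bnd_ge0 hr)// !heaviside_gt0 ?subr_gt0//; last exact: lt_trans rt.
    rewrite !mul1r; case/andP: ha => _ a0; apply: le0_le_powR => //.
      by rewrite subr_gt0.
    by rewrite lerB// ltW.
  have [st|ts] := leP s t.
    by rewrite F_le0 ?mulr0// -oppr_ge0; exact/ltW/after.
  by rewrite !heaviside_le0 ?mul0r ?subr_le0 ?(ltW rs) ?(ltW ts).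
rewrite !mul1r; have := eu t; have := eu r; move/eqP: ur; rewrite oppr_eq0 => /eqP ->.
by set I1 := fracint _ _ t; set I2 := fracint _ _ r; move: ut; clearbody I1 I2; lra.
Qed.

Let w t := u0 - u t.

Let w_ge0 t : 0 <= w t. Proof. by rewrite subr_ge0 solution_le. Qed.

Let w_homo : {homo w : s t / s <= t}.
Proof. by move=> s t st; rewrite lerB// solution_nonincreasing. Qed.

Let hw : bnd u0 w.
Proof.
split; first exact: measurable_funB.
by move=> x; rewrite w_ge0/= gerBl solution_ge0.
Qed.

Let wE t : w t = fracint (g - 1) (fun s => rate * F (u s)) t.
Proof. by rewrite /w eu; set I := fracint _ _ _; rewrite opprB addrC subrK. Qed.

(** Convolve the Volterra equation with [t `^ (- g)]; by [conv_pk_pk] the two kernels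
    combine into a constant. *)
Lemma solution_convE t :
  conv (pk (- g)) (causal w) t =
  conv (pk 0) (causal (fun s => Gamma (1 - g) * F (u s))) t.
Proof.
have hF := mge0_bnd (bndrF meas_u); have B0 := beta_gt0 hk ha.
have -> : causal w = conv (pk (g - 1)) (causal (fun s => rate * F (u s))).
  apply/funext => s; have [s0|s0] := ltP 0 s.
    by rewrite causal_gt0// wE (fracintE s ha (bndrF meas_u)).
  by rewrite causal_le0// conv_le0.
rewrite convA//; [|exact: mge0_pk|exact: mge0_pk].
have -> : conv (pk (- g)) (pk (g - 1)) = (fun t => (beta (- g) (g - 1))%:E * pk 0 t)%E.
  apply/funext => s; rewrite conv_pk_pk// (_ : - g + (g - 1) + 1 = 0); last by lra.
  by rewrite /pk /causal -EFinM; congr EFin; ring.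
rewrite convZl ?(ltW B0)//; last exact: mge0_pk.
rewrite -convZr ?(ltW B0)//; last exact: mge0_pk.
congr conv; apply/funext => s; rewrite /causal -EFinM; congr EFin.
by rewrite /rate; field; rewrite gt_eqF.
Qed.

(** The memory equation. *)
Lemma solution_fracintE t :
  fracint (- g) w t = Gamma (1 - g) * fracint 0 (fun s => F (u s)) t.
Proof.
have hF := bndF meas_u.
by rewrite -(fracintZ t z0 (ltW Gamma1B_gt0) hF) !fracint_def solution_convE.
Qed.

Lemma solution_drop_gt0 t : 0 < t -> 0 < w t.
Proof.
move=> t0; rewrite lt_neqAle w_ge0 andbT; apply/negP => /eqP w0.
have : 0 < fracint (g - 1) (fun s => rate * F (u s)) t.
  apply: (@fracint_gt0 _ _ _ _ 0 t t ha (bndrF meas_u)) => // s s0 st.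
  rewrite mulr_gt0 ?rate_gt0// F_gt0//; apply: lt_le_trans u00 _.
  rewrite -subr_le0 -/(w s) w0; exact/w_homo/ltW.
by rewrite -wE -w0 ltxx.
Qed.

Let hD h : 0 <= h -> bnd u0 (fun s => w (s + h) - w s).
Proof.
move=> h0; split; first by apply: measurable_funB; [exact: (bnd_shift h hw).1|exact: hw.1].
move=> x; rewrite subr_ge0 w_homo ?lerDl//=.
by have /andP[_ h1] := hw.2 (x + h); rewrite (le_trans _ h1)// gerBl.
Qed.

(** As [w] is nondecreasing, both new terms are nonnegative: the memory gains at least
    what the values of [w] on [0, h] contribute at time [t + h]. All strict and
    quantitative lower bounds come from this gain, compared with the gain of
    [Gamma (1 - g) * fracint 0 (F \o u)] in the memory equation. *)
Lemma memory_increment t h : 0 <= t -> 0 <= h ->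
  fracint (- g) w (t + h) = fracint (- g) (fun s => w s * ((s <= h)%R : bool)%:R) (t + h) +
   (fracint (- g) (fun s => w (s + h) - w s) t + fracint (- g) w t).
Proof.
move=> t0 h0; rewrite (fracint_split _ hk hw h0); congr (_ + _).
rewrite -(fracintD t hk (hD h0) hw); apply: eq_fracint => s _ _ /=.
by rewrite subrK.
Qed.

(** If [u t = 0] then [u], being nonincreasing and nonnegative, vanishes from [t] on, and
    so does its source; then the right-hand side of the memory equation stops while
    the left-hand side still gains. *)
Lemma solution_gt0 t : 0 < u t.
Proof.
rewrite lt_neqAle solution_ge0 andbT; apply/negP => /eqP ut.
have [t0|t0] := leP t 0; first by move: u00; rewrite -(solution_le0 t0) -ut ltxx.
have e : fracint 0 (fun s => F (u s)) (1 + t) = fracint 0 (fun s => F (u s)) t.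
  rewrite (fracint0_split (bndF meas_u) (ltW t0) ler01).
  rewrite [X in _ + X](@eq_fracint _ 0 _ (cst 0)); last first.
    by move=> s s0 _; rewrite F_le0// ut solution_nonincreasing// lerDr ltW.
  by rewrite fracint_cst// mul0r addr0.
have e' : fracint (- g) w (t + 1) = fracint (- g) w t.
  by rewrite !solution_fracintE (addrC t 1) e.
have := memory_increment (ltW t0) ler01; rewrite e'.
have h1 := fracint_ge0 (- g) t (hD ler01).
have h2 : 0 < fracint (- g) (fun s => w s * ((s <= 1)%R : bool)%:R) (t + 1).
  apply: (@fracint_gt0 _ _ _ _ 0 1 _ hk (bnd_trunc 1 hw)) => //.
    by rewrite lerDr ltW.
  by move=> s s0 s1; rewrite (ltW s1) mulr1 solution_drop_gt0.
move: h1 h2; set I1 := fracint _ _ t; set I2 := fracint _ _ _; set I3 := fracint _ w t.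
by clearbody I1 I2 I3; lra.
Qed.

(** In the memory equation [w <= u0] on the left, and [F (u t) <= F (u s)] on the right. *)
Lemma solution_F_le t : 0 < t ->
  Gamma (1 - g) * (F (u t) * t) <= u0 * (t `^ (1 - g) * beta (- g) 0).
Proof.
move=> t0.
have e1 : u0 * (t `^ (1 - g) * beta (- g) 0) = fracint (- g) (cst u0) t.
  by rewrite fracint_cst ?(ltW u00)// /fracint1 heaviside_gt0// mul1r addrC.
have Fu0 : 0 <= F (u t) by case/andP: (F0M (u t)).
rewrite -(fracint0_cst Fu0 (ltW t0)) e1.
apply: (@le_trans _ _ (fracint (- g) w t)).
  rewrite solution_fracintE ler_wpM2l ?(ltW Gamma1B_gt0)//.
  apply: (le_fracint z0 (bnd_cst Fu0) (bndF meas_u)) => s s0 st /=.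
  by rewrite homoF// solution_nonincreasing// ltW.
apply: (le_fracint hk hw (bnd_cst (ltW u00))) => s _ _ /=.
by have /andP[] := hw.2 s.
Qed.

(** Otherwise [F (u t)] would stay above [F e > 0], whereas [solution_F_le] makes
    it at most of order [t `^ (- g)]. The time [t] below is chosen so that [t `^ g]
    exceeds the resulting constant [D]. *)
Lemma solution_small e : 0 < e -> exists T, 0 < T /\ forall t, T <= t -> u t <= e.
Proof.
move=> e0; have [[T [T0 uT]]|nT] := pselect (exists T, 0 < T /\ u T <= e).
  exists T; split => // t Tt; apply: le_trans uT; exact: solution_nonincreasing.
have big t : 0 < t -> e <= u t.
  by move=> t0; rewrite leNgt; apply/negP => ut; apply: nT; exists t; rewrite ltW.
have G0 := Gamma1B_gt0; have F0 := F_gt0 e0.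
have b0 : 0 < beta (- g) 0 by exact: beta_gt0.
pose D := u0 * beta (- g) 0 / (Gamma (1 - g) * F e).
have D0 : 0 < D by rewrite divr_gt0 ?mulr_gt0.
pose t := (D + 1) `^ g^-1.
have D1 : 0 < D + 1 by rewrite addr_gt0.
have t0 : 0 < t by rewrite powR_gt0.
have tg : t `^ g = D + 1 by rewrite /t -powRrM mulVf ?gt_eqF// powRr1// ltW.
have := solution_F_le t0.
have h1 : Gamma (1 - g) * (F e * t) <= Gamma (1 - g) * (F (u t) * t).
  by rewrite ler_wpM2l ?(ltW G0)// ler_wpM2r ?(ltW t0)// homoF// big.
move=> /(le_trans h1).
have tE : t = t `^ (1 - g) * (D + 1).
  by rewrite -tg -powRD ?subrK ?powRr1 ?(ltW t0)// (gt_eqF t0) implybT.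
rewrite [X in _ * (_ * X)]tE (_ : u0 * _ = t `^ (1 - g) * (Gamma (1 - g) * F e * D)); last first.
  by rewrite /D; field; rewrite !gt_eqF.
rewrite (_ : Gamma (1 - g) * (F e * _) = t `^ (1 - g) * (Gamma (1 - g) * F e * (D + 1))); last by ring.
rewrite ler_pM2l ?powR_gt0// ler_pM2l ?mulr_gt0// gerDl.
by rewrite leNgt ltr01.
Qed.

Lemma solution_cvg0 : u t @[t --> +oo] --> (0 : R).
Proof.
apply/cvgrPdist_le => e e0; have [T [_ hT]] := solution_small e0.
near=> t; rewrite sub0r normrN ger0_norm ?solution_ge0//; apply: hT.
by near: t; apply: nbhs_pinfty_ge; exact: num_real.
Unshelve. all: by end_near. Qed.

(** Compare the gains over [t, 2t] in the memory equation. The right-hand side gains at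
    most [Gamma (1 - g) * F (u t) * t], by monotonicity. The left-hand side gains at
    least the memory at time [2t] of the values of [w] on [0, t]; as [u] tends to 0,
    these values exceed [u0 / 2] except on a bounded interval, so that this memory is
    of order [u0 * t `^ (1 - g)]. *)
Lemma solution_F_ge : \forall t \near +oo,
  u0 / 8 * t `^ (- g) <= Gamma (1 - g) * F (u t).
Proof.
have u02 : 0 < u0 / 2 by rewrite divr_gt0.
have [T [T0 hT]] := solution_small u02.
near=> t.
have tT : T + T <= t by near: t; apply: nbhs_pinfty_ge; exact: num_real.
have Tt : T < t by apply: lt_le_trans tT; rewrite ltrDl.
have t0 : 0 < t by exact: lt_trans Tt.
pose phi s := w s * ((s <= t)%R : bool)%:R.
have hphi : bnd u0 phi by exact: bnd_trunc.
have Fu0 : 0 <= F (u t) by case/andP: (F0M (u t)).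
have G0 := Gamma1B_gt0.
(* Upper bound on the gain of the right-hand side over [t, 2t]. *)
have h1 : fracint (- g) phi (t + t) <= Gamma (1 - g) * (F (u t) * t).
  have e1 : Gamma (1 - g) * fracint 0 (fun s => F (u (s + t))) t =
      fracint (- g) w (t + t) - fracint (- g) w t.
    rewrite !solution_fracintE (fracint0_split (bndF meas_u) (ltW t0) (ltW t0)) -mulrBr.
    by rewrite addrAC subrr add0r.
  apply: (@le_trans _ _ (Gamma (1 - g) * fracint 0 (fun s => F (u (s + t))) t)).
    rewrite e1 (memory_increment (ltW t0) (ltW t0)) addrA addrK lerDl.
    exact: fracint_ge0 (hD (ltW t0)).
  rewrite ler_wpM2l ?(ltW G0)// -(fracint0_cst Fu0 (ltW t0)).
  apply: (le_fracint z0 (bnd_shift t (bndF meas_u)) (bnd_cst Fu0)) => s s0 _ /=.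
  by rewrite homoF// solution_nonincreasing// lerDr ltW.
(* The kernel [(2t - s) `^ (- g)] is at least [(2t) `^ (- g)]. *)
have h2 : (t + t) `^ (- g) * fracint 0 phi (t + t) <= 1 * fracint (- g) phi (t + t).
  apply: (@le_fracint_weighted _ _ _ _ _ _ _ _ _ 0 z0 hk hphi (powR_ge0 _ _) ler01) => s s0 _.
  rewrite mul1r heaviside0_powR0 mulrA ler_wpM2r ?(bnd_ge0 hphi)//.
  have [st|ts] := ltP s (t + t); last by rewrite heaviside_le0 ?subr_le0// mulr0 mul0r.
  rewrite heaviside_gt0 ?subr_gt0// mulr1 mul1r; case/andP: hk => _ k0.
  by apply: le0_le_powR => //; rewrite ?subr_gt0// gerBl ltW.
(* After [T], [u <= u0 / 2] and hence [w >= u0 / 2]. *)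
have h3 : u0 / 2 * (t - T) <= fracint 0 phi (t + t).
  have tT0 : 0 <= t - T by rewrite subr_ge0 ltW.
  rewrite (fracint0_split hphi (ltW t0) (ltW t0)) -[leLHS]addr0.
  apply: lerD; last exact: fracint_ge0 (bnd_shift t hphi).
  rewrite -[X in fracint 0 phi X](subrK T t) (fracint0_split hphi (ltW T0) tT0) -[leLHS]add0r.
  apply: lerD; first exact: fracint_ge0 hphi.
  rewrite -(fracint0_cst (ltW u02) tT0).
  apply: (le_fracint z0 (bnd_cst (ltW u02)) (bnd_shift T hphi)) => s s0 st /=.
  rewrite /phi (_ : s + T <= t) ?mulr1; last by rewrite -lerBrDr ltW.
  rewrite /w lerBrDr -lerBrDl (_ : u0 - u0 / 2 = u0 / 2); last by field.
  by apply: hT; rewrite lerDr ltW.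
have h4 : t `^ (- g) / 2 <= (t + t) `^ (- g).
  rewrite -mulr2n -[in leRHS]mulr_natl powRM ?(ltW t0)// mulrC ler_wpM2r ?powR_ge0//.
  by rewrite -powR_inv1// ler_powR ?ler1n// lerN2 ltW.
have h5 : t / 2 <= t - T.
  by rewrite ler_pdivrMr// mulrBl mulr_natr mulr2n; rewrite mulr_natr mulr2n -addrA lerDl subr_ge0.
have h6 : t `^ (- g) / 2 * (u0 / 2 * (t / 2)) <= Gamma (1 - g) * (F (u t) * t).
  apply: le_trans h1; rewrite -[leRHS]mul1r; apply: le_trans h2.
  apply: ler_pM => //.
  - by rewrite divr_ge0// powR_ge0.
  - by rewrite mulr_ge0 ?divr_ge0// ltW.
  - by apply: le_trans h3; rewrite ler_wpM2l// ltW.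
rewrite -(ler_pM2r t0) -[leRHS]mulrA; apply: le_trans h6.
by rewrite le_eqVlt; apply/orP; left; apply/eqP; field.
Unshelve. all: by end_near. Qed.

(** Suppose that [u] is constant on [s, t], with midpoint [m = s + h]. The right-hand
    side of the memory equation gains the same amount on [s, m] and on [m, t]. On the
    left, the gain is a memory of [w] on [0, h] plus a memory of the increments [D] of
    [w]; the former is strictly smaller at the later time, and so, weakly, is the
    latter, because [D] vanishes on [s, m]. *)
Lemma solution_decreasing s t : 0 <= s -> s < t -> u t < u s.
Proof.
move=> s0 st; rewrite lt_neqAle solution_nonincreasing ?(ltW st)// andbT.
apply/negP => /eqP uts.
pose h := (t - s) / 2; have h0 : 0 < h by rewrite divr_gt0// subr_gt0.
have ucst r : s <= r -> r <= t -> u r = u s.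
  move=> sr rt; apply/le_anti; rewrite solution_nonincreasing//=.
  by rewrite -uts solution_nonincreasing.
have [m mE] : exists m, m = s + h by eexists.
have tE : t = m + h by rewrite mE /h; field.
have m0 : 0 < m by rewrite mE ltr_wpDl.
have sm : s < m by rewrite mE ltrDl.
have mt : m < t by rewrite tE ltrDl.
have e1 : fracint 0 (fun x => F (u x)) (h + m) - fracint 0 (fun x => F (u x)) m =
          fracint 0 (fun x => F (u x)) (h + s) - fracint 0 (fun x => F (u x)) s.
  rewrite (fracint0_split (bndF meas_u) (ltW m0) (ltW h0)).
  rewrite (fracint0_split (bndF meas_u) s0 (ltW h0)).
  rewrite (@eq_fracint _ 0 (fun x => F (u (x + m))) (fun x => F (u (x + s)))).
    by rewrite addrAC subrr [RHS]addrAC subrr.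
  move=> x x0 xh.
  have xm : x + m <= t by rewrite tE addrC lerD2l ltW.
  have sx : s <= x + s by rewrite lerDr ltW.
  have sxm : x + s <= x + m by rewrite lerD2l ltW.
  have xst := le_trans sxm xm; have smx := le_trans sx sxm.
  by rewrite (ucst _ smx xm) (ucst _ sx xst).
pose phi x := w x * ((x <= h)%R : bool)%:R.
pose D x := w (x + h) - w x.
have hphi : bnd u0 phi by exact: bnd_trunc.
have bD := hD (ltW h0).
have e2 : fracint (- g) phi (m + h) + fracint (- g) D m =
          fracint (- g) phi (s + h) + fracint (- g) D s.
  have im := memory_increment (ltW m0) (ltW h0); have is_ := memory_increment s0 (ltW h0).
  move: e1 => /(congr1 (fun x => Gamma (1 - g) * x)); rewrite !mulrBr -!solution_fracintE.
  rewrite [h + m]addrC [h + s]addrC im is_ !addrA !addrK.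
  move=> e; exact: e.
(* [D] vanishes on [s, m], and on [0, s] the memory has faded from [s] to [m]. *)
have le1 : fracint (- g) D m <= fracint (- g) D s.
  rewrite -[leLHS]mul1r -[leRHS]mul1r.
  apply: (@le_fracint_weighted _ _ _ _ _ _ _ _ _ s hk hk bD ler01 ler01) => x x0.
  rewrite neq_lt !mul1r => /orP[xs|sx].
    rewrite ler_wpM2r ?(bnd_ge0 bD)// !heaviside_gt0 ?subr_gt0//; last exact: lt_trans sm.
    rewrite !mul1r; case/andP: hk => _ k0; apply: le0_le_powR => //.
      by rewrite subr_gt0.
    by rewrite lerB// ltW.
  have [xm|mx] := leP x m.
    have xh : x + h <= t by rewrite tE lerD2r.
    rewrite (_ : w (x + h) - w x = 0) ?mulr0// /w !ucst ?subrr//.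
    - exact: ltW.
    - exact: le_trans (ltW mt).
    - by rewrite (le_trans (ltW sx))// lerDl ltW.
  rewrite !heaviside_le0 ?mul0r// subr_le0 ltW//.
have sh0 : 0 < s + h by rewrite -mE.
pose rho := ((m + h) / (s + h)) `^ (- g).
have q1 : 1 < (m + h) / (s + h) by rewrite ltr_pdivlMr// mul1r ltrD2r.
have q0 : 0 < (m + h) / (s + h) by exact: lt_trans q1.
have rho1 : rho < 1.
  rewrite -[ltRHS](@powR1E R (- g)); apply: lt0_lt_powR => //.
  by rewrite oppr_lt0.
have rho0 : 0 <= rho by exact: powR_ge0.
(* The memory of [0, h] fades by a factor [rho < 1] at least from [s + h] to [m + h]. *)
have le2 : 1 * fracint (- g) phi (m + h) <= rho * fracint (- g) phi (s + h).
  apply: (@le_fracint_weighted _ _ _ _ _ _ _ _ _ h hk hk hphi ler01 rho0) => x x0.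
  rewrite neq_lt mul1r => /orP[xh|hx]; last by rewrite /phi (leNgt x) hx/= !mulr0.
  have p1 : 0 < s + h - x by rewrite subr_gt0 (lt_le_trans xh)// lerDr.
  have p2 : 0 < m + h - x by rewrite subr_gt0 (lt_trans xh)// ltrDr.
  rewrite !heaviside_gt0// !mul1r mulrA ler_wpM2r ?(bnd_ge0 hphi)//.
  rewrite /rho -powRM ?(ltW q0) ?(ltW p1)//; case/andP: hk => _ k0.
  apply: le0_le_powR => //; first by rewrite mulr_gt0.
  rewrite mulrAC ler_pdivrMr// [leLHS]mulrBr [leRHS]mulrBl.
  by rewrite lerD2l lerN2 mulrC ler_pM2r// lerD2r ltW.
have pos : 0 < fracint (- g) phi (s + h).
  apply: (@fracint_gt0 _ _ _ _ 0 h _ hk hphi) => //; first by rewrite lerDr.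
  by move=> x x0 xh; rewrite /phi (ltW xh) mulr1 solution_drop_gt0.
have le3 : rho * fracint (- g) phi (s + h) < fracint (- g) phi (s + h).
  by rewrite gtr_pMl.
move: le1 le2 le3 e2; rewrite mul1r.
set I1 := fracint _ _ _; set I2 := fracint _ _ _; set I3 := fracint _ _ _; set I4 := fracint _ _ _.
move: (rho * _) => I5; clearbody I1 I2 I3 I4; lra.
Qed.

End solution.

(** * A smooth step *)

Section smooth_functions.
Context {R : realType}.
Implicit Types (c d k x y : R) (f : R -> R).

(** The smoothness clause of [test_function]. *)
Definition smooth f := forall (n : nat) (x : R), derivable (derive1n n f) x 1.

Lemma smooth_class (P : (R -> R) -> Prop) :
  (forall f, P f -> (forall x, derivable f x 1) /\ P (derive1 f)) ->
  forall f, P f -> smooth f.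
Proof.
move=> hP f Pf n; suff : P (derive1n n f) by move=> /hP[].
elim: n => [|n IH]; first by rewrite derive1n0.
by rewrite derive1nS; have [_] := hP _ IH.
Qed.

Lemma smooth_derivable f x : smooth f -> derivable f x 1.
Proof. by move=> /(_ 0%N x). Qed.

Lemma smooth_derive1 f : smooth f -> smooth (derive1 f).
Proof. by move=> sf n x; rewrite -derive1Sn; exact: sf. Qed.

Lemma smooth_primitive f : (forall x, derivable f x 1) -> smooth (derive1 f) -> smooth f.
Proof. by move=> df sf [|n] x; [exact: df|rewrite derive1Sn; exact: sf]. Qed.

Lemma is_derive1_smooth f x : smooth f -> is_derive x 1 f ((derive1 f) x).
Proof. by move=> sf; rewrite derive1E; exact/derivableP/smooth_derivable. Qed.

Lemma is_derive_affine c d x : is_derive x (1 : R) (affine c d) c.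
Proof.
have h1 : is_derive x (1 : R) (fun x : R => x) 1 by exact: is_derive_id.
have h2 := is_deriveZ c h1.
have h3 : is_derive x (1 : R) (cst d : R -> R) 0 by exact: is_derive_cst.
have := is_deriveD h2 h3; rewrite addr0 (_ : c *: (1 : R) = c) //.
by rewrite /GRing.scale/= mulr1.
Qed.

Lemma is_derive_comp_affine f c d x df :
  is_derive (affine c d x) 1 f df -> is_derive x (1 : R) (fun x => f (affine c d x)) (df * c).
Proof. by move=> h; exact: (is_derive1_comp h (is_derive_affine c d x)). Qed.

Lemma smooth_affine f k c d : smooth f -> smooth (fun x => k * f (affine c d x)).
Proof.
pose P (h : R -> R) := exists k f, smooth f /\ h = fun x => k * f (affine c d x).
move=> sf; apply: (@smooth_class P); last by exists k, f.
move=> _ [{}k [{}f [{}sf ->]]].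
have dh x : is_derive x (1 : R) (fun x => k * f (affine c d x)) (k * ((derive1 f) (affine c d x) * c)).
  exact/is_deriveZ/is_derive_comp_affine/is_derive1_smooth.
split; first by move=> x; by have [] := dh x.
exists (k * c), (derive1 f); split; first exact: smooth_derive1.
apply/funext => x; rewrite derive1E (derive_val (is_derive := dh x)).
by rewrite mulrAC -mulrA.
Qed.

Lemma smoothB f h : smooth f -> smooth h -> smooth (f \- h).
Proof.
pose P (q : R -> R) := exists f h, [/\ smooth f, smooth h & q = f \- h].
move=> sf sh; apply: (@smooth_class P); last by exists f, h.
move=> _ [{}f [{}h [{}sf {}sh ->]]].
have dh x : is_derive x (1 : R) (f \- h) ((derive1 f) x - (derive1 h) x).
  by apply: is_deriveB; exact: is_derive1_smooth.
split; first by move=> x; by have [] := dh x.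
exists (derive1 f), (derive1 h); split; [exact: smooth_derive1|exact: smooth_derive1|].
by apply/funext => x; rewrite derive1E (derive_val (is_derive := dh x)).
Qed.

End smooth_functions.

Section smooth_step.
Context {R : realType}.
Implicit Types (x y t : R) (p q : {poly R}).

(** These functions, for all polynomials [p], are closed under differentiation: see
    [is_derive_flat]. The case [p = 1] is the classical flat function. *)
Definition flat p x : R := if 0 < x then p.[x^-1] * expR (- x^-1) else 0.

Lemma flat_le0 p x : x <= 0 -> flat p x = 0.
Proof. by move=> x0; rewrite /flat ltNge x0. Qed.

Lemma flat_gt0 p x : 0 < x -> flat p x = p.[x^-1] * expR (- x^-1).
Proof. by move=> x0; rewrite /flat x0. Qed.

Lemma poly_bound p : exists C n, 0 <= C /\ forall y, 1 <= y -> `|p.[y]| <= C * y ^+ n.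
Proof.
exists (\sum_(i < size p) `|p`_i|), (size p); split; first by rewrite sumr_ge0.
move=> y y1; rewrite horner_coef mulr_suml; apply: (le_trans (ler_norm_sum _ _ _)).
apply: ler_sum => i _; rewrite normrM ler_wpM2l// normrX ger0_norm; last by lra.
by rewrite ler_weXn2l// ltnW.
Qed.

(** The exponential beats every power of [x^-1]; a quadratic bound is what
    differentiability at 0 takes. *)
Lemma flat_small p : exists C, 0 <= C /\ forall x, `|x| <= 1 -> `|flat p x| <= C * x ^+ 2.
Proof.
have [C [n [C0 hC]]] := poly_bound p.
exists (C * (n.+2)`!%:R); split; first by rewrite mulr_ge0.
move=> x x1; have [x0|x0] := leP x 0.
  by rewrite flat_le0// normr0; apply: mulr_ge0; [exact: mulr_ge0|exact: sqr_ge0].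
rewrite flat_gt0//; rewrite ger0_norm ?(ltW x0)// in x1.
set y := x^-1; have y1 : 1 <= y by rewrite invf_ge1.
have y0 : 0 < y by lra.
rewrite normrM [X in _ * X]ger0_norm ?expR_ge0// expRN ler_pdivrMr ?expR_gt0//.
apply: (le_trans (hC y y1)).
have h := expR_ge1Dxn n.+1 (ltW y0).
have h1 : y ^+ n.+2 / n.+2`!%:R <= expR y by lra.
have xy : x ^+ 2 = (y ^+ 2)^-1 by rewrite /y exprVn invrK.
apply: (@le_trans _ _ (C * (n.+2)`!%:R * x ^+ 2 * (y ^+ n.+2 / n.+2`!%:R))).
  rewrite xy -addn2 exprD; set f := _`!%:R.
  have f0 : f != 0 by rewrite /f pnatr_eq0 -lt0n fact_gt0.
  rewrite le_eqVlt; apply/orP; left; apply/eqP; field.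
  by rewrite f0 gt_eqF.
rewrite ler_wpM2l//; apply: mulr_ge0; [exact: mulr_ge0|exact: sqr_ge0].
Qed.

(** By the chain rule, with [y = x^-1] and [dy = - y ^+ 2 dx], the derivative of
    [p(y) * expR (- y)]. *)
Definition flat_derive p : {poly R} := 'X ^+ 2 * (p - p^`()).

Lemma is_derive_flat p x : is_derive x (1 : R) (flat p) (flat (flat_derive p) x).
Proof.
have [x0|x0|->] := ltgtP x 0.
- rewrite [flat (flat_derive p) x]flat_le0 ?ltW//.
  apply: (near_eq_is_derive (f := cst 0)).
  by near=> z; rewrite flat_le0// ltW//; near: z; exact: lt_nbhsl.
- have xn0 : (id x : R) != 0 by rewrite gt_eqF.
  have dV : is_derive x (1 : R) (fun x : R => x^-1) (- x ^- 2).
    apply: is_derive_eq; first exact: (is_deriveV xn0 (is_derive_id x (1 : R))).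
    by rewrite /GRing.scale/= mulr1.
  have dP := is_derive1_comp (is_derive_poly p x^-1) dV.
  have dN := is_deriveN dV.
  have dE := @is_derive1_comp R expR (fun x => - x^-1) x _ _ (is_derive_expR (- x^-1)) dN.
  apply: is_derive_eq.
    apply: (near_eq_is_derive _ (is_deriveM dP dE)).
    near=> z; rewrite [RHS]flat_gt0//.
    by near: z; exact: lt_nbhsr.
  rewrite flat_gt0// /flat_derive /GRing.scale/= !hornerE /=.
  by rewrite -exprVn; ring.
rewrite [flat (flat_derive p) 0]flat_le0//.
have [C [C0 hC]] := flat_small p.
suff cv : h^-1 *: (flat p (h *: 1 + 0) - flat p 0) @[h --> 0^'] --> (0 : R).
  apply: DeriveDef; last exact: cvg_lim cv.
  by apply/cvg_ex; exists 0.
apply/cvgrPdist_le => e e0.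
near=> h.
have h0 : h != 0 by near: h; exact: nbhs_dnbhs_neq.
have h1 : `|h| <= 1 by near: h; apply: dnbhs0_le.
have he : `|h| <= e / (C + 1).
  near: h; apply: dnbhs0_le; rewrite divr_gt0//; lra.
rewrite sub0r normrN /GRing.scale/= mulr1 addr0 (flat_le0 p (lexx 0)) subr0.
rewrite normrM normfV ler_pdivrMl ?normr_gt0//.
apply: (le_trans (hC h h1)).
rewrite -[h ^+ 2](@ger0_norm _ (h ^+ 2)) ?sqr_ge0// normrX.
rewrite expr2 mulrCA ler_wpM2l//.
move: he; rewrite ler_pdivlMr; last by lra.
by have := normr_ge0 h; rewrite mulrDr mulr1 mulrC; lra.
Unshelve. all: by end_near. Qed.

(** The derivative of a product is the difference of two products, the second factor
    being reflected; hence the closure under differences. *)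
Inductive bump_class : (R -> R) -> Prop :=
| Bump_prod p q : bump_class (fun x => flat p x * flat q (affine (-1) 1 x))
| Bump_sub f h : bump_class f -> bump_class h -> bump_class (f \- h).

Lemma bump_class_derive f : bump_class f -> forall x, derivable f x 1.
Proof.
elim=> [p q|{}f h _ df _ dh] x; last exact: derivableB.
have d1 := is_derive_flat p x.
have d2 := is_derive_comp_affine (is_derive_flat q (affine (-1) 1 x)).
by have [] := is_deriveM d1 d2.
Qed.

Lemma bump_class_derive1 f : bump_class f -> bump_class (derive1 f).
Proof.
elim=> [p q|{}f h Cf df Ch dh].
  rewrite (_ : derive1 _ = (fun x => flat (flat_derive p) x * flat q (affine (-1) 1 x)) \-
     (fun x => flat p x * flat (flat_derive q) (affine (-1) 1 x))).
    by apply: Bump_sub; exact: Bump_prod.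
  apply/funext => x.
  have d1 := is_derive_flat p x.
  have d2 := is_derive_comp_affine (is_derive_flat q (affine (-1) 1 x)).
  rewrite derive1E (derive_val (is_derive := is_deriveM d1 d2)) /GRing.scale/=.
  by ring.
rewrite (_ : derive1 _ = (derive1 f) \- (derive1 h)); first exact: Bump_sub.
apply/funext => x; rewrite derive1E deriveB//; last 2 first.
- exact: bump_class_derive.
- exact: bump_class_derive.
by rewrite /= !derive1E.
Qed.

Definition bump x : R := flat 1 x * flat 1 (affine (-1) 1 x).

Lemma smooth_bump : smooth bump.
Proof.
apply: (@smooth_class _ bump_class); last exact: Bump_prod.
by move=> f Cf; split; [exact: bump_class_derive|exact: bump_class_derive1].
Qed.

Lemma flat1_ge0 x : 0 <= flat 1 x.
Proof. by rewrite /flat; case: ifP => // _; rewrite mulr_ge0 ?expR_ge0// hornerC. Qed.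

Lemma bump_ge0 x : 0 <= bump x.
Proof. by rewrite mulr_ge0// flat1_ge0. Qed.

Lemma bump_le0 x : x <= 0 -> bump x = 0.
Proof. by move=> x0; rewrite /bump flat_le0// mul0r. Qed.

Lemma bump_ge1 x : 1 <= x -> bump x = 0.
Proof. by move=> x1; rewrite /bump [X in _ * X]flat_le0 ?mulr0// /affine mulN1r addrC subr_le0. Qed.

Lemma bump_gt0 x : 0 < x -> x < 1 -> 0 < bump x.
Proof.
move=> x0 x1; have h (y : R) : 0 < y -> 0 < flat 1 y.
  by move=> y0; rewrite flat_gt0// hornerC mul1r expR_gt0.
by rewrite mulr_gt0 ?h// /affine mulN1r addrC subr_gt0.
Qed.

Lemma continuous_bump : continuous bump.
Proof.
by move=> x; apply/differentiable_continuous/derivable1_diffP/smooth_derivable/smooth_bump.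
Qed.

Lemma bump_le1 x : bump x <= 1.
Proof.
have h y : flat 1 y <= 1.
  rewrite /flat; case: ifPn => // y0.
  by rewrite hornerC mul1r -expR0 ler_expR oppr_le0 invr_ge0 ltW.
by rewrite /bump mulr_ile1// flat1_ge0.
Qed.

Lemma bnd_bump : bnd 1 bump.
Proof.
split; first exact: continuous_measurable_fun continuous_bump.
by move=> x; rewrite bump_ge0 bump_le1.
Qed.

Local Notation mu := (@lebesgue_measure R).

Lemma integrable_bump (A : set R) : measurable A -> mu.-integrable A (EFin \o bump).
Proof.
move=> mA; apply: (@integrableS _ _ _ mu setT) => //.
have -> : EFin \o bump = (EFin \o bump) \_ `[0, 1].
  apply/funext => x; rewrite patchE; case: ifPn => //=.
  rewrite notin_setE/= in_itv/= => /negP; rewrite negb_and -!ltNge => /orP[x0|x1].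
    by rewrite bump_le0// ltW.
  by rewrite bump_ge1// ltW.
apply/integrable_restrict => //; rewrite setTI.
apply: continuous_compact_integrable; first exact: segment_compact.
exact: continuous_subspaceT continuous_bump.
Qed.

Definition bump_mass x : R := (\int[mu]_(t in `]-oo, x]) bump t)%R.

Lemma bump_mass_mkcond x : bump_mass x = fracint 0 bump x.
Proof.
rewrite fracint_def /bump_mass /Rintegral; congr fine.
rewrite [pk 0]/pk conv_heaviside; [|exact: bump_ge0|exact: bnd_bump.1].
rewrite -integral_itv_bndo_bndc; last first.
  by apply/measurable_EFinP; apply: measurable_funTS; exact: bnd_bump.1.
rewrite integral_mkcond [RHS]integral_mkcond; apply: eq_integral => t _.
rewrite !patchE; have [t0|t0] := leP t 0.
  by rewrite bump_le0//; case: ifP; case: ifP.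
by rewrite !mem_setE !in_itv/= t0.
Qed.

Lemma is_derive_bump_mass x : is_derive x (1 : R) bump_mass (bump x).
Proof.
have xx1 : x < x + 1 by rewrite ltrDl.
have [] := @continuous_FTC1 R bump -oo%O x _ xx1 _ _ (@continuous_bump x).
- exact: integrable_bump.
- by rewrite ltNyr.
by move=> d1 d2; apply: DeriveDef => //; rewrite -derive1E.
Qed.

(** The normalised primitive of a bump supported in [0, 1]. *)
Lemma smooth_step_exists : exists S : R -> R,
  [/\ smooth S, forall x, x <= 0 -> S x = 0, forall x, 1 <= x -> S x = 1,
      forall x y, x <= y -> S x <= S y & forall x, 0 <= derive1 S x].
Proof.
have z : -1 < (0 : R) <= 0 by rewrite ltrN10 lexx.
pose c := bump_mass 1.
have c0 : 0 < c.
  rewrite /c bump_mass_mkcond.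
  by apply: (@fracint_gt0 _ _ _ _ 0 1 1 z bnd_bump) => // s; exact: bump_gt0.
have homo x y : x <= y -> bump_mass x <= bump_mass y.
  move=> xy; rewrite /bump_mass /Rintegral fine_le//.
  - by apply: integrable_fin_num => //; exact: integrable_bump.
  - by apply: integrable_fin_num => //; exact: integrable_bump.
  apply: ge0_subset_integral => //.
  - by apply/measurable_EFinP; apply: measurable_funTS; exact: bnd_bump.1.
  - by move=> t _; rewrite lee_fin bump_ge0.
  - by apply: subset_itvl; rewrite bnd_simp.
have dS x : is_derive x (1 : R) (fun x => c^-1 * bump_mass x) (c^-1 * bump x).
  exact: (is_deriveZ c^-1 (is_derive_bump_mass x)).
exists (fun x => c^-1 * bump_mass x); split.
- apply: smooth_primitive => [x|]; first by have [] := dS x.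
  rewrite (_ : derive1 _ = fun x => c^-1 * bump (affine 1 0 x)).
    by apply: smooth_affine; exact: smooth_bump.
  apply/funext => x; rewrite derive1E (derive_val (is_derive := dS x)).
  by rewrite /affine mul1r addr0.
- by move=> x x0; rewrite bump_mass_mkcond fracint_le0// mulr0.
- move=> x x1; rewrite (_ : bump_mass x = c) ?mulVf ?gt_eqF//.
  rewrite /c !bump_mass_mkcond -[x](subrK 1) (fracint0_split bnd_bump ler01) ?subr_ge0//.
  rewrite [X in _ + X](@eq_fracint _ 0 _ (cst 0)) ?fracint_cst ?mul0r ?addr0//.
  by move=> s s0 _; rewrite bump_ge1// lerDr ltW.
- by move=> x y xy; rewrite ler_wpM2l ?homo// invr_ge0 ltW.
- move=> x; rewrite derive1E (derive_val (is_derive := dS x)).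
  by rewrite mulr_ge0 ?bump_ge0// invr_ge0 ltW.
Qed.

End smooth_step.

(** * The Caputo derivative paired with a test function *)

Section test_functions.
Context {R : realType}.
Implicit Types (T x t C : R) (phi f : R -> R).

Lemma test_function_derivable T phi x : test_function T phi -> derivable phi x 1.
Proof. by move=> [/(_ 0%N x)]. Qed.

Lemma test_function_derivable1 T phi x : test_function T phi -> derivable (derive1 phi) x 1.
Proof. by move=> [/(_ 1%N x)]. Qed.

Lemma test_function_continuous T phi : test_function T phi -> continuous phi.
Proof.
move=> h x; apply: differentiable_continuous; apply/derivable1_diffP.
exact: (test_function_derivable h).
Qed.

Lemma test_function_continuous1 T phi : test_function T phi -> continuous (derive1 phi).
Proof.
move=> h x; apply: differentiable_continuous; apply/derivable1_diffP.
exact: (test_function_derivable1 h).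
Qed.

Let support phi := closure [set x | phi x != 0].

Let out_support phi x : ~ support phi x -> phi x = 0.
Proof. by move=> h; apply/eqP/negPn/negP => hx; apply: h; exact: subset_closure. Qed.

Let out_support1 phi x : ~ support phi x -> derive1 phi x = 0.
Proof.
move=> h; rewrite derive1E.
have nx : \near x, cst 0 x = phi x.
  have : nbhs x (~` support phi).
    by apply: open_nbhs_nbhs; split => //; apply: closed_openC; exact: closed_closure.
  by apply: filterS => y hy /=; rewrite out_support.
exact: (derive_val (is_derive := near_eq_is_derive nx (is_derive_cst (0 : R) x (1 : R)))).
Qed.

Lemma test_function_ge phi T x : test_function T phi -> T <= x -> phi x = 0.
Proof.
move=> [_ /= [_ KT]] Tx; apply: out_support => /KT /=.
by rewrite in_itv/= ltNge Tx.
Qed.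

Lemma test_function_derive1_ge phi T x : test_function T phi -> T <= x -> derive1 phi x = 0.
Proof.
move=> [_ /= [_ KT]] Tx; apply: out_support1 => /KT /=.
by rewrite in_itv/= ltNge Tx.
Qed.

Let compact_support_bounded (K : set R) f : compact K -> continuous f ->
  (forall x, ~ K x -> f x = 0) -> exists C, 0 <= C /\ forall x, `|f x| <= C.
Proof.
move=> cK cf f0.
have /compact_bounded[N [_ hN]] : compact (f @` K).
  by apply: continuous_compact => //; exact: continuous_subspaceT.
exists (`|N| + 1); split; first by rewrite addr_ge0.
move=> x; have [Kx|nKx] := pselect (K x); last by rewrite f0// normr0 addr_ge0.
apply: hN; last by exists x.
by apply: (le_lt_trans (ler_norm N)); rewrite ltrDl.
Qed.

Lemma test_function_bounded T phi : test_function T phi ->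
  exists C, 0 <= C /\ forall x, `|phi x| <= C.
Proof.
move=> h; have [_ /= [cK _]] := h.
apply: (compact_support_bounded cK); last exact: out_support.
exact: test_function_continuous h.
Qed.

Lemma test_function_bounded1 T phi : test_function T phi ->
  exists C, 0 <= C /\ forall x, `|derive1 phi x| <= C.
Proof.
move=> h; have [_ /= [cK _]] := h.
apply: (compact_support_bounded cK); last exact: out_support1.
exact: test_function_continuous1 h.
Qed.

End test_functions.

Section caputo_formula.
Context {R : realType}.
Local Notation mu := (@lebesgue_measure R).
Implicit Types (T x t C M : R) (phi f W : R -> R).

Lemma integral_shift t (f : R -> \bar R) : measurable_fun [set: R] f ->
  (\int[mu]_x f (x + t)%R = \int[mu]_x f x)%E.
Proof.
move=> mf; rewrite integralE [RHS]integralE; congr (_ - _)%E.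
  rewrite -[RHS](ge0_integral_shift t); [|exact: measurable_funepos|by move=> x; exact: funepos_ge0].
  by apply: eq_integral => x _; rewrite !funeposE.
rewrite -[RHS](ge0_integral_shift t); [|exact: measurable_funeneg|by move=> x; exact: funeneg_ge0].
by apply: eq_integral => x _; rewrite !funenegE.
Qed.

Lemma integral_reflect t (f : R -> \bar R) : measurable_fun [set: R] f ->
  (\int[mu]_x f (t - x)%R = \int[mu]_x f x)%E.
Proof.
move=> mf; rewrite integralE [RHS]integralE; congr (_ - _)%E.
  rewrite -[RHS](ge0_integral_reflect t); [|exact: measurable_funepos|by move=> x; exact: funepos_ge0].
  by apply: eq_integral => x _; rewrite !funeposE.
rewrite -[RHS](ge0_integral_reflect t); [|exact: measurable_funeneg|by move=> x; exact: funeneg_ge0].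
by apply: eq_integral => x _; rewrite !funenegE.
Qed.

Lemma integrable_bounded_itv f C x y : measurable_fun [set: R] f ->
  (forall t, `|f t| <= C) -> (forall t, t \notin `[x, y] -> f t = 0) ->
  mu.-integrable setT (EFin \o f).
Proof.
move=> mf fC f0.
have -> : EFin \o f = (EFin \o f) \_ `[x, y].
  apply/funext => t; rewrite patchE; case: ifPn => //= txy.
  by rewrite f0//; move: txy; rewrite mem_setE.
apply/integrable_restrict => //; rewrite setTI.
apply: measurable_bounded_integrable => //.
- by apply: compact_finite_measure; exact: segment_compact.
- exact: measurable_funTS.
- by exists C; split; [exact: num_real|move=> c Cc t _ /=; rewrite (le_trans (fC t))// ltW].
Qed.

Let k (g : R) s : R := heaviside s * s `^ (- g).

Lemma pk_integrable g r : 0 < g -> g < 1 ->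
  mu.-integrable setT (EFin \o (fun s => k g s * heaviside (r - s))).
Proof.
move=> g0 g1; have hk : -1 < - g <= 0 by rewrite ltrN2 g1 oppr_le0 ltW.
have z : -1 < (0 : R) <= 0 by rewrite ltrN10 lexx.
have hi := mge0_integrand r (mge0_pk 0) (mge0_pk (- g)).
have e : EFin \o (fun s => k g s * heaviside (r - s)) =
    (fun s => pk 0 (r - s)%R * pk (- g) s)%E.
  apply/funext => s; rewrite /pk /causal /= -EFinM powRr0 mulr1.
  by congr EFin; rewrite mulrC.
rewrite e; apply/integrableP; split; first exact: hi.1.
under eq_integral do rewrite gee0_abs ?hi.2//.
exact: (conv_pk_lt_pinfty r z hk).
Qed.

(** The derivative is moved from the pairing of [W] with the translates of [phi] onto
    [phi], by differentiation under the integral sign; Fubini's theorem then groups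
    the kernel with [W]. *)
Lemma caputo_formula g T W M phi : 0 < g -> g < 1 ->
  measurable_fun [set: R] W -> (forall t, `|W t| <= M) ->
  (forall t, t <= 0 -> W t = 0) -> (forall t, T <= t -> W t = 0) ->
  test_function T phi ->
  distr_conv (g_neg g) (of_fun W) phi =
  - ((Gamma (1 - g))^-1 *
     \int[mu]_r ((\int[mu]_s (k g s * W (r - s))) * derive1 phi r)).
Proof.
move=> g0 g1 mW WM W0 WT tphi.
have M0 : 0 <= M by apply: le_trans (WM 0).
have [C [C0 hC]] := test_function_bounded tphi.
have [C1 [C10 hC1]] := test_function_bounded1 tphi.
have cphi := test_function_continuous tphi.
have cphi1 := test_function_continuous1 tphi.
have W_out t : t \notin `[0, T] -> W t = 0.
  rewrite in_itv/= negb_and -!ltNge => /orP[t0|tT]; first by rewrite W0// ltW.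
  by rewrite WT// ltW.
have mphis (f : R -> R) s : continuous f -> measurable_fun [set: R] (fun t => f (s + t)).
  move=> cf; apply: (measurableT_comp (continuous_measurable_fun cf)).
  exact: measurable_funD.
have intW f D s : continuous f -> (forall x, `|f x| <= D) ->
    mu.-integrable setT (EFin \o (fun t => W t * f (s + t))).
  move=> cf fD; apply: (@integrable_bounded_itv _ (M * D) 0 T).
  - by apply: measurable_funM => //; exact: mphis.
  - by move=> t; rewrite normrM ler_pM.
  - by move=> t /W_out ->; rewrite mul0r.
have dPhi s : derive1 (fun s => \int[mu]_t (W t * phi (s + t))) s =
    \int[mu]_t (W t * derive1 phi (s + t)).
  have dW x y : is_derive x (1 : R) (fun x => W y * phi (x + y)) (W y * derive1 phi (x + y)).
    have h := @is_derive_comp_affine _ phi 1 y x _ (_ : is_derive (affine 1 y x) 1 phi (derive1 phi (affine 1 y x))).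
    have {}h := h (ltac:(rewrite derive1E; exact/derivableP/(test_function_derivable tphi))).
    have := is_deriveZ (W y) h; rewrite mulr1 /GRing.scale/=.
    by rewrite (_ : affine 1 y x = x + y) /affine ?mul1r// (_ : (fun x0 => phi (1 * x0 + y)) = (fun x0 => phi (x0 + y)))//; apply/funext => z; rewrite mul1r.
  pose G (y : R) := M * C1 * (\1_(`[0, T] : set R) y).
  have G0 y : 0 <= G y by rewrite /G !mulr_ge0.
  have intG : mu.-integrable setT (EFin \o G).
    apply: (@integrable_bounded_itv G (M * C1) 0 T).
    - by apply: measurable_funM => //; exact: measurable_indic.
    - move=> t; rewrite ger0_norm ?G0// /G indicE.
      by case: (_ \in _); rewrite ?mulr1 ?mulr0 ?mulr_ge0.
    - by move=> t tT; rewrite /G indicE mem_setE (negbTE tT) mulr0.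
  have Is : `]s - 1, s + 1[%classic s by rewrite /= in_itv/= ltrDl gtrBl ltr01.
  have Gub x y : `]s - 1, s + 1[%classic x -> [set: R] y ->
      `|partial1of2 (fun s t => W t * phi (s + t)) x y| <= G y.
    move=> _ _; rewrite partial1of2E (derive_val (is_derive := dW x y)).
    rewrite /G indicE mem_setE; case: (boolP (y \in `[0, T])) => yT.
      by rewrite mulr1 normrM ler_pM.
    by rewrite W_out// mul0r normr0 mulr0.
  have h := @differentiation_under_integral R _ _ mu (fun s t => W t * phi (s + t))
    setT measurableT s (s - 1) (s + 1) Is (fun x _ => intW phi C x cphi hC)
    (fun x y _ _ => @ex_derive _ _ _ _ _ _ _ (dW x y)) G G0 intG Gub.
  rewrite h; apply: eq_Rintegral => t _.
  by rewrite partial1of2E (derive_val (is_derive := dW s t)).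
have k0 s : 0 <= k g s by rewrite mulr_ge0 ?heaviside_ge0 ?powR_ge0.
have khv s x : 0 <= k g s * heaviside x by exact: mulr_ge0 (k0 s) (heaviside_ge0 x).
have mk : measurable_fun [set: R] (k g).
  by apply: measurable_funM; [exact: measurable_heaviside|exact: measurable_powR].
have mWr r : measurable_fun [set: R] (fun s => W (r - s)).
  by apply: (measurableT_comp mW); exact: measurable_funB.
have intk r : mu.-integrable setT (EFin \o (fun s => k g s * W (r - s))).
  apply: (@le_integrable _ _ _ mu setT measurableT _ (EFin \o (fun s => M * (k g s * heaviside (r - s))))) => //.
  - by apply/measurable_EFinP; exact: (measurable_funM mk (mWr r)).
  - move=> s _; rewrite /= lee_fin normrM (ger0_norm (k0 s)).
    rewrite [leRHS]ger0_norm; last exact: mulr_ge0 M0 (khv s (r - s)).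
    rewrite [leRHS]mulrCA; apply: ler_wpM2l => //.
    have [rs|sr] := leP (r - s) 0.
      by rewrite W0// normr0; apply: mulr_ge0 => //; exact: heaviside_ge0.
    by rewrite heaviside_gt0// mulr1.
  - exact: (integrableZl measurableT M (@pk_integrable g r g0 g1)).
have intr s : mu.-integrable setT (EFin \o (fun r => W (r - s) * derive1 phi r)).
  apply: (@integrable_bounded_itv _ (M * C1) s (s + T)).
  - apply: measurable_funM; last exact: continuous_measurable_fun.
    by apply: (measurableT_comp mW); exact: measurable_funB.
  - by move=> t; rewrite normrM ler_pM.
  - move=> t; rewrite in_itv/= => h; rewrite W_out ?mul0r//; move: h.
    by rewrite in_itv/= subr_ge0 lerBlDl.
pose F (p : measurableTypeR R * measurableTypeR R) : \bar R :=
  (k g p.1 * (W (p.2 - p.1) * derive1 phi p.2))%:E.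
have mF : measurable_fun setT F.
  apply/measurable_EFinP; apply: measurable_funM.
    by apply: (measurableT_comp mk); exact: measurable_fst.
  apply: measurable_funM.
    apply: (measurableT_comp mW).
    by apply: measurable_funB; [exact: measurable_snd|exact: measurable_fst].
  apply: (measurableT_comp (continuous_measurable_fun cphi1)); exact: measurable_snd.
pose G (y : R) := M * C1 * (\1_(`[0, T] : set R) y).
have G0 y : 0 <= G y by rewrite /G !mulr_ge0.
have mG : measurable_fun [set: R] G.
  by apply: measurable_funM => //; exact: measurable_indic.
have intG : mu.-integrable setT (EFin \o G).
  apply: (@integrable_bounded_itv G (M * C1) 0 T) => //.
  - move=> t; rewrite ger0_norm ?G0// /G indicE.
    by case: (_ \in _); rewrite ?mulr1 ?mulr0 ?mulr_ge0.
  - by move=> t tT; rewrite /G indicE mem_setE (negbTE tT) mulr0.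
pose kT s := k g s * heaviside (T - s).
have kT0 s : 0 <= kT s by exact: khv.
have mkT : measurable_fun [set: R] kT.
  apply: measurable_funM => //; apply: (measurableT_comp measurable_heaviside).
  exact: measurable_funB.
have kG0 s r : 0 <= kT s * G r by exact: mulr_ge0 (kT0 s) (G0 r).
have intF : (mu \x mu)%E.-integrable setT F.
  apply: (@le_integrable _ _ _ (mu \x mu)%E setT measurableT F (fun p => (kT p.1 * G p.2)%:E)) => //.
    move=> [s r] _; rewrite /F/= lee_fin [leRHS]ger0_norm; last exact: kG0.
    have [s0|s0] := leP s 0.
      by rewrite /k heaviside_le0// !mul0r normr0; exact: kG0.
    have [rs|sr] := leP (r - s) 0; first by rewrite W0// mul0r mulr0 normr0; exact: kG0.
    have [Tr|rT] := leP T r.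
      by rewrite (test_function_derive1_ge tphi Tr) !mulr0 normr0; exact: kG0.
    have sT : 0 < T - s by lra.
    rewrite /kT heaviside_gt0// mulr1 normrM (ger0_norm (k0 s)) ler_wpM2l//.
    rewrite /G indicE mem_set/=; last by rewrite in_itv/=; apply/andP; split; lra.
    by rewrite mulr1 normrM ler_pM.
  have mH : measurable_fun [set: measurableTypeR R * measurableTypeR R]
      (fun p => (kT p.1 * G p.2)%:E).
    apply/measurable_EFinP; apply: measurable_funM.
      by apply: (measurableT_comp mkT); exact: measurable_fst.
    by apply: (measurableT_comp mG); exact: measurable_snd.
  apply: (@integrable12ltyP _ _ (measurableTypeR R) (measurableTypeR R) R mu mu _ mH).2.
  under eq_integral => s _.
    under eq_integral => r _ do rewrite /= (ger0_norm (kG0 s r)) EFinM.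
    rewrite ge0_integralZl ?lee_fin//; last 2 first.
    - exact/measurable_EFinP.
    - by move=> r _; rewrite lee_fin.
    over.
  have Gfin : (\int[mu]_x (G x)%:E \is a fin_num)%E by exact: integrable_fin_num.
  rewrite -(fineK Gfin).
  under eq_integral do rewrite muleC.
  rewrite ge0_integralZl ?lee_fin//; last 3 first.
  - exact/measurable_EFinP.
  - by move=> r _; rewrite lee_fin.
  - by rewrite fine_ge0// integral_ge0// => r _; rewrite lee_fin.
  have kfin : (\int[mu]_x (kT x)%:E \is a fin_num)%E.
    by apply: integrable_fin_num => //; exact: pk_integrable.
  by rewrite -(fineK kfin) -EFinM ltry.
have fub := @Fubini _ _ (measurableTypeR R) (measurableTypeR R) R mu mu F intF.
have step1 s : ((k g s * derive1 (fun s => \int[mu]_t (W t * phi (s + t))) s)%:E =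
    \int[mu]_r F (s, r))%E.
  rewrite dPhi.
  have e : (\int[mu]_t (W t * derive1 phi (s + t)) = \int[mu]_r (W (r - s) * derive1 phi r))%R.
    have /integrableP[mX _] := intr s.
    have h : (\int[mu]_t (W (t + s - s) * derive1 phi (t + s))%:E =
        \int[mu]_r (W (r - s) * derive1 phi r)%:E)%E := integral_shift s mX.
    rewrite /Rintegral; apply: (congr1 fine); rewrite -[RHS]h.
    by apply: eq_integral => t _; rewrite addrK [t + s]addrC.
  rewrite e.
  transitivity ((k g s)%:E * \int[mu]_r (W (r - s) * derive1 phi r)%:E)%E.
    by rewrite EFinM; congr (_ * _)%E; apply: fineK; exact: (integrable_fin_num measurableT (intr s)).
  by rewrite -(integralZl measurableT (intr s)).
have step2 r : (((\int[mu]_s (k g s * W (r - s)))%R * derive1 phi r)%:E =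
    \int[mu]_s F (s, r))%E.
  transitivity ((derive1 phi r)%:E * \int[mu]_s (k g s * W (r - s))%:E)%E.
    by rewrite EFinM muleC; congr (_ * _)%E; apply: fineK; exact: (integrable_fin_num measurableT (intk r)).
  rewrite -(integralZl measurableT (intk r)); apply: eq_integral => s _.
  by rewrite /F/= -EFinM; congr EFin; rewrite mulrC -mulrA.
have main : (\int[mu]_x (k g x * derive1 (fun s => \int[mu]_t (W t * phi (s + t))) x) =
    \int[mu]_r ((\int[mu]_s (k g s * W (r - s))) * derive1 phi r))%R.
  have e1 : (\int[mu]_x (k g x * derive1 (fun s => (\int[mu]_t (W t * phi (s + t)))%R) x)%:E =
      \int[mu]_s \int[mu]_r F (s, r))%E.
    by apply: eq_integral => s _; exact: step1.
  have e2 : (\int[mu]_r ((\int[mu]_s (k g s * W (r - s)))%R * derive1 phi r)%:E =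
      \int[mu]_r \int[mu]_s F (s, r))%E.
    by apply: eq_integral => r _; exact: step2.
  by rewrite /Rintegral; apply: (congr1 fine); apply: (etrans e1); apply: (etrans fub); exact: (esym e2).
rewrite -main /distr_conv /g_neg /distr_derive /of_fun mulrN; reflexivity.
Qed.

End caputo_formula.

(** * From the memory equation to strong solutions *)

Section strong_solutions.
Context {R : realType}.
Local Notation mu := (@lebesgue_measure R).
Implicit Types (T t r s C M N : R) (phi p q W : R -> R).

Lemma integrable_conv a M p r : -1 < a <= 0 -> bnd M p ->
  mu.-integrable setT (fun s => pk a (r - s) * causal p s)%E.
Proof.
move=> ha hp; have hi := mge0_integrand r (mge0_pk a) (mge0_bnd hp).
apply/integrableP; split; first exact: hi.1.
under eq_integral do rewrite gee0_abs ?hi.2//.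
exact: (conv_bnd_lt_pinfty r ha hp).
Qed.

(** The inner integral of [caputo_formula] is a memory term. [fracint] takes
    nonnegative arguments, hence the difference. *)
Lemma memory_fracint g M N p q W r : 0 < g -> g < 1 -> bnd M p -> bnd N q ->
  measurable_fun [set: R] W -> (forall s, s <= 0 -> W s = 0) ->
  (forall s, 0 < s -> s < r -> W s = p s - q s) ->
  \int[mu]_s (heaviside s * s `^ (- g) * W (r - s)) =
  fracint (- g) p r - fracint (- g) q r.
Proof.
move=> g0 g1 hp hq mW W0 Wpq.
have hk : -1 < - g <= 0 by rewrite ltrN2 g1 oppr_le0 ltW.
have ip := integrable_conv r hk hp; have iq := integrable_conv r hk hq.
rewrite !fracint_def /conv -fineB; [|exact: integrable_fin_num|exact: integrable_fin_num].
rewrite -integralB// /Rintegral; congr fine.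
pose f s : \bar R := (heaviside s * s `^ (- g) * W (r - s))%:E.
have mf : measurable_fun [set: R] f.
  apply/measurable_EFinP; apply: measurable_funM.
    by apply: measurable_funM; [exact: measurable_heaviside|exact: measurable_powR].
  by apply: (measurableT_comp mW); exact: measurable_funB.
rewrite -[LHS](integral_reflect r mf); apply: eq_integral => s _.
rewrite /f subKr /pk /causal -!EFinM -EFinB; congr EFin.
have [s0|s0] := leP s 0.
  by rewrite W0// (heaviside_le0 s0) !mul0r !mulr0 subr0.
have [sr|rs] := ltP s r; last by rewrite heaviside_le0 ?subr_le0// !mul0r subr0.
by rewrite Wpq// (heaviside_gt0 s0) !mul1r mulrBr.
Qed.

Lemma fracint0E M phi t : bnd M phi -> fracint 0 phi t = (\int[mu]_(s in `[0, t]) phi s)%R.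
Proof.
move=> h; rewrite fracint_def [pk 0]/pk conv_heaviside; [|exact: (bnd_ge0 h)|exact: h.1].
rewrite /Rintegral; congr fine.
have m (A : set R) : measurable_fun A (EFin \o phi).
  by apply: measurable_funTS; apply/measurable_EFinP; exact: h.1.
by rewrite (integral_itv_bndo_bndc (m _)) (integral_itv_obnd_cbnd (m _)).
Qed.

(** The fundamental theorem of calculus. *)
Lemma fracint0_derive M phi t : bnd M phi -> continuous phi -> 0 < t ->
  is_derive t (1 : R) (fracint 0 phi) (phi t).
Proof.
move=> h cphi t0; have tt : t < t + 1 by rewrite ltrDl.
rewrite (_ : fracint 0 phi = fun t => (\int[mu]_(s in `[0, t]) phi s)%R); last first.
  by apply/funext => s; exact: fracint0E h.
have [] := @continuous_FTC1_closed R phi 0 t (t + 1) tt _ t0 (cphi t).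
  apply: continuous_compact_integrable; first exact: segment_compact.
  exact: continuous_subspaceT.
by move=> d1 d2; apply: DeriveDef => //; rewrite -derive1E.
Qed.

Lemma continuous_right_limit0 (u : R -> R) : continuous u -> right_limit0 u (u 0).
Proof.
move=> cu.
have cd : continuous (fun s => `|u s - u 0|).
  by move=> x; apply: cvg_norm; apply: cvgB; [exact: cu|exact: cvg_cst].
have it t : mu.-integrable `]0, t[ (EFin \o (fun s => `|u s - u 0|)).
  apply: (@integrableS _ _ _ mu `[0, t]) => //; first exact: subset_itv_oo_cc.
  apply: continuous_compact_integrable; first exact: segment_compact.
  exact: continuous_subspaceT.
apply/fine_cvgP; split.
  apply: nearW => t; rewrite fin_numM//.
  by apply: integrable_fin_num => //; exact: it.
apply/cvgrPdist_le => e e0.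
have : \forall s \near (0 : R), `|u s - u 0| <= e.
  by have := cu 0 => /cvgrPdist_le /(_ e e0); apply: filterS => s; rewrite distrC.
move=> /nbhs_ballP[d /= d0 hd]; near=> t.
have t0 : 0 < t by near: t; exact: nbhs_right_gt.
have td : t < d by near: t; exact: nbhs_right_lt.
rewrite sub0r normrN /= fineM//; last by apply: integrable_fin_num => //; exact: it.
rewrite normrM gtr0_norm ?invr_gt0//= mulrC ler_pdivrMr//.
rewrite ger0_norm; last by apply: fine_ge0; apply: integral_ge0 => s _; rewrite lee_fin.
rewrite -lee_fin fineK; last by apply: integrable_fin_num => //; exact: it.
apply: (@le_trans _ _ (\int[mu]_(s in `]0%R, t[) cst e%:E s)%E).
  apply: ge0_le_integral => //.
  - by have /integrableP[] := it t.
  - move=> s /=; rewrite in_itv/= => /andP[s0 st]; rewrite lee_fin; apply: hd.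
    by rewrite /ball/= sub0r normrN gtr0_norm// (lt_trans st).
rewrite integral_cst//= lebesgue_measure_itv/= lte_fin t0 oppr0 adde0.
by rewrite -EFinM.
Unshelve. all: by end_near. Qed.

(** By [caputo_formula], the Caputo derivative of [u] pairs with [phi] as the memory
    of [u0 - u] does with the derivative of [phi]. The memory equation makes this memory
    a primitive, up to the factor [Gamma (1 - g)], of [F (u t)], and integration by
    parts concludes. *)
Lemma strong_solution_of_memory (g u0 M : R) (f F u : R -> R) T :
  0 < g -> g < 1 -> 0 < T -> continuous u -> (forall t, 0 <= u t <= u0) ->
  u 0 = u0 -> (forall t, t <= 0 -> u t = u0) ->
  continuous F -> (forall x, 0 <= F x <= M) -> (forall t, f (u t) = - F (u t)) ->
  (forall t, fracint (- g) (fun s => u0 - u s) t =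
     Gamma (1 - g) * fracint 0 (fun s => F (u s)) t) ->
  strong_solution g f u0 T u.
Proof.
move=> g0 g1 T0 cu u0u uz ule cF F0M fF memo.
have mu_ : measurable_fun [set: R] u by exact: continuous_measurable_fun.
have cFu : continuous (fun t => F (u t)).
  by move=> t; apply: continuous_comp; [exact: cu|exact: cF].
have hF : bnd M (fun t => F (u t)).
  by split; [exact: continuous_measurable_fun|move=> t; exact: F0M].
have hw : bnd u0 (fun s => u0 - u s).
  split; first exact: measurable_funB.
  by move=> t; have /andP[? ?] := u0u t; rewrite subr_ge0 gerBl; apply/andP.
have io (h : R -> R) : continuous h -> mu.-integrable `]0, T[ (EFin \o h).
  move=> ch; apply: (@integrableS _ _ _ mu `[0, T]) => //; first exact: subset_itv_oo_cc.
  apply: continuous_compact_integrable; first exact: segment_compact.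
  exact: continuous_subspaceT.
have hG : 0 < Gamma (1 - g).
  by rewrite addrC Gamma_gt0// ltrN2 g1 oppr_le0 ltW.
split.
- by apply: open_integrable_locally; [exact: itv_open|exact: io].
- by rewrite -uz; exact: continuous_right_limit0.
exists (fun t => - F (u t)); split.
- by apply: io => t; apply: cvgN; exact: cFu.
- move=> phi tphi; rewrite /caputo.
  set W := (fun t => _).
  have W0 t : t <= 0 -> W t = 0 by move=> t0; rewrite /W heaviside_le0// mulr0 mul0r.
  have WT t : T <= t -> W t = 0.
    move=> Tt; rewrite /W indicE memNset ?mulr0//= in_itv/=.
    by apply/negP; rewrite -leNgt.
  have Ww t : 0 < t -> t < T -> W t = - (u0 - u t).
    move=> t0 tT; have e : \1_(`]-oo, T[ : set R) t = 1 :> R.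
      by rewrite indicE mem_set//= in_itv.
    by rewrite /W heaviside_gt0// e !mulr1 opprB.
  have mW : measurable_fun [set: R] W.
    apply: measurable_funM; last exact: measurable_indic.
    apply: measurable_funM; last exact: measurable_heaviside.
    exact: measurable_funB.
  have WM t : `|W t| <= u0.
    have u00 : 0 <= u0 by have /andP[] := u0u 0; exact: le_trans.
    have [t0|t0] := leP t 0; first by rewrite W0// normr0.
    have [Tt|tT] := leP T t; first by rewrite WT// normr0.
    rewrite Ww// normrN; have /andP[? ?] := hw.2 t.
    by rewrite ger0_norm.
  rewrite (caputo_formula g0 g1 mW WM W0 WT tphi).
  pose H := fracint 0 (fun s => F (u s)).
  have -> : (\int[mu]_r ((\int[mu]_s (heaviside s * s `^ (- g) * W (r - s))) * derive1 phi r) =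
     \int[mu]_r (- Gamma (1 - g) * (if (0 <= r <= T) then H r * derive1 phi r else 0)))%R.
    apply: eq_Rintegral => r _.
    have [Tr|rT] := leP T r.
      by rewrite (test_function_derive1_ge tphi Tr) !mulr0 if_same mulr0.
    rewrite (memory_fracint g0 g1 (bnd_cst (lexx 0)) hw mW W0); last first.
      by move=> s s0 sr; rewrite Ww ?sub0r// (lt_trans sr).
    have hk : -1 < - g <= 0 by rewrite ltrN2 g1 oppr_le0 ltW.
    rewrite fracint_cst// mul0r sub0r memo -mulNr (ltW rT) andbT.
    have [r0|r0] := leP 0 r; first by rewrite mulrA.
    by rewrite fracint_le0 ?(ltW r0)// mulr0 mul0r.
  have cphi := test_function_continuous tphi.
  have cphi1 := test_function_continuous1 tphi.
  have cH : continuous H.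
    by have := @continuous_fracint R 0 M _ _ hF; apply; rewrite ltrN10 lexx.
  have iHphi : mu.-integrable `[0, T] (EFin \o (fun r => H r * derive1 phi r)).
    apply: continuous_compact_integrable; first exact: segment_compact.
    by apply: continuous_subspaceT => x; apply: cvgM; [exact: cH|exact: cphi1].
  have eif : EFin \o (fun r => if (0 <= r <= T) then H r * derive1 phi r else 0) =
      (EFin \o (fun r => H r * derive1 phi r)) \_ `[0, T].
    apply/funext => r; rewrite patchE /=; case: ifPn => h.
      by rewrite mem_set//= in_itv.
    by rewrite memNset//= in_itv/=; apply/negP.
  rewrite RintegralZl//; last first.
    by rewrite eif; apply/integrable_restrict => //; rewrite setTI.
  rewrite mulrA mulrN mulVf ?gt_eqF// mulN1r opprK.
  rewrite [LHS](_ : _ = (\int[mu]_(r in `[0, T]) (H r * derive1 phi r))%R); last first.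
    by rewrite /Rintegral [in RHS]integral_mkcond; congr fine; congr integral; exact: eif.
  rewrite (@Rintegration_by_parts R H phi (fun t => F (u t)) (derive1 phi) 0 T T0).
  + rewrite (test_function_ge tphi (lexx T)) mulr0 {1}/H fracint_le0// mul0r subr0 sub0r.
    have cFphi : continuous (fun x => F (u x) * phi x).
      by move=> x; apply: cvgM; [exact: cFu|exact: cphi].
    have iF : mu.-integrable `[0, T] (EFin \o (fun x => F (u x) * phi x)).
      apply: continuous_compact_integrable; first exact: segment_compact.
      exact: continuous_subspaceT.
    rewrite -mulN1r -RintegralZl// /Rintegral; congr fine.
    have m (A : set R) : measurable_fun A (fun x => (-1 * (F (u x) * phi x))%:E).
      apply: measurable_funTS; apply/measurable_EFinP; apply: measurable_funM => //.
      exact: continuous_measurable_fun.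
    rewrite -(integral_itv_bndo_bndc (m _)) -(integral_itv_obnd_cbnd (m _)).
    by apply: eq_integral => x _; rewrite mulN1r mulNr.
  + exact: continuous_subspaceT.
  + split.
    * move=> x; rewrite in_itv/= => /andP[x0 _]; by have [] := fracint0_derive hF cFu x0.
    * by apply: cvg_at_right_filter; exact: cH.
    * by apply: cvg_at_left_filter; exact: cH.
  + move=> x; rewrite in_itv/= => /andP[x0 _]; rewrite derive1E.
    exact: (derive_val (is_derive := fracint0_derive hF cFu x0)).
  + exact: continuous_subspaceT.
  + split.
    * by move=> x _; exact: (test_function_derivable tphi).
    * by apply: cvg_at_right_filter; exact: cphi.
    * by apply: cvg_at_left_filter; exact: cphi.
  + by [].
- by apply/aeW => t _; rewrite fF.
Qed.

End strong_solutions.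

(** * From strong solutions to the memory equation *)

Section weak_equation.
Context {R : realType}.
Local Notation mu := (@lebesgue_measure R).
Implicit Types (T t r s d e M N : R) (P V W : R -> R).

Lemma smooth_step_derive1_out (S : R -> R) x : (forall x, x <= 0 -> S x = 0) ->
  (forall x, 1 <= x -> S x = 1) -> x < 0 \/ 1 < x -> derive1 S x = 0.
Proof.
move=> S0 S1 [x0|x1]; rewrite derive1E.
  have nx : \near x, cst 0 x = S x.
    by near=> y; rewrite S0// ltW//; near: y; exact: lt_nbhsl.
  exact: (derive_val (is_derive := near_eq_is_derive nx (is_derive_cst (0 : R) x (1 : R)))).
have nx : \near x, cst 1 x = S x.
  by near=> y; rewrite S1// ltW//; near: y; exact: lt_nbhsr.
exact: (derive_val (is_derive := near_eq_is_derive nx (is_derive_cst (1 : R) x (1 : R)))).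
Unshelve. all: by end_near. Qed.

(** Rises from 0 to 1 on [-2, -1] and falls from 1 to 0 on [t, t + d]. For small [d] this
    test function is close to the indicator of ]0, t] on the half-line, and minus its
    derivative is there close to the Dirac mass at [t]. *)
Definition cutoff (S : R -> R) t d x : R := S (affine 1 2 x) - S (affine d^-1 (- (t / d)) x).

Lemma affine_inv d t x : affine d^-1 (- (t / d)) x = (x - t) / d.
Proof. by rewrite /affine mulrBl [d^-1 * x]mulrC. Qed.

Section cutoff.
Variables (S : R -> R) (T t d : R).
Hypotheses (sS : smooth S) (S0 : forall x, x <= 0 -> S x = 0) (S1 : forall x, 1 <= x -> S x = 1).
Hypotheses (homoS : forall x y, x <= y -> S x <= S y) (S'_ge0 : forall x, 0 <= derive1 S x).
Hypotheses (t0 : 0 < t) (d0 : 0 < d) (tdT : t + d < T).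

Lemma cutoff_eq1 x : 0 < x -> x <= t -> cutoff S t d x = 1.
Proof.
move=> x0 xt; rewrite /cutoff S1; last by rewrite /affine mul1r; lra.
by rewrite S0 ?subr0// affine_inv mulr_le0_ge0 ?subr_le0// invr_ge0 ltW.
Qed.

Lemma cutoff_eq0 x : t + d <= x -> cutoff S t d x = 0.
Proof.
move=> tdx; rewrite /cutoff S1; last by rewrite /affine mul1r; move: (t0) (d0); lra.
by rewrite S1 ?subrr// affine_inv ler_pdivlMr// mul1r lerBrDl.
Qed.

Lemma step_range x : 0 <= S x <= 1.
Proof.
apply/andP; split; have [x0|x0] := leP x 0.
- by rewrite S0.
- by rewrite -(S0 (lexx 0)) homoS// ltW.
- by rewrite S0.
- have [x1|x1] := leP x 1; last by rewrite (S1 (ltW x1)).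
  by rewrite -(S1 (lexx 1)) homoS.
Qed.

Lemma cutoff_range x : 0 <= cutoff S t d x <= 1.
Proof.
rewrite /cutoff; have /andP[? ?] := step_range (affine 1 2 x).
have /andP[h1 h2] := step_range (affine d^-1 (- (t / d)) x).
have [x0|x0] := leP x 0; last first.
  rewrite (S1 (x := affine 1 2 x)); last by rewrite /affine mul1r; lra.
  by apply/andP; split; lra.
rewrite [X in _ - X]S0 ?subr0; first by apply/andP.
by rewrite affine_inv mulr_le0_ge0 ?invr_ge0 ?(ltW d0)//; move: (t0); lra.
Qed.

Lemma cutoff_test : test_function T (cutoff S t d).
Proof.
split.
  have h1 := @smooth_affine R S 1 1 2 sS; have h2 := @smooth_affine R S 1 d^-1 (- (t / d)) sS.
  have := smoothB h1 h2; rewrite (_ : _ \- _ = cutoff S t d)//.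
  by apply/funext => x; rewrite /cutoff /= !mul1r.
have sub : closure [set x | cutoff S t d x != 0] `<=` `[- 2, t + d].
  rewrite [X in _ `<=` X](closure_id _).1; last exact: itv_closed.
  apply: closure_subset => x /= h; rewrite in_itv/=; apply/andP; split; rewrite leNgt; apply/negP => hx.
    move/eqP: h; apply; rewrite /cutoff S0; last by rewrite /affine mul1r; lra.
    by rewrite S0 ?subrr// affine_inv mulr_le0_ge0 ?invr_ge0 ?(ltW d0)//; move: (t0); lra.
  by move/eqP: h; apply; rewrite cutoff_eq0// ltW.
split.
  apply: (subclosed_compact _ (@segment_compact R (- 2) (t + d))) => //.
  exact: closed_closure.
by move=> x /sub /=; rewrite !in_itv/= => /andP[_ h]; exact: le_lt_trans h tdT.
Qed.

Lemma cutoff_derive1 x : derive1 (cutoff S t d) x =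
  derive1 S (x + 2) - d^-1 * derive1 S ((x - t) / d).
Proof.
have h1 := is_derive_comp_affine (is_derive1_smooth (affine 1 2 x) sS).
have h2 := is_derive_comp_affine (is_derive1_smooth (affine d^-1 (- (t / d)) x) sS).
rewrite derive1E (derive_val (is_derive := is_deriveB h1 h2)) affine_inv.
by rewrite /affine mulr1 mul1r [d^-1 * _]mulrC.
Qed.

Lemma cutoff_mass : (\int[mu]_(x in `[t, t + d]) (d^-1 * derive1 S ((x - t) / d)) = 1)%R.
Proof.
have cS1 : continuous (derive1 S).
  by move=> x; apply: differentiable_continuous; apply/derivable1_diffP/smooth_derivable/smooth_derive1.
have dx x : is_derive x (1 : R) (fun x => S (affine d^-1 (- (t / d)) x))
    (d^-1 * derive1 S ((x - t) / d)).
  have := is_derive_comp_affine (is_derive1_smooth (affine d^-1 (- (t / d)) x) sS).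
  by rewrite affine_inv [X in is_derive _ _ _ X]mulrC.
have cx : continuous (fun x => S (affine d^-1 (- (t / d)) x)).
  by move=> x; apply: differentiable_continuous; apply/derivable1_diffP; have [] := dx x.
rewrite /Rintegral (@continuous_FTC2 R _ (fun x => S (affine d^-1 (- (t / d)) x))).
- rewrite !affine_inv subrr mul0r (S0 (lexx 0)) addrAC subrr add0r divff ?gt_eqF//.
  by rewrite (S1 (lexx 1)) /= subr0.
- by rewrite ltrDl.
- apply: continuous_subspaceT => x; apply: cvgM; first exact: cvg_cst.
  apply: (@continuous_comp _ _ _ (fun x => (x - t) / d) (derive1 S)); last exact: cS1.
  by apply: cvgM; [apply: cvgB; [exact: cvg_id|exact: cvg_cst]|exact: cvg_cst].
- split; first by move=> x _; have [] := dx x.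
  + by apply: cvg_at_right_filter; exact: cx.
  + by apply: cvg_at_left_filter; exact: cx.
- by move=> x _; rewrite derive1E; exact: (derive_val (is_derive := dx x)).
Qed.

Let rho r := d^-1 * derive1 S ((r - t) / d).

Let continuous_rho : continuous rho.
Proof.
have cS1 : continuous (derive1 S).
  by move=> x; apply: differentiable_continuous; apply/derivable1_diffP/smooth_derivable/smooth_derive1.
move=> x; apply: cvgM; first exact: cvg_cst.
apply: (@continuous_comp _ _ _ (fun x => (x - t) / d) (derive1 S)); last exact: cS1.
by apply: cvgM; [apply: cvgB; [exact: cvg_id|exact: cvg_cst]|exact: cvg_cst].
Qed.

Let rho_ge0 r : 0 <= rho r.
Proof. by rewrite mulr_ge0 ?S'_ge0// invr_ge0 ltW. Qed.

Let int_itv (f : R -> R) : continuous f -> mu.-integrable `[t, t + d] (EFin \o f).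
Proof.
move=> cf; apply: continuous_compact_integrable; first exact: segment_compact.
exact: continuous_subspaceT.
Qed.

Lemma cutoff_average (Q : R -> R) e : continuous Q ->
  (forall r, t <= r -> r <= t + d -> `|Q r - Q t| <= e) ->
  `|\int[mu]_(r in `[t, t + d]) (Q r * rho r) - Q t| <= e.
Proof.
move=> cQ hQ.
have cQr : continuous (fun r => Q r * rho r) by move=> x; apply: cvgM; [exact: cQ|exact: continuous_rho].
have cD : continuous (fun r => (Q r - Q t) * rho r).
  by move=> x; apply: cvgM; [apply: cvgB; [exact: cQ|exact: cvg_cst]|exact: continuous_rho].
have cZ c : continuous (fun r => c * rho r).
  by move=> x; apply: cvgM; [exact: cvg_cst|exact: continuous_rho].
have mass c : \int[mu]_(r in `[t, t + d]) (c * rho r) = c.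
  by rewrite RintegralZl ?cutoff_mass ?mulr1//; exact: int_itv.
have -> : \int[mu]_(r in `[t, t + d]) (Q r * rho r) - Q t =
    \int[mu]_(r in `[t, t + d]) ((Q r - Q t) * rho r).
  rewrite -[X in _ - X](mass (Q t)) -RintegralB//; [|exact: int_itv|exact: int_itv].
  by apply: eq_Rintegral => r _; rewrite mulrBl.
apply: (le_trans (le_normr_Rintegral _ (int_itv cD))) => //.
rewrite -[leRHS](mass e); apply: le_Rintegral => //.
- by apply: int_itv => x; apply: cvg_norm; exact: cD.
- exact: int_itv.
move=> r /=; rewrite in_itv/= => /andP[tr rd].
by rewrite normrM (ger0_norm (rho_ge0 r)) ler_wpM2r// hQ.
Qed.

Lemma cutoff_pairing_memory (Q Q' : R -> R) : continuous Q ->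
  (forall r, r < T -> Q' r = Q r) -> (forall r, r <= 0 -> Q r = 0) ->
  \int[mu]_r (Q' r * derive1 (cutoff S t d) r) =
  - \int[mu]_(r in `[t, t + d]) (Q r * rho r).
Proof.
move=> cQ QQ Q0.
have cQr : continuous (fun r => Q r * rho r) by move=> x; apply: cvgM; [exact: cQ|exact: continuous_rho].
rewrite -mulN1r -RintegralZl//; last exact: int_itv.
rewrite [RHS]Rintegral_mkcond; apply: eq_Rintegral => r _.
rewrite patchE; have [Tr|rT] := leP T r.
  rewrite (test_function_derive1_ge cutoff_test Tr) mulr0 memNset//= in_itv/=.
  by apply/negP; rewrite negb_and -!ltNge (lt_le_trans tdT) ?orbT.
rewrite QQ//; have [r0|r0] := leP r 0.
  by rewrite Q0// mul0r memNset//= in_itv/=; apply/negP; rewrite negb_and -!ltNge (le_lt_trans r0).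
rewrite cutoff_derive1 (smooth_step_derive1_out (x := r + 2))//; last by right; lra.
rewrite sub0r; case: ifPn => [|rtd]; first by rewrite mulN1r mulrN.
rewrite [X in _ * - (_ * X)]smooth_step_derive1_out ?mulr0 ?oppr0 ?mulr0//.
move: rtd; rewrite mem_setE in_itv/= negb_and -!ltNge => /orP[rt|tdr]; [left|right].
  by rewrite pmulr_llt0 ?invr_gt0// subr_lt0.
by rewrite ltr_pdivlMr// mul1r ltrBrDl.
Qed.

Lemma cutoff_pairing_source N V : bnd N V ->
  fracint 0 V t <= fracint 0 (fun s => V s * cutoff S t d s) T /\
  fracint 0 (fun s => V s * cutoff S t d s) T <= fracint 0 V t + N * d.
Proof.
move=> hV; have z0 : -1 < (0 : R) <= 0 by rewrite ltrN10 lexx.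
have N0 := bnd_M_ge0 hV.
pose f s := V s * cutoff S t d s.
have hf : bnd N f.
  split.
    apply: measurable_funM; first exact: hV.1.
    exact: continuous_measurable_fun (test_function_continuous cutoff_test).
  move=> s; have /andP[V0 VN] := hV.2 s; have /andP[c0 c1] := cutoff_range s.
  by rewrite mulr_ge0//= -[leRHS]mulr1 ler_pM.
have tT : 0 <= T - t - d by move: (tdT); lra.
have e : fracint 0 f T = fracint 0 V t + fracint 0 (fun s => f (s + t)) d.
  rewrite -[in LHS](subrK t T) (fracint0_split hf (ltW t0)); last by move: (tdT) (d0); lra.
  congr (_ + _).
    by apply: eq_fracint => s s0 st; rewrite /f cutoff_eq1 ?mulr1// ltW.
  rewrite -[in LHS](subrK d (T - t)) (fracint0_split (bnd_shift t hf) (ltW d0))//.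
  rewrite [X in _ + X](@eq_fracint _ 0 _ (cst 0)) ?fracint_cst ?mul0r ?addr0//.
  by move=> s s0 _; rewrite /f cutoff_eq0 ?mulr0//; lra.
rewrite -/f e lerDl lerD2l; split; first exact: fracint_ge0 (bnd_shift t hf).
rewrite -(fracint0_cst N0 (ltW d0)).
apply: (le_fracint z0 (bnd_shift t hf) (bnd_cst N0)) => s _ _ /=.
by case/andP: (hf.2 (s + t)).
Qed.

End cutoff.

(** Test the equation against [cutoff S t d] and let [d] tend to 0. The left-hand side
    tends to the memory at time [t], which is continuous, and the right-hand side to
    the integral of [V] over ]0, t[. This gives the equation for every [t], although
    the strong formulation holds almost everywhere only. *)
Lemma weak_memory_equation (g T u0 M N B : R) P V W : 0 < g -> g < 1 -> 0 <= u0 ->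
  bnd M P -> bnd N V ->
  measurable_fun [set: R] W -> (forall t, `|W t| <= B) ->
  (forall s, s <= 0 -> W s = 0) -> (forall s, T <= s -> W s = 0) ->
  (forall s, 0 < s -> s < T -> W s = P s - u0) ->
  (forall phi, test_function T phi -> distr_conv (g_neg g) (of_fun W) phi =
     - \int[mu]_(t in `]0, T[) (V t * phi t)) ->
  forall t, 0 < t -> t < T ->
  fracint (- g) P t + Gamma (1 - g) * fracint 0 V t = u0 * fracint1 (- g) t.
Proof.
move=> g0 g1 u00 hP hV mW WB W0 WT WP weak t t0 tT.
have hk : -1 < - g <= 0 by rewrite ltrN2 g1 oppr_le0 ltW.
have hG : 0 < Gamma (1 - g) by rewrite addrC Gamma_gt0.
have hu := bnd_cst u00; have N0 := bnd_M_ge0 hV.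
have [S [sS S0 S1 homoS S'0]] := @smooth_step_exists R.
pose Q r := fracint (- g) P r - fracint (- g) (cst u0) r.
have cQ : continuous Q.
  by move=> x; apply: cvgB; [exact: (continuous_fracint hk hP)|exact: (continuous_fracint hk hu)].
have Q0 r : r <= 0 -> Q r = 0 by move=> r0; rewrite /Q !fracint_le0// subrr.
have kQ r : r < T -> \int[mu]_s (heaviside s * s `^ (- g) * W (r - s)) = Q r.
  move=> rT; apply: (memory_fracint g0 g1 hP hu mW W0) => s s0 sr.
  by rewrite WP// (lt_trans sr).
(* [e] bounds the oscillation of the memory [Q] on [t, t + d]. *)
have approx d : 0 < d -> t + d < T -> forall e,
    (forall r, t <= r -> r <= t + d -> `|Q r - Q t| <= e) ->
    `|Q t + Gamma (1 - g) * fracint 0 V t| <= e + Gamma (1 - g) * (N * d).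
  move=> d0 tdT e he.
  have tphi := cutoff_test sS S0 S1 t0 d0 tdT.
  have := weak _ tphi; rewrite (caputo_formula g0 g1 mW WB W0 WT tphi).
  rewrite (cutoff_pairing_memory sS S0 S1 t0 d0 tdT cQ kQ Q0).
  have [lb ub] := cutoff_pairing_source sS S0 S1 homoS t0 d0 tdT hV.
  have := cutoff_average sS S0 S1 S'0 d0 cQ he.
  have -> : \int[mu]_(s in `]0, T[) (V s * cutoff S t d s) =
      fracint 0 (fun s => V s * cutoff S t d s) T.
    have hVc : bnd N (fun s => V s * cutoff S t d s).
      split.
        apply: measurable_funM; first exact: hV.1.
        exact: continuous_measurable_fun (test_function_continuous tphi).
      move=> s; have /andP[V0 VN] := hV.2 s.
      have /andP[c0 c1] := cutoff_range S0 S1 homoS t0 d0 s.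
      by rewrite mulr_ge0//= -[leRHS]mulr1 ler_pM.
    rewrite (fracint0E T hVc) /Rintegral; apply: (congr1 fine).
    have m (A : set R) : measurable_fun A (EFin \o (fun s => V s * cutoff S t d s)).
      by apply: measurable_funTS; apply/measurable_EFinP; exact: hVc.1.
    by rewrite (integral_itv_bndo_bndc (m _)) (integral_itv_obnd_cbnd (m _)).
  move: lb ub; set I := fracint 0 _ T; set A := \int[mu]_(r in _) _.
  set v := fracint 0 V t.
  move=> lb ub hA; rewrite mulrN opprK => /(congr1 (fun x => Gamma (1 - g) * x)) /=.
  rewrite (mulVKf (lt0r_neq0 hG)) mulrN => AE.
  rewrite (_ : Q t + _ = - (A - Q t) - Gamma (1 - g) * (I - v)); last by rewrite AE; ring.
  apply: (le_trans (ler_normB _ _)); rewrite normrN; apply: lerD => //.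
  rewrite normrM (gtr0_norm hG) ler_wpM2l ?(ltW hG)// ger0_norm ?subr_ge0//.
  by rewrite lerBlDl.
have small e : 0 < e -> `|Q t + Gamma (1 - g) * fracint 0 V t| <= e + e.
  move=> e0; have := cQ t => /cvgrPdist_le /(_ e e0) /nbhs_ballP[d1 /= d10 hd1].
  pose d := Num.min (d1 / 2) (Num.min ((T - t) / 2) (e / (Gamma (1 - g) * (N + 1)))).
  have N1 : 0 < N + 1 by rewrite ltr_wpDl.
  have d0 : 0 < d by rewrite !lt_min !divr_gt0 ?subr_gt0// mulr_gt0.
  have dd1 : d <= d1 / 2 by rewrite ge_min lexx.
  have dT : d <= (T - t) / 2 by rewrite !ge_min lexx orbT.
  have de : d <= e / (Gamma (1 - g) * (N + 1)) by rewrite !ge_min lexx !orbT.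
  have tdT : t + d < T by move: dT tT; clearbody d; clear; lra.
  apply: (le_trans (approx d d0 tdT e _)) => [r tr rd|].
    rewrite distrC; apply: hd1; rewrite /ball/= distrC ger0_norm ?subr_ge0//.
    by move: dd1 rd d10; clearbody d; clear; lra.
  rewrite lerD2l; move: de; rewrite ler_pdivlMr ?mulr_gt0// => de.
  apply: le_trans de; rewrite [d * _]mulrC -mulrA ler_wpM2l ?(ltW hG)//.
  by rewrite ler_wpM2r ?(ltW d0)// lerDl.
have : Q t + Gamma (1 - g) * fracint 0 V t = 0.
  apply/eqP; rewrite -normr_le0 leNgt; apply/negP => n0.
  have := small (`|Q t + Gamma (1 - g) * fracint 0 V t| / 3); rewrite divr_gt0// => /(_ isT).
  by move: n0; set x := `|_|; clearbody x; clear; lra.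
rewrite /Q fracint_cst// => /eqP; rewrite addrAC subr_eq0 => /eqP; exact.
Qed.

End weak_equation.

(** * Inverting the memory equation *)

Section clamp.
Context {R : realType}.
Implicit Types (x y m : R).

Definition clamp m x : R := Num.min (Num.max x 0) m.

Lemma le_clamp m x y : x <= y -> clamp m x <= clamp m y.
Proof. by move=> xy; rewrite /clamp /Num.min /Num.max; case: (ltP x 0) => ?; case: (ltP y 0) => ?; repeat (case: ltP => ?); lra. Qed.

Lemma clamp_dist m x y : `|clamp m x - clamp m y| <= `|x - y|.
Proof.
wlog xy : x y / x <= y => [hw|].
  have [|/ltW] := leP x y; first exact: hw.
  by move=> /hw; rewrite distrC [`|y - x|]distrC.
rewrite distrC [`|x - y|]distrC !ger0_norm ?subr_ge0 ?le_clamp//.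
by rewrite /clamp /Num.min /Num.max; case: (ltP x 0) => ?; case: (ltP y 0) => ?; repeat (case: ltP => ?); lra.
Qed.

Lemma clamp_range m x : 0 <= m -> 0 <= clamp m x <= m.
Proof.
move=> m0; rewrite /clamp ge_min lexx orbT andbT le_min m0 andbT.
by rewrite le_max lexx orbT.
Qed.

Lemma clamp_id m x : 0 <= x -> x <= m -> clamp m x = x.
Proof. by move=> x0 xm; rewrite /clamp (max_idPl x0) (min_idPl xm). Qed.

Lemma clamp_le0 m x : 0 <= m -> x <= 0 -> clamp m x = 0.
Proof. by move=> m0 x0; rewrite /clamp (max_idPr x0) (min_idPl m0). Qed.

Lemma clamp_gt0 m x : 0 < m -> 0 < x -> 0 < clamp m x.
Proof. by move=> m0 x0; rewrite /clamp lt_min m0 andbT lt_max x0. Qed.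

Lemma continuous_clamp m : continuous (clamp m).
Proof.
by apply: (@lipschitz_continuous R 1) => // x y; rewrite mul1r clamp_dist.
Qed.

End clamp.

Section volterra_of_memory.
Context {R : realType}.
Implicit Types (T t r s M N : R) (P V : R -> R).

Lemma beta_sym (a b : R) : beta a b = beta b a.
Proof. by rewrite /beta (convC (mge0_pk a) (mge0_pk b)). Qed.

(** Convolving the memory equation with [t `^ (g - 1)] turns [t `^ (- g)] into a constant,
    hence gives the integrated form of the Volterra equation; the integrands are
    continuous, so that it may be differentiated. *)
Lemma volterra_of_memory (g T u0 M N : R) P V : 0 < g -> g < 1 -> 0 <= u0 ->
  bnd M P -> continuous P -> bnd N V ->
  (forall t, 0 < t -> t < T ->
    fracint (- g) P t + Gamma (1 - g) * fracint 0 V t = u0 * fracint1 (- g) t) ->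
  forall t, 0 < t -> t < T -> P t = u0 - fracint (g - 1) (fun s => rate g * V s) t.
Proof.
move=> g0 g1 u00 hP cP hV memo.
have hk : -1 < - g <= 0 by rewrite ltrN2 g1 oppr_le0 ltW.
have ha : -1 < g - 1 <= 0 by rewrite ltrBrDr addrC subrr g0 subr_le0 ltW.
have z0 : -1 < (0 : R) <= 0 by rewrite ltrN10 lexx.
have G0 : 0 < Gamma (1 - g) by rewrite addrC Gamma_gt0.
pose B : R := beta (g - 1) (- g); have B0 : 0 < B by exact: beta_gt0.
have hGV := bndZ (ltW G0) hV; have hu := bnd_cst u00.
pose GV s := Gamma (1 - g) * V s.
(* The argument is clamped to have a bounded function; only times in [0, T] matter. *)
pose Z s := fracint (g - 1) GV (clamp T s).
have hZ : bnd (Gamma (1 - g) * N * fracint1 (g - 1) T) Z.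
  split.
    apply: (measurableT_comp (continuous_measurable_fun (continuous_fracint ha hGV))).
    exact: continuous_measurable_fun (@continuous_clamp R T).
  move=> s; rewrite (fracint_ge0 _ _ hGV)/=.
  apply: (@le_trans _ _ (fracint (g - 1) (cst (Gamma (1 - g) * N)) (clamp T s))).
    have h r : 0 < r -> r < clamp T s -> GV r <= cst (Gamma (1 - g) * N) r.
      by move=> _ _; case/andP: (hGV.2 r).
    exact: (le_fracint ha hGV (bnd_cst (bnd_M_ge0 hGV)) h).
  rewrite fracint_cst ?(bnd_M_ge0 hGV)// ler_wpM2l ?(bnd_M_ge0 hGV)//.
  by apply: le_fracint1 => //; rewrite /clamp ge_min lexx orbT.
have pa := mge0_pk (R := R) (g - 1); have pk_ := mge0_pk (R := R) (- g).
have p0 := mge0_pk (R := R) 0.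
(* The two kernels compose to [B] times an integration. *)
have cg D s : mge0 D -> conv (pk (g - 1)) (conv (pk (- g)) D) s = (B%:E * conv (pk 0) D s)%E.
  move=> hD; rewrite (convA pa pk_ hD) -(convZl _ p0 hD (ltW B0)).
  congr conv; apply/funext => r; rewrite conv_pk_pk// (_ : g - 1 + - g + 1 = 0); last by lra.
  by rewrite /pk /causal -EFinM; congr EFin; rewrite /B; ring.
(* The Volterra equation, multiplied by [B] and integrated over ]0, t[. *)
have int_eq t : 0 < t -> t < T -> fracint 0 (fun s => B * P s + Z s) t = B * u0 * t.
  move=> t0 tT.
  have hBP := bndZ (ltW B0) hP.
  rewrite (fracintD t z0 hBP hZ) (fracintZ t z0 (ltW B0) hP).
  rewrite -mulrA -(fracint0_cst u00 (ltW t0)).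
  apply: EFin_inj; rewrite EFinD !EFinM (fracintE t z0 hP) (fracintE t z0 hu) (fracintE t z0 hZ).
  have mP := mge0_bnd hP; have mu_ := mge0_bnd hu; have mG := mge0_bnd hGV.
  rewrite -(cg _ t mP) -(cg _ t mu_).
  have -> : conv (pk 0) (causal Z) t = conv (pk (g - 1)) (conv (pk 0) (causal GV)) t.
    rewrite (convA pa p0 mG) (convC pa p0) -(convA p0 pa mG).
    rewrite (@eq_conv _ 0 Z (fracint (g - 1) GV) t); last first.
      by move=> s s0 st; rewrite /Z clamp_id// ltW// (lt_trans st).
    congr conv; apply/funext => s; have [s0|s0] := ltP 0 s.
      by rewrite causal_gt0// (fracintE s ha hGV).
    by rewrite causal_le0// conv_le0.
  rewrite -(convDr t pa (mge0_conv pk_ mP) (mge0_conv p0 mG)).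
  apply: eq_integral => s _.
  have [st|ts] := ltP s t; last first.
    have z : pk (g - 1) (t - s) = 0%E by rewrite /pk causal_le0// subr_le0.
    by rewrite z !mul0e.
  congr (_ * _)%E; have [s0|s0] := leP s 0.
    by rewrite /= !conv_le0// adde0.
  rewrite /= -(fracintE s hk hP) -(fracintE s z0 hGV) -(fracintE s hk hu) -EFinD.
  congr EFin; rewrite (fracintZ s z0 (ltW G0) hV) fracint_cst//.
  by rewrite memo// (lt_trans st).
move=> t t0 tT.
have cZ : continuous Z.
  move=> s; apply: (@continuous_comp _ _ _ (clamp T) (fracint (g - 1) GV)).
    exact: continuous_clamp.
  exact: (continuous_fracint ha hGV).
have cphi : continuous (fun s => B * P s + Z s).
  by move=> s; apply: cvgD; [apply: cvgM; [exact: cvg_cst|exact: cP]|exact: cZ].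
have dphi := fracint0_derive (bndD (bndZ (ltW B0) hP) hZ) cphi t0.
have nt : \near t, B * u0 * t = fracint 0 (fun s => B * P s + Z s) t.
  near=> s; rewrite int_eq//; near: s; [exact: lt_nbhsr|exact: lt_nbhsl].
have dlin : is_derive t (1 : R) (fun s => B * u0 * s) (B * u0).
  have := is_derive_affine (B * u0) 0 t.
  by rewrite (_ : affine _ _ = fun s => B * u0 * s)//; apply/funext => s; rewrite /affine addr0.
have d2 := near_eq_is_derive nt dlin.
have : B * P t + Z t = B * u0 :=
  etrans (esym (derive_val (is_derive := dphi))) (derive_val (is_derive := d2)).
rewrite /Z (clamp_id (ltW t0) (ltW tT)).
rewrite (fracintZ t ha (ltW G0) hV) (fracintZ t ha _ hV) ?(ltW (rate_gt0 g0 g1))// => e.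
apply: (mulfI (lt0r_neq0 B0)); rewrite mulrBr -e /rate [beta (- g) _]beta_sym -/B.
rewrite (_ : B * (Gamma (1 - g) / B * _) = Gamma (1 - g) * fracint (g - 1) V t).
  by rewrite addrK.
by rewrite mulrA mulrCA divff ?mulr1// gt_eqF.
Unshelve. all: by end_near. Qed.

End volterra_of_memory.

(** * The power nonlinearity *)

Section power_nonlinearity.
Context {R : realType}.
Implicit Types (p m x y : R).

(** The mean value theorem, for positive arguments; at 0 a direct comparison, since the
    power need not be differentiable there. *)
Lemma powR_lipschitz p m x y : 1 <= p -> 0 <= x -> x <= m -> 0 <= y -> y <= m ->
  `|x `^ p - y `^ p| <= p * m `^ (p - 1) * `|x - y|.
Proof.
move=> p1 x0 xm y0 ym; wlog yx : x y x0 xm y0 ym / y <= x => [hw|].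
  have [|/ltW] := leP y x; first exact: hw.
  by rewrite distrC [`|x - y|]distrC; exact: hw.
have pm1 : 0 <= p - 1 by rewrite subr_ge0.
have p0 : 0 < p by exact: lt_le_trans p1.
have mono c : 0 <= c -> c <= m -> c `^ (p - 1) <= m `^ (p - 1).
  by move=> c0 cm; apply: ge0_ler_powR; rewrite ?nnegrE// (le_trans c0).
have xyp : y `^ p <= x `^ p by apply: ge0_ler_powR; rewrite ?nnegrE// ltW.
rewrite !ger0_norm ?subr_ge0//.
move: yx; rewrite le_eqVlt => /predU1P[->|yx]; first by rewrite !subrr mulr0.
move: y0; rewrite le_eqVlt => /predU1P[yE|y0].
  have xp : 0 < x by rewrite yE.
  rewrite -yE.
  have -> : x `^ p = x `^ (p - 1) * x.
    by rewrite -{3}(powRr1 x0) -powRD ?subrK// (gt_eqF xp) implybT.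
  rewrite powR0 ?gt_eqF// !subr0 ler_wpM2r//.
  by apply: (le_trans (mono x x0 xm)); rewrite ler_peMl ?powR_ge0.
have dx z : z \in `]y, x[ -> is_derive z (1 : R) (fun x => x `^ p) (p * z `^ (p - 1)).
  by rewrite in_itv/= => /andP[yz _]; apply: is_derive1_powR; exact: lt_trans yz.
have cx : {within `[y, x], continuous (fun x => x `^ p)}.
  apply: continuous_in_subspaceT => z; rewrite inE/= in_itv/= => /andP[yz _].
  apply/differentiable_continuous/derivable1_diffP/derivable_powR.
  by rewrite in_itv/= (lt_le_trans y0).
have [c] := MVT yx dx cx; rewrite in_itv/= => /andP[yc cx'] ->.
rewrite ler_wpM2r ?subr_ge0 ?(ltW yx)// ler_wpM2l ?(ltW p0)// mono//.
  by rewrite ltW// (lt_trans y0).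
by rewrite ltW// (lt_le_trans cx').
Qed.

(** Clamping to [0, u0] makes the nonlinearity [- A * x `^ p] nondecreasing, bounded and
    globally Lipschitz, and changes nothing for functions with values in [0, u0]. *)
Definition clamped_power (A p u0 x : R) : R := - A * clamp u0 x `^ p.

End power_nonlinearity.

Section continuous_positive_solutions.
Context {R : realType}.
Local Notation mu := (@lebesgue_measure R).

Lemma continuous_zero_left (d : R -> R) T : 0 < T -> continuous d ->
  (forall s, 0 < s -> s < T -> d s = 0) -> d 0 = 0.
Proof.
move=> T0 cd d0; apply/eqP; rewrite -normr_le0 leNgt; apply/negP => n0.
have := cd 0 => /cvgrPdist_lt /(_ _ n0) /nbhs_ballP[e /= e0 he].
pose s := Num.min (e / 2) (T / 2).
have s0 : 0 < s by rewrite lt_min !divr_gt0.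
have sT : s < T.
  by apply: (@le_lt_trans _ _ (T / 2)); [rewrite ge_min lexx orbT|rewrite ltr_pdivrMr// ltr_pMr// ltr1n].
have se : s < e.
  by apply: (@le_lt_trans _ _ (e / 2)); [rewrite ge_min lexx|rewrite ltr_pdivrMr// ltr_pMr// ltr1n].
have : `|d 0 - d s| < `|d 0|.
  by apply: he; rewrite /ball/= sub0r normrN gtr0_norm.
by rewrite (d0 s s0 sT) subr0 ltxx.
Qed.

(** Clamping the argument extends a solution on [0, T] by constants to a continuous
    function on the whole line. *)
Lemma continuous_clamp_within (v : R -> R) (Tb : \bar R) T : 0 <= T -> (T%:E < Tb)%E ->
  {within [set t : R | 0 <= t /\ (t%:E < Tb)%E], continuous v} ->
  continuous (fun s => v (clamp T s)).
Proof.
move=> T0 TTb /subspace_continuousP cv s.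
have /andP[c0 cT] := clamp_range s T0.
have Dc r : 0 <= clamp T r /\ ((clamp T r)%:E < Tb)%E.
  have /andP[h1 h2] := clamp_range r T0; split => //.
  by apply: le_lt_trans TTb; rewrite lee_fin.
have := cv _ (Dc s) => cvs P /cvs /= hP.
have hQ : \forall x \near clamp T s, 0 <= x /\ (x%:E < Tb)%E -> P (v x) by exact: hP.
have hr : \forall r \near s, P (v (clamp T r)).
  have hQ' : \forall r \near s, 0 <= clamp T r /\ ((clamp T r)%:E < Tb)%E -> P (v (clamp T r)).
    exact: (@continuous_clamp R T s _ hQ).
  by apply: filterS hQ' => r; apply; exact: Dc.
exact: hr.
Qed.

Lemma bounded_clamp (v : R -> R) T : continuous (fun s => v (clamp T s)) -> 0 <= T ->
  exists M, forall s, `|v (clamp T s)| <= M.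
Proof.
move=> cv T0; pose P s := v (clamp T s).
have /compact_bounded[N [_ hN]] : compact (P @` `[0, T]).
  apply: continuous_compact; last exact: segment_compact.
  exact: continuous_subspaceT.
have hN1 : N < `|N| + 1 by apply: (le_lt_trans (ler_norm N)); rewrite ltrDl.
exists (`|N| + 1) => s; apply: (hN _ hN1).
have /andP[h1 h2] := clamp_range s T0.
by exists (clamp T s); rewrite /= ?in_itv/= ?h1 ?h2// /P clamp_id.
Qed.

(** The memory equation is derived and inverted for the power itself. Only then does it
    follow that [v <= u0], the fractional integral being nonnegative, and that the
    power may be replaced by the clamped one. *)
Lemma volterra_of_positive_solution (g p u0 A T : R) (Tb : \bar R) (v : R -> R) :
  0 < g -> g < 1 -> 1 <= p -> 0 < u0 -> A < 0 -> 0 < T -> (T%:E < Tb)%E ->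
  positive_solution g (fun x => A * x `^ p) u0 Tb v ->
  [/\ continuous (fun s => v (clamp T s)),
      exists M, bnd M (fun s => v (clamp T s)) &
      forall t, 0 < t -> t < T -> v (clamp T t) = u0 -
        fracint (g - 1) (fun s => rate g * clamped_power A p u0 (v (clamp T s))) t].
Proof.
move=> g0 g1 p1 u00 A0 T0 TTb [cv v0 sol].
have p0 : 0 < p by exact: lt_le_trans p1.
pose P s := v (clamp T s).
have cP : continuous P by exact: continuous_clamp_within (ltW T0) TTb cv.
have [M hM] := bounded_clamp cP (ltW T0).
have P0 s : 0 < P s.
  have /andP[h1 h2] := clamp_range s (ltW T0); apply: v0 => //.
  by apply: le_lt_trans TTb; rewrite lee_fin.
have bP : bnd M P.
  split; first exact: continuous_measurable_fun.
  by move=> s; rewrite (ltW (P0 s))/= (le_trans (ler_norm _) (hM s)).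
have M0 := bnd_M_ge0 bP.
pose V s := - A * P s `^ p.
have bV : bnd (- A * M `^ p) V.
  split.
    apply: measurable_funM => //.
    exact: (measurableT_comp (@measurable_powR R p) (continuous_measurable_fun cP)).
  move=> s; have /andP[_ PM] := bP.2 s.
  rewrite mulr_ge0 ?powR_ge0 ?oppr_ge0 ?(ltW A0)//= ler_wpM2l ?oppr_ge0 ?(ltW A0)//.
  by apply: ge0_ler_powR; rewrite ?nnegrE ?(ltW p0) ?(ltW (P0 s)).
pose W t := (v t - u0) * heaviside t * \1_(`]-oo, T[ : set R) t.
have W0 s : s <= 0 -> W s = 0 by move=> s0; rewrite /W heaviside_le0// mulr0 mul0r.
have WT s : T <= s -> W s = 0.
  move=> Ts; rewrite /W indicE memNset ?mulr0//= in_itv/=.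
  by apply/negP; rewrite -leNgt.
have WP s : 0 < s -> s < T -> W s = P s - u0.
  move=> s0 sT; have e : \1_(`]-oo, T[ : set R) s = 1 :> R.
    by rewrite indicE mem_set//= in_itv.
  by rewrite /W heaviside_gt0// e !mulr1 /P clamp_id ?(ltW s0) ?(ltW sT).
have WE : W = fun s => (P s - u0) * heaviside s * \1_(`]-oo, T[ : set R) s.
  apply/funext => s; have [s0|s0] := leP s 0.
    by rewrite W0// heaviside_le0// mulr0 mul0r.
  have [Ts|sT] := leP T s.
    by rewrite WT// indicE memNset ?mulr0//= in_itv/=; apply/negP; rewrite -leNgt.
  rewrite WP// heaviside_gt0// mulr1 (_ : \1_ _ s = 1) ?mulr1//.
  by rewrite indicE mem_set//= in_itv.
have mW : measurable_fun [set: R] W.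
  rewrite WE; apply: measurable_funM; last exact: measurable_indic.
  apply: measurable_funM; last exact: measurable_heaviside.
  by apply: measurable_funB => //; exact: bP.1.
have WB s : `|W s| <= M + u0.
  have [s0|s0] := leP s 0; first by rewrite W0// normr0 addr_ge0// ltW.
  have [Ts|sT] := leP T s; first by rewrite WT// normr0 addr_ge0// ltW.
  rewrite WP//; apply: (le_trans (ler_normB _ _)).
  by rewrite (gtr0_norm u00) lerD2r hM.
have [_ _ [h [ih weak aeh]]] := sol T T0 TTb.
have weakV phi : test_function T phi -> distr_conv (g_neg g) (of_fun W) phi =
    - \int[mu]_(t in `]0, T[) (V t * phi t).
  move=> tphi; rewrite -[LHS]/(caputo g T v u0 phi) weak//.
  have cphi := test_function_continuous tphi.
  have iV : mu.-integrable `]0, T[ (EFin \o (fun t => V t * phi t)).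
    have cVphi : continuous (fun t => V t * phi t).
      move=> t; apply: cvgM; last exact: cphi.
      apply: cvgM; first exact: cvg_cst.
      apply: (@continuous_comp _ _ _ P (fun x => x `^ p)); first exact: cP.
      apply/differentiable_continuous/derivable1_diffP/derivable_powR.
      by rewrite in_itv/= P0.
    apply: (@integrableS _ _ _ mu `[0, T]) => //; first exact: subset_itv_oo_cc.
    apply: continuous_compact_integrable; first exact: segment_compact.
    exact: continuous_subspaceT.
  rewrite -mulN1r -RintegralZl//.
  apply: (congr1 fine); apply: ae_eq_integral => //.
  - apply/measurable_EFinP; apply: measurable_funM.
      by apply/measurable_EFinP; exact: (measurable_int mu ih).
    by apply: measurable_funTS; exact: continuous_measurable_fun.
  - apply/measurable_EFinP; apply: measurable_funM => //.
    by apply/measurable_EFinP; exact: (measurable_int mu iV).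
  - have [N [mN N0 sub]] := aeh; exists N; split => // t /= ht; apply: sub => /= hA; apply: ht => tT.
    rewrite hA//; move: tT; rewrite in_itv/= => /andP[t0 tT].
    by rewrite /V /P clamp_id ?(ltW t0) ?(ltW tT)// mulN1r mulNr mulNr opprK.
have memo := weak_memory_equation g0 g1 (ltW u00) bP bV mW WB W0 WT WP weakV.
have volt := volterra_of_memory g0 g1 (ltW u00) bP cP bV memo.
split; [exact: cP|by exists M|move=> t t0 tT].
rewrite -/(P t) volt//; congr (_ - _); apply: eq_fracint => s s0 st; congr (_ * _).
rewrite /clamped_power /V clamp_id//; first exact/ltW/P0.
rewrite -/(P s) volt ?(lt_trans st)// gerBl.
have r0 := rate_gt0 g0 g1.
exact: fracint_ge0 (bndZ (ltW r0) bV).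
Qed.

End continuous_positive_solutions.

Section clamped_power_theory.
Context {R : realType}.
Variables (A p u0 : R).
Hypotheses (A0 : A < 0) (p1 : 1 <= p) (u00 : 0 < u0).
Local Notation F := (clamped_power A p u0).

Let p0 : 0 < p. Proof. exact: lt_le_trans p1. Qed.
Let NA0 : 0 <= - A. Proof. by rewrite oppr_ge0 ltW. Qed.

Lemma clamped_power_range x : 0 <= F x <= - A * u0 `^ p.
Proof.
have /andP[c0 cu] := clamp_range x (ltW u00).
rewrite /clamped_power mulr_ge0 ?powR_ge0//= ler_wpM2l//.
by apply: ge0_ler_powR; rewrite ?nnegrE ?(ltW p0) ?(ltW u00).
Qed.

Lemma clamped_power_lipschitz x y :
  `|F x - F y| <= - A * (p * u0 `^ (p - 1)) * `|x - y|.
Proof.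
have /andP[x0 xu] := clamp_range x (ltW u00).
have /andP[y0 yu] := clamp_range y (ltW u00).
rewrite /clamped_power -mulrBr normrM (ger0_norm NA0) -mulrA ler_wpM2l//.
apply: (le_trans (powR_lipschitz p1 x0 xu y0 yu)); rewrite ler_wpM2l ?clamp_dist//.
by rewrite mulr_ge0 ?powR_ge0 ?(ltW p0).
Qed.

Lemma clamped_power_homo : {homo F : x y / x <= y}.
Proof.
move=> x y xy; have /andP[x0 _] := clamp_range x (ltW u00).
have /andP[y0 _] := clamp_range y (ltW u00).
rewrite /clamped_power ler_wpM2l//.
by apply: ge0_ler_powR; rewrite ?nnegrE ?(ltW p0)// le_clamp.
Qed.

Lemma clamped_power_le0 x : x <= 0 -> F x = 0.
Proof.
move=> x0; rewrite /clamped_power (clamp_le0 (ltW u00) x0) powR0 ?mulr0//.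
by rewrite gt_eqF.
Qed.

Lemma clamped_power_gt0 x : 0 < x -> 0 < F x.
Proof.
by move=> x0; rewrite /clamped_power mulr_gt0 ?oppr_gt0 ?powR_gt0// clamp_gt0.
Qed.

Lemma clamped_power_id x : 0 <= x -> x <= u0 -> F x = - A * x `^ p.
Proof. by move=> x0 xu; rewrite /clamped_power clamp_id. Qed.

Lemma continuous_clamped_power : continuous F.
Proof.
apply: lipschitz_continuous clamped_power_lipschitz.
by rewrite !mulr_ge0 ?powR_ge0 ?(ltW p0).
Qed.

End clamped_power_theory.

Section comparison.
Context {R : realType}.

(** Both functions solve the same Volterra equation on ]0, T[; at time 0 continuity
    concludes. *)
Lemma positive_solution_unique (g p u0 A T : R) (Tb : \bar R) (u v : R -> R) :
  0 < g -> g < 1 -> 1 <= p -> 0 < u0 -> A < 0 -> 0 < T -> (T%:E < Tb)%E ->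
  measurable_fun [set: R] u ->
  (forall t, u t = u0 -
     fracint (g - 1) (fun s => rate g * clamped_power A p u0 (u s)) t) ->
  continuous u ->
  positive_solution g (fun x => A * x `^ p) u0 Tb v ->
  forall t : R, 0 <= t -> t < T -> v t = u t.
Proof.
move=> g0 g1 p1 u00 A0 T0 TTb mu' eu cu sol.
have [cP [M bP] eP] := volterra_of_positive_solution g0 g1 p1 u00 A0 T0 TTb sol.
pose P s := v (clamp T s).
have p0 : 0 < p by exact: lt_le_trans p1.
pose K : R := - A * (p * u0 `^ (p - 1)).
have L0 : 0 <= K by rewrite /K !mulr_ge0 ?powR_ge0 ?(ltW p0) ?oppr_ge0 ?(ltW A0).
have FM := clamped_power_range A0 p1 u00.
have lipF := clamped_power_lipschitz A0 p1 u00.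
have r0 := rate_gt0 g0 g1.
have hg : -1 < g - 1 <= 0 by rewrite ltrBrDl subrr g0 subr_le0 ltW.
have rK0 : 0 <= rate g * K by rewrite mulr_ge0// ltW.
have lipr (w1 w2 : R -> R) s : `|rate g * clamped_power A p u0 (w1 s) -
    rate g * clamped_power A p u0 (w2 s)| <= rate g * K * `|w1 s - w2 s|.
  rewrite -mulrBr normrM (gtr0_norm r0) -mulrA; apply: ler_wpM2l; first exact: ltW.
  exact: lipF.
have eqPu s : 0 < s -> s < T -> P s = u s.
  move=> s0 sT.
  apply: (@volterra_unique R (g - 1) (rate g * K) _ T (cst u0) P u
    (fun _ x => rate g * clamped_power A p u0 x) hg rK0 bP.1 mu'
    (bndrF g0 g1 L0 FM lipF bP.1) (bndrF g0 g1 L0 FM lipF mu') (lipr P u) _ _ _ s0 sT).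
  - exact: eP.
  - by move=> t _ _; exact: eu.
have P0 : P 0 = u 0.
  apply/eqP; rewrite -subr_eq0; apply/eqP.
  apply: (@continuous_zero_left R (fun s => P s - u s) T) => //.
    by move=> s; apply: cvgB; [exact: cP|exact: cu].
  by move=> s s0 sT; rewrite eqPu// subrr.
move=> t t0 tT; have -> : v t = P t by rewrite /P clamp_id// ltW.
by move: t0; rewrite le_eqVlt => /predU1P[<-|t0]; [exact: P0|exact: eqPu].
Qed.

(** Solving the lower bound on the source for [w]. *)
Lemma powR_lower_bound (A p u0 G t w x : R) : A < 0 -> 1 <= p -> 0 < u0 -> 0 < G ->
  0 <= w -> u0 / 8%:R * t `^ (- x) <= G * (- A * w `^ p) ->
  (u0 / (8%:R * - A)) `^ p^-1 * (t `^ (- (x / p)) / G `^ p^-1) <= w.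
Proof.
move=> A0 p1 u00 G0 w0 h.
have p0 : 0 < p by exact: lt_le_trans p1.
have NA0 : 0 < - A by rewrite oppr_gt0.
have C0 : 0 <= u0 / (8%:R * - A) by rewrite divr_ge0 ?mulr_ge0 ?(ltW u00) ?(ltW NA0).
have Gp : 0 < G `^ p^-1 by exact: powR_gt0.
have e : t `^ (- (x / p)) = (t `^ (- x)) `^ p^-1 by rewrite -powRrM mulNr.
rewrite e mulrA ler_pdivrMr// -powRM ?powR_ge0//.
have -> : w * G `^ p^-1 = (w `^ p * G) `^ p^-1.
  by rewrite powRM ?powR_ge0 ?(ltW G0)// -powRrM mulfV ?gt_eqF// powRr1.
apply: ge0_ler_powR; rewrite ?nnegrE ?invr_ge0 ?(ltW p0)//.
- exact: mulr_ge0 C0 (powR_ge0 _ _).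
- exact: mulr_ge0 (powR_ge0 _ _) (ltW G0).
- rewrite invfM mulrA mulrAC ler_pdivrMr//.
  by apply: (le_trans h); rewrite mulrC -mulrA mulrC.
Qed.

End comparison.

Theorem theorem5p10 (R : realType) (p u0 A : R)
    (hp : 1 <= p) (hu0 : 0 < u0) (hA : A < 0) :
  exists C : R, 0 < C /\
    forall gamma : R, 0 < gamma -> gamma < 1 ->
    exists (Tb : \bar R) (u : R -> R),
      unique_maximal_solution gamma (fun x => A * x `^ p) u0 Tb u /\
      [/\ Tb = +oo%E,
          forall t : R, 0 < t -> 0 < u t,
          forall s t : R, 0 <= s -> s < t -> u t < u s,
          u t @[t --> +oo] --> (0 : R) &
          \forall t \near +oo,
            C * (t `^ (- (gamma / p)) / Gamma (1 - gamma) `^ p^-1) <= u t].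
Proof.
have p0 : 0 < p by exact: lt_le_trans hp.
have NA0 : 0 < - A by rewrite oppr_gt0.
(* The number 8 is the one of [solution_F_ge]. *)
exists ((u0 / (8%:R * - A)) `^ p^-1); split.
  by rewrite powR_gt0// divr_gt0// mulr_gt0.
move=> g g0 g1.
pose F := clamped_power A p u0.
pose L : R := - A * (p * u0 `^ (p - 1)).
have L0 : 0 <= L by rewrite /L !mulr_ge0 ?powR_ge0 ?(ltW p0) ?(ltW NA0).
have FM := clamped_power_range hA hp hu0.
have lipF := clamped_power_lipschitz hA hp hu0.
have homoF := clamped_power_homo hA hp hu0.
have F_le0 := clamped_power_le0 A hp hu0.
have F_gt0 := @clamped_power_gt0 R A p u0 hA hu0.
have [u [mu' eu]] := solution_exists u0 g0 g1 L0 FM lipF.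
have cu := solution_continuous g0 g1 L0 FM lipF mu' eu.
have upos := solution_gt0 g0 g1 hu0 L0 homoF FM lipF F_le0 F_gt0 mu' eu.
have ule := solution_le g0 g1 L0 FM lipF mu' eu.
have ule0 := solution_le0 eu.
have u0E : u 0 = u0 by exact: ule0.
have fu t : A * u t `^ p = - F (u t).
  by rewrite /F clamped_power_id ?(ltW (upos t)) ?ule// mulNr opprK.
exists +oo%E, u; split; first split => //.
- split.
  + exact: continuous_subspaceT.
  + by move=> t _ _; exact: upos.
  + move=> T T0 _.
    apply: (strong_solution_of_memory (F := F) g0 g1 T0 cu _ u0E ule0 _ FM fu).
    * by move=> t; rewrite (ltW (upos t)) ule.
    * exact: continuous_clamped_power.
    * exact: (solution_fracintE g0 g1 L0 FM lipF mu' eu).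
- move=> Tb v Tb0 sol; split; first exact: leey.
  move=> t t0 tTb.
  have [T [T0 tT TTb]] : exists T, [/\ 0 < T, t < T & (T%:E < Tb)%E].
    case: Tb tTb {Tb0 sol} => [b| |//] tb.
      rewrite lte_fin in tb; exists ((t + b) / 2).
      have [h1 h2] := midf_lt tb.
      by split; rewrite ?lte_fin//; apply: le_lt_trans h1.
    by exists (t + 1); rewrite ltry; split; rewrite ?ltrDl// ltr_wpDl.
  exact: (positive_solution_unique g0 g1 hp hu0 hA T0 TTb mu' eu cu sol t0 tT).
- split => //.
  + by move=> s t s0 st; exact: (solution_decreasing g0 g1 hu0 L0 homoF FM lipF F_le0 F_gt0 mu' eu s0 st).
  + exact: (solution_cvg0 g0 g1 hu0 L0 homoF FM lipF F_le0 F_gt0 mu' eu).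
  + have := solution_F_ge g0 g1 hu0 L0 homoF FM lipF F_le0 F_gt0 mu' eu.
    apply: filterS => t ht; apply: powR_lower_bound => //; last 1 first.
    * by move: ht; rewrite clamped_power_id ?(ltW (upos t)) ?ule.
    * by rewrite addrC Gamma_gt0// ltrN2 g1 oppr_le0 ltW.
    * exact/ltW/upos.
Qed.
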